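(* Let $\{X_{k,i}; i \geq 1, k \geq 1\}$ be an array of i.i.d. random variables, write $X_i = X_{1,i}$ for $i \geq 1$, and let $\{p_n; n \geq 1\}$ be a sequence of positive integers such that $n/p_n$ is bounded away from $0$ and $\infty$. For $n \geq 2$ and $1 \leq i \leq p_n$ let $\bar{X}_i^{(n)} = \frac{1}{n}\sum_{k=1}^n X_{k,i}$, and for $1 \leq i, j \leq p_n$ let $$\hat{\rho}_{i,j}^{(n)} = \frac{\sum_{k=1}^n (X_{k,i} - \bar{X}_i^{(n)})(X_{k,j} - \bar{X}_j^{(n)})}{\big(\sum_{k=1}^n (X_{k,i} - \bar{X}_i^{(n)})^2\big)^{1/2} \big(\sum_{k=1}^n (X_{k,j} - \bar{X}_j^{(n)})^2\big)^{1/2}},$$ and let $L_n = \max_{1 \leq i < j \leq p_n} |\hat{\rho}_{i,j}^{(n)}|$. If $X_1$ is nondegenerate and $$\sum_{n=1}^{\infty} P\Big(\max_{1 \leq i < j \leq n} |X_i X_j| \geq \sqrt{n \log n}\Big) < \infty,$$ then $$\lim_{n \to \infty} \Big(\frac{n}{\log n}\Big)^{1/2} L_n = 2 \quad \text{a.s.}$$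
   Context: $\log$ denotes the natural logarithm. *)

(* Defs.v *)
From HB Require Import structures.
From mathcomp Require Import all_boot all_order all_algebra.
From mathcomp Require Import all_classical all_reals all_analysis.
Set Implicit Arguments. Unset Strict Implicit. Unset Printing Implicit Defensive.
Import Order.TTheory GRing.Theory Num.Theory.
Import numFieldNormedType.Exports.
Local Open Scope classical_set_scope.
Local Open Scope ring_scope.

Definition mutually_independent d (T : measurableType d) (R : realType)
  (P : probability T R) (I : eqType) (D : set I) (Y : I -> T -> R) : Prop :=
  forall (J : seq I) (B : I -> set R),
    uniq J -> (forall j, j \in J -> D j) -> (forall j, measurable (B j)) ->
    P (\bigcap_(j in [set j | j \in J]) (Y j @^-1` B j)) =
    (\prod_(j <- J) P (Y j @^-1` B j))%E.

Definition identically_distributed d (T : measurableType d) (R : realType)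
  (P : probability T R) (I : Type) (D : set I) (Y : I -> T -> R) : Prop :=
  forall i j (B : set R), D i -> D j -> measurable B ->
    P (Y i @^-1` B) = P (Y j @^-1` B).

Definition iid d (T : measurableType d) (R : realType)
  (P : probability T R) (I : eqType) (D : set I) (Y : I -> T -> R) : Prop :=
  [/\ forall i, D i -> measurable_fun setT (Y i),
      mutually_independent P D Y & identically_distributed P D Y].

Definition colmean (R : realType) (T : Type) (X : nat -> nat -> T -> R)
  (n i : nat) (w : T) : R :=
  (\sum_(1 <= k < n.+1) X k i w) / n%:R.

Definition sample_corr (R : realType) (T : Type) (X : nat -> nat -> T -> R)
  (n i j : nat) (w : T) : R :=
  (\sum_(1 <= k < n.+1) (X k i w - colmean X n i w) * (X k j w - colmean X n j w))
  / (Num.sqrt (\sum_(1 <= k < n.+1) (X k i w - colmean X n i w) ^+ 2) *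
     Num.sqrt (\sum_(1 <= k < n.+1) (X k j w - colmean X n j w) ^+ 2)).

Definition Lmax (R : realType) (T : Type) (X : nat -> nat -> T -> R)
  (p : nat -> nat) (n : nat) (w : T) : R :=
  \big[Num.max/0]_(1 <= i < (p n).+1)
     \big[Num.max/0]_(i.+1 <= j < (p n).+1) `|sample_corr X n i j w|.

(* Main.v *)
Require Import Defs.
From HB Require Import structures.
From mathcomp Require Import all_boot all_order all_algebra.
From mathcomp Require Import all_classical all_reals all_analysis.
From mathcomp Require Import measurable_realfun lebesgue_Rintegral ring lra.
Set Implicit Arguments. Unset Strict Implicit. Unset Printing Implicit Defensive.
Import Order.TTheory GRing.Theory Num.Theory.
Import numFieldNormedType.Exports.
Local Open Scope classical_set_scope.
Local Open Scope ring_scope.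

(** Correlations are invariant under affine changes of the entries, so the
    entries may be standardized, and n times a sample correlation is then the
    inner product of two columns up to a factor 1 + o(1) and an error
    o(sqrt (n log n)), provided the column sums and the column sums of squares
    obey crude almost sure bounds.  The summability hypothesis forces
    P(|X| >= t) = O(t^-5), hence finite fourth moments, and makes all products
    X_ki X_kj of entries in the same row eventually smaller than
    e sqrt (n log n), for every e > 0.  Replacing products above this level
    by 0, the moment generating function of an inner product at
    t sqrt (log n / n) is computed to the second order, its cubic error being
    controlled by the third moment of the products; this gives the tail
    n^(-x^2/2 + o(1)) at x sqrt (n log n).  With about n^2 pairs of columns,
    x = 2 is critical: a union bound gives the upper bound, and the
    second-moment method the lower bound, since even for two pairs sharing a
    column the joint tail is n^(-x^2 + o(1)).  These estimates are made
    at the end points of the blocks [c 2^l, (c + 1) 2^l] with c large, where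
    they are summable in l; the increments inside a block are negligible. *)

(** * Independence and generated sigma-algebras *)

(** The obstacle: the union bound over about n^2 pairs at level (2 + y) sqrt (n log n) leaves only
    n^(-2y), summable along a geometric sequence of n but not over all n. For fixed c the points c
    2^l form such a sequence, and finitely many c are in play; for large c the increment over a
    block has at most n / c terms, so its tail beats the n^2 pairs and all intermediate end points
    together. Truncation level and tilt multiply to t e log n, so the cubic error carries a factor
    n^(t e). Summed over n rows that error is of order n^(-1/2 + t e) up to logarithms, harmless
    once t e is at most 1/4. The exponent 5 comes from condensing the hypothesis over 2^l <= n <
    2^(l+1): the probability of two entries above r among 2^l, with r^2 near sqrt (2^l l), is
    O(2^-l). Hence 2^l P(|X| >= r) is O(2^(-l/2)), and P(|X| >= r) is r^-6 up to logarithms.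
    Settling for 5 absorbs the logarithms and still exceeds 4, as fourth moments require. *)

Lemma Rintegral_prob_cst d (T : measurableType d) (R : realType) (P : probability T R) (r : R) : \int[P]_w r = r.
Proof.
by rewrite Rintegral_cst// -[RHS]mulr1; congr (_ * _); rewrite -[RHS]/(fine 1%E) -(probability_setT P).
Qed.

Section independent_pair.
Context d (T : measurableType d) (R : realType) (P : probability T R).

Definition indep_pair (U V : T -> R) : Prop :=
  forall A B : set R, measurable A -> measurable B ->
    P ((U @^-1` A) `&` (V @^-1` B)) = (P (U @^-1` A) * P (V @^-1` B))%E.

(** The joint law agrees with the product of the two laws on rectangles, hence everywhere.
    Integrability then follows from Tonelli on absolute values, and the formula from Fubini. *)
Lemma Rintegral_mul_indep (U V : T -> R) : indep_pair U V ->
  P.-integrable setT (EFin \o U) -> P.-integrable setT (EFin \o V) ->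
  P.-integrable setT (EFin \o (fun w => U w * V w)) /\
  \int[P]_w (U w * V w) = (\int[P]_w U w) * (\int[P]_w V w).
Proof.
move=> UV iU iV.
have mU : measurable_fun setT U by apply/measurable_EFinP; exact: measurable_int iU.
have mV : measurable_fun setT V by apply/measurable_EFinP; exact: measurable_int iV.
have mUV : measurable_fun setT (fun w => (U w, V w)) by exact: measurable_fun_pair.
pose U' : {mfun T >-> R} := HB.pack U (isMeasurableFun.Build _ _ _ _ U mU).
pose V' : {mfun T >-> R} := HB.pack V (isMeasurableFun.Build _ _ _ _ V mV).
pose W' : {mfun T >-> (R * R)%type} :=
  HB.pack (fun w => (U w, V w)) (isMeasurableFun.Build _ _ _ _ _ mUV).
pose m1 := distribution P U'; pose m2 := distribution P V'.
pose m12 := distribution P W'.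
have prodE X : measurable X -> (m1 \x m2)%E X = m12 X.
  by apply: product_measure_unique => A B mA mB; exact: UV.
pose f (z : R * R) : \bar R := (z.1 * z.2)%:E.
have mf : measurable_fun setT f.
  by apply/measurable_EFinP; exact: measurable_funM.
have absf z : `|f z|%E = (`|z.1|%:E * `|z.2|%:E)%E.
  by rewrite /f abse_EFin normrM EFinM.
have ione (Z : {mfun T >-> R}) : P.-integrable setT (EFin \o Z) ->
    (\int[distribution P Z]_x `|x|%:E < +oo)%E.
  move=> /integrableP[_]; rewrite (_ : (\int[P]_x _)%E =
    (\int[P]_x ((fun x => `|x|%:E) \o Z) x)%E)//.
  by rewrite -ge0_integral_distribution//; apply/measurable_EFinP.
have i1 : (\int[m1]_x `|x|%:E < +oo)%E by exact: (ione U').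
have i2 : (\int[m2]_x `|x|%:E < +oo)%E by exact: (ione V').
have mabs : measurable_fun setT (fun y : R => `|y|%:E : \bar R).
  by apply/measurable_EFinP.
have ifprod : (m1 \x m2)%E.-integrable setT f.
  apply/integrable12ltyP => //.
  have Fx x : (\int[m2]_y `|f (x, y)| = `|x|%:E * \int[m2]_y `|y|%:E)%E.
    under eq_integral do rewrite absf.
    by rewrite /= ge0_integralZl.
  under eq_integral do rewrite Fx.
  rewrite ge0_integralZr//; last exact: integral_ge0.
  rewrite lte_mul_pinfty//; first exact: integral_ge0.
  by rewrite ge0_fin_numE// integral_ge0.
have iUV : P.-integrable setT (f \o W').
  apply/integrableP; split; first exact: (measurableT_comp mf mUV).
  have [_] := integrableP _ _ _ ifprod; apply: le_lt_trans.
  rewrite (_ : (\int[P]_x _)%E = (\int[P]_x ((abse \o f) \o W') x)%E)//.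
  have mabsf : measurable_fun setT (abse \o f) by exact: measurableT_comp.
  rewrite -ge0_integral_distribution//; last by move=> y; exact: abse_ge0.
  rewrite -/m12 (_ : (\int[m12]_x _)%E = (\int[(m1 \x m2)%E]_x (abse \o f) x)%E)//.
  by apply: eq_measure_integral => A mA _; exact/esym/prodE.
split; first exact: iUV.
rewrite /Rintegral.
have -> : (\int[P]_w (U w * V w)%:E)%E = (\int[P]_w (f \o W') w)%E by [].
rewrite -integral_distribution// -/m12.
have -> : (\int[m12]_x f x = \int[(m1 \x m2)%E]_x f x)%E.
  by apply: eq_measure_integral => A mA _; exact/esym/prodE.
rewrite -integral12_prod_meas1//.
have EFinZ (Z : {mfun T >-> R}) : P.-integrable setT (EFin \o Z) ->
    (\int[distribution P Z]_x x%:E = \int[P]_w (Z w)%:E)%E.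
  by move=> iZ; rewrite (@integral_distribution _ _ _ _ _ P Z EFin).
have iI (Z : {mfun T >-> R}) : P.-integrable setT (EFin \o Z) ->
    (distribution P Z).-integrable setT (EFin : R -> \bar R).
  by move=> iZ; apply/integrableP; split; [exact/measurable_EFinP|exact: ione].
rewrite /fubini_F.
have E1 x : (\int[m2]_y f (x, y) = x%:E * \int[P]_w (V w)%:E)%E.
  rewrite /f; under eq_integral do rewrite EFinM.
  by rewrite integralZl ?EFinZ//; exact: iI.
have -> : (\int[m1]_x \int[m2]_y f (x, y) =
    \int[m1]_x (x%:E * \int[P]_w (V w)%:E))%E.
  by apply: eq_integral => x _; exact: E1.
have fV : (\int[P]_w (V w)%:E)%E \is a fin_num by exact: integrable_fin_num iV.
have fU : (\int[P]_w (U w)%:E)%E \is a fin_num by exact: integrable_fin_num iU.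
rewrite -(fineK fV) integralZr//; last exact: iI.
by rewrite (EFinZ U')// fineM.
Qed.

End independent_pair.

Section generated_sigma_algebras.
Context d (T : measurableType d) (R : realType) (P : probability T R).
Variables (I : choiceType) (Y : I -> T -> R).

(** Lists are duplicate-free because [mutually_independent] speaks of such lists only. By
    [cylinders_setI] these sets form a pi-system. *)
Definition cylinders (J : set I) : set (set T) :=
  [set A | exists s B, [/\ uniq s, forall j, j \in s -> J j,
    forall j, measurable (B j) &
    A = \bigcap_(j in [set j | j \in s]) (Y j @^-1` B j)]].

(* [sub_measurable J f]: f is measurable for the sigma-algebra generated by
   the family (Y j), j in J. *)
Definition sub_measurable (J : set I) (f : T -> R) : Prop :=
  @measurable_fun _ _ (g_sigma_algebraType (cylinders J)) R setT f.

Lemma sub_measurable_coord J j : J j -> sub_measurable J (Y j).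
Proof.
move=> Jj _ B mB; rewrite setTI; apply: sub_sigma_algebra.
exists [:: j], (fun=> B); split => //; first by move=> k; rewrite inE => /eqP ->.
apply/seteqP; split=> w /=; first by move=> Bw k /=; rewrite inE => /eqP ->.
by apply; rewrite /= inE.
Qed.

Hypothesis mY : forall j, measurable_fun setT (Y j).
Hypothesis iY : mutually_independent P setT Y.

Lemma cylinders_measurable J A : cylinders J A -> measurable A.
Proof.
move=> [s [B [_ _ mB ->]]]; rewrite (bigcap_seq s (fun j => Y j @^-1` B j)).
apply: bigsetI_measurable => j _.
rewrite -[X in measurable X]setTI; exact: mY.
Qed.

Lemma sub_sigma_measurable J : <<s cylinders J >> `<=` measurable.
Proof.
apply: smallest_sub; first exact: sigma_algebra_measurable.
by move=> A; exact: cylinders_measurable.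
Qed.

Lemma sub_measurableS J J' f : J `<=` J' -> sub_measurable J f ->
  sub_measurable J' f.
Proof.
move=> JJ' mf _ B mB; have := mf measurableT B mB.
apply: sub_sigma_algebra2 => A [s [B' [us sJ mB' ->]]].
by exists s, B'; split => // j /sJ /JJ'.
Qed.

Lemma sub_measurable_measurable J f : sub_measurable J f -> measurable_fun setT f.
Proof.
move=> mf _ B mB; apply: (@sub_sigma_measurable J).
exact: (mf measurableT B mB).
Qed.

Lemma cylinders_setI J : setI_closed (cylinders J).
Proof.
move=> _ _ [s [B [us sJ mB ->]]] [s' [B' [us' sJ' mB' ->]]].
exists (undup (s ++ s')), (fun j => (if j \in s then B j else setT) `&`
  (if j \in s' then B' j else setT)); split.
- exact: undup_uniq.
- by move=> j; rewrite mem_undup mem_cat => /orP[/sJ|/sJ'].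
- by move=> j; apply: measurableI; case: ifP.
- apply/seteqP; split => w /=.
    move=> [h h'] j /=; rewrite mem_undup mem_cat => _.
    by split; case: ifP => // js; [exact: h|exact: h'].
  move=> h; split=> j /= js.
    have := h j; rewrite /= mem_undup mem_cat js => /(_ isT)[].
    by [].
  have := h j; rewrite /= mem_undup mem_cat js orbT => /(_ isT)[_].
  by [].
Qed.

Lemma cylinders_indep J J' A A' : J `&` J' = set0 ->
  cylinders J A -> cylinders J' A' -> P (A `&` A') = (P A * P A')%E.
Proof.
move=> JJ' [s [B [us sJ mB ->]]] [s' [B' [us' sJ' mB' ->]]].
have disj j : j \in s -> j \in s' -> False.
  move=> /sJ Jj /sJ' J'j; have : (J `&` J') j by [].
  by rewrite JJ'.
rewrite (iY us) // (iY us') //.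
pose B'' j := if j \in s then B j else B' j.
have -> : \bigcap_(j in [set j | j \in s]) (Y j @^-1` B j) `&`
    \bigcap_(j in [set j | j \in s']) (Y j @^-1` B' j) =
    \bigcap_(j in [set j | j \in s ++ s']) (Y j @^-1` B'' j).
  apply/seteqP; split => w /=.
    move=> [h h'] j /=; rewrite mem_cat /B''.
    by case: ifP => /= [js _|js js']; [exact: h|exact: h'].
  move=> h; split=> j /= js.
    by have := h j; rewrite /= mem_cat /B'' js => /(_ isT).
  have := h j; rewrite /= mem_cat /B'' js orbT.
  by case: ifP => [js'|_]; [case: (disj _ js' js)|exact].
rewrite iY //.
- rewrite big_cat /=; congr (_ * _)%E; apply: eq_big_seq => j js.
    by rewrite /B'' js.
  by rewrite /B''; case: ifP => // js'; case: (disj _ js' js).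
- rewrite cat_uniq us us' andbT; apply/hasPn => j js'.
  by apply/negP => js; exact: (disj j).
- by move=> j; rewrite /B''; case: ifP.
Qed.

(** Dynkin's pi-lambda theorem, used once in each argument: with a cylinder over J' held fixed, then
    with a member of the sigma-algebra over J held fixed. *)
Lemma sigma_cylinders_indep J J' A A' : J `&` J' = set0 ->
  <<s cylinders J >> A -> <<s cylinders J' >> A' ->
  P (A `&` A') = (P A * P A')%E.
Proof.
move=> JJ'.
have setTcyl K : cylinders K setT.
  exists [::], (fun=> setT); split => //.
  by apply/seteqP; split.
have step (K : set I) C : measurable C ->
    (forall D, cylinders K D -> P (D `&` C) = (P D * P C)%E) ->
    forall D, <<s cylinders K >> D -> P (D `&` C) = (P D * P C)%E.
  move=> mC hC; pose TK : measurableType _ := g_sigma_algebraType (cylinders K).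
  apply: (@dynkin_induction _ TK (cylinders K)
    (fun D => P (D `&` C) = (P D * P C)%E)) => //.
  - exact: cylinders_setI.
  - by rewrite setTI probability_setT mul1e.
  - move=> D mD PD; have {}mD : d.-measurable D by exact: (@sub_sigma_measurable K).
    have fC : P C \is a fin_num by exact: fin_num_measure.
    have fD : P D \is a fin_num by exact: fin_num_measure.
    have -> : P (~` D `&` C) = (P C - P (D `&` C))%E.
      by rewrite setIC -setDE measureD ?(setIC C D)// ltey_eq fC.
    rewrite PD probability_setC//.
    by rewrite -(fineK fC) -(fineK fD) -EFinM -!EFinB -EFinM mulrBl mul1r.
  - move=> F mF tF PF.
    have mF' n : d.-measurable (F n) by exact: (@sub_sigma_measurable K _ (mF n)).
    rewrite setI_bigcupl measure_bigcup//; last 2 first.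
      by move=> n _; exact: measurableI.
      by apply: trivIset_setIr.
    rewrite measure_bigcup//.
    rewrite (eq_eseriesr (fun n _ => PF n)).
    have fC : P C \is a fin_num by exact: fin_num_measure.
    by rewrite muleC -(fineK fC) -nneseriesZl//; apply: eq_eseriesr => n _; rewrite muleC.
move=> hA hA'; rewrite setIC muleC.
apply: (step J') => // [|D' cD']; first exact: (@sub_sigma_measurable J).
rewrite setIC muleC.
apply: (step J) => // [|D cD]; first exact: cylinders_measurable cD'.
exact: (@cylinders_indep J J').
Qed.

Lemma sub_measurable_indep J J' U V : J `&` J' = set0 ->
  sub_measurable J U -> sub_measurable J' V -> indep_pair P U V.
Proof.
move=> JJ' mU mV A B mA mB; apply: (sigma_cylinders_indep JJ').
  by rewrite -[X in <<s _ >> X]setTI; exact: mU.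
by rewrite -[X in <<s _ >> X]setTI; exact: mV.
Qed.

(** Induction on the list: the product over the tail is measurable for the union of its index
    blocks, which is disjoint from the block of the head. *)
Lemma Rintegral_prod_indep (K : eqType) (s : seq K) (J : K -> set I)
    (f : K -> T -> R) : uniq s ->
  (forall k l, k != l -> J k `&` J l = set0) ->
  (forall k, sub_measurable (J k) (f k)) ->
  (forall k, P.-integrable setT (EFin \o f k)) ->
  P.-integrable setT (EFin \o (fun w => \prod_(k <- s) f k w)) /\
  \int[P]_w (\prod_(k <- s) f k w) = \prod_(k <- s) \int[P]_w f k w.
Proof.
move=> us dJ mf intf.
elim: s us => [_|k s IH /= /andP[ks us]].
  have -> : (fun w => \prod_(k <- [::]) f k w) = cst 1.
    by apply/funext => w; rewrite big_nil.
  rewrite big_nil; split; first exact: finite_measure_integrable_cst.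
  exact: Rintegral_prob_cst.
have {IH us}[IH1 IH2] := IH us.
have mprod : sub_measurable (\bigcup_(l in [set l | l \in s]) J l)
    (fun w => \prod_(l <- s) f l w).
  (* The sublist shrinks while the union over s stays fixed, so that the induction goes through. *)
  have h : forall s', {subset s' <= s} ->
      sub_measurable (\bigcup_(l in [set l | l \in s]) J l)
      (fun w => \prod_(l <- s') f l w).
    elim=> [_|l s' IHs sub].
      rewrite (_ : (fun _ => _) = cst 1); first exact: measurable_cst.
      by apply/funext => w; rewrite big_nil.
    rewrite (_ : (fun _ => _) = (fun w => f l w * \prod_(l <- s') f l w)); last first.
      by apply/funext => w; rewrite big_cons.
    apply: measurable_funM.
      apply: sub_measurableS (mf l) => j Jj; exists l => //=.
      by apply: sub; rewrite inE eqxx.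
    by apply: IHs => x xs; apply: sub; rewrite inE xs orbT.
  exact: h.
have disj : J k `&` (\bigcup_(l in [set l | l \in s]) J l) = set0.
  rewrite setI_bigcupr; apply: bigcup0 => l /= ls; apply: dJ.
  by apply: contraNneq ks => ->.
have [h1 h2] := Rintegral_mul_indep (sub_measurable_indep disj (mf k) mprod)
  (intf k) IH1.
have -> : (fun w => \prod_(l <- k :: s) f l w) =
    (fun w => f k w * \prod_(l <- s) f l w).
  by apply/funext => w; rewrite big_cons.
by rewrite big_cons -IH2 -h2.
Qed.

End generated_sigma_algebras.

(** * Exponential inequalities *)

Section exponential_bounds.
Context (R : realType).
Implicit Types (u y b l : R).

(** Termwise domination of the remainder: (k + m)! is at least k!, so the tail of the series is at
    most |u|^m times the series of exp |u|. *)
Lemma expR_taylor m u :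
  `|expR u - series (exp_coeff u) m| <= `|u| ^+ m * expR `|u|.
Proof.
have cu := @is_cvg_series_exp_coeff R u.
have ca := @is_cvg_series_exp_coeff R `|u|.
have c : (fun N => `|series (exp_coeff u) N - series (exp_coeff u) m|) @ \oo -->
    `|expR u - series (exp_coeff u) m|.
  by apply: cvg_norm; apply: cvgB; [exact: cu|exact: cvg_cst].
rewrite -(cvg_lim _ c)//; apply: limr_le; first by apply/cvg_ex; exists `|expR u - series (exp_coeff u) m|.
near=> N.
have mN : (m <= N)%N by near: N; exact: nbhs_infty_ge.
rewrite sub_series_geq//.
apply: (le_trans (ler_norm_sum _ _ _)).
have h : series (exp_coeff `|u|) (N - m)%N <= expR `|u|.
  apply: nondecreasing_cvgn_le => //.
  by apply: nondecreasing_series => n _ _; exact: exp_coeff_ge0.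
apply: (le_trans _ (ler_wpM2l _ h)); last exact: exprn_ge0.
rewrite -{1}(add0n m) big_addn /series /= mulr_sumr.
rewrite ler_sum// => i _; rewrite /exp_coeff/=.
rewrite normrM normrX normfV normr_nat exprD -mulrA mulrCA.
rewrite ler_wpM2l ?exprn_ge0// ler_wpM2l ?exprn_ge0//.
by rewrite lef_pV2 ?posrE ?ltr0n ?fact_gt0// ler_nat leq_fact// leq_addr.
Unshelve. all: by end_near.
Qed.

Lemma expR_taylor1 u : expR u <= 1 + u + u ^+ 2 * expR `|u|.
Proof.
have := expR_taylor 2 u; rewrite real_normK ?num_real// /series/= /exp_coeff.
rewrite !big_nat_recr//= big_geq// add0r expr0 expr1 fact0 !divr1.
by move=> /ler_normlP[_]; lra.
Qed.

Lemma expR_taylor2 u :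
  `|expR u - (1 + u + u ^+ 2 / 2)| <= `|u| ^+ 3 * expR `|u|.
Proof.
have := expR_taylor 3 u; rewrite /series/= /exp_coeff.
by rewrite !big_nat_recr//= big_geq// add0r expr0 expr1 fact0 !divr1.
Qed.

Definition trunc b u : R := if `|u| <= b then u else 0.

Lemma norm_trunc_le b u : 0 <= b -> `|trunc b u| <= b.
Proof. by rewrite /trunc; case: ifP => // _; rewrite normr0. Qed.

(** Coefficient of |u|^3 in the error of the second-order expansion. The first two terms pay for the
    linear and quadratic parts lost where |u| > b, since there |u| <= |u|^3 / b^2 and u^2 <= |u|^3 /
    b; the third is the Taylor remainder where |u| <= b. *)
Definition mgf_error b l : R :=
  `|l| / b ^+ 2 + l ^+ 2 / b + `|l| ^+ 3 * expR (`|l| * b).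

Lemma mgf_error_ge0 b l : 0 < b -> 0 <= mgf_error b l.
Proof.
move=> /ltW b0; rewrite /mgf_error.
have l2 : 0 <= l ^+ 2 by exact: sqr_ge0.
have b2 : 0 <= b ^+ 2 by exact: sqr_ge0.
have l3 : 0 <= `|l| ^+ 3 by exact: exprn_ge0.
have e0 := expR_ge0 (`|l| * b).
by rewrite addr_ge0 ?mulr_ge0// addr_ge0// divr_ge0.
Qed.

Lemma expR_trunc b l u : 0 < b ->
  `|expR (l * trunc b u) - (1 + l * u + l ^+ 2 / 2 * u ^+ 2)| <=
  mgf_error b l * `|u| ^+ 3.
Proof.
move=> b0; rewrite /trunc /mgf_error; case: ifPn => [ub|].
  have h := expR_taylor2 (l * u).
  rewrite (_ : l ^+ 2 / 2 * u ^+ 2 = (l * u) ^+ 2 / 2); last by ring.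
  apply: (le_trans h); rewrite normrM exprMn -mulrA (mulrC (`|u| ^+ 3)) mulrA.
  rewrite ler_wpM2r ?exprn_ge0//.
  apply: (@le_trans _ _ (`|l| ^+ 3 * expR (`|l| * b))).
    by rewrite ler_wpM2l ?exprn_ge0// ler_expR ler_wpM2l.
  by rewrite lerDr addr_ge0// divr_ge0// ?sqr_ge0// ltW.
rewrite -ltNge => bu; rewrite mulr0 expR0.
have u0 : 0 < `|u| by exact: lt_trans bu.
have h1 : `|l * u| <= `|l| / b ^+ 2 * `|u| ^+ 3.
  rewrite normrM -mulrA ler_wpM2l// ler_pdivlMl ?exprn_gt0//.
  by rewrite [leRHS]exprSr ler_wpM2r// lerXn2r ?nnegrE// ltW.
have h2 : l ^+ 2 / 2 * u ^+ 2 <= l ^+ 2 / b * `|u| ^+ 3.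
  have uu : `|u| ^+ 2 / 2 <= `|u| ^+ 3 / b.
    by rewrite ler_pdivlMr// [leRHS]exprSr -mulrA ler_wpM2l ?exprn_ge0//; lra.
  have l2 : 0 <= l ^+ 2 by exact: sqr_ge0.
  have := ler_wpM2l l2 uu; rewrite real_normK ?num_real//; lra.
have h3 : 0 <= `|l| ^+ 3 * expR (`|l| * b) * `|u| ^+ 3.
  by rewrite !mulr_ge0// ?exprn_ge0// expR_ge0.
have h4 : 0 <= l ^+ 2 / 2 * u ^+ 2 by rewrite mulr_ge0 ?sqr_ge0// divr_ge0// sqr_ge0.
rewrite (_ : 1 - _ = - (l * u) - l ^+ 2 / 2 * u ^+ 2); last by ring.
apply: (le_trans (ler_normB _ _)); rewrite normrN (ger0_norm h4) !mulrDl.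
lra.
Qed.

(** Meant for two products u, v with a common entry: they are uncorrelated but dependent, so u v is
    kept on the right, where its expectation will vanish. The doubled tilt in the error reflects
    that the two truncations add up to at most 2 b. *)
Lemma expR_trunc2 b l u v : 0 < b -> 0 <= l ->
  expR (l * (trunc b u + trunc b v)) <=
  1 + l * (u + v) + l ^+ 2 / 2 * (u ^+ 2 + v ^+ 2) + l ^+ 2 * (u * v) +
  4 * mgf_error b (2 * l) * (`|u| ^+ 3 + `|v| ^+ 3).
Proof.
move=> b0 l0; set t := trunc b u; set s := trunc b v.
have tb : `|t| <= b by exact/norm_trunc_le/ltW.
have sb : `|s| <= b by exact/norm_trunc_le/ltW.
have [_ h] := ler_normlP _ _ (expR_taylor2 (l * (t + s))).
have e1 : expR `|l * (t + s)| <= expR (2 * l * b).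
  rewrite ler_expR normrM (ger0_norm l0) (mulrC 2) -mulrA ler_wpM2l//.
  by apply: (le_trans (ler_normD _ _)); lra.
have trunc_lin w : trunc b w <= w + `|w| ^+ 3 / b ^+ 2.
  have w3 : 0 <= `|w| ^+ 3 / b ^+ 2 by rewrite divr_ge0// exprn_ge0// ltW.
  rewrite /trunc; case: ifPn => [_|]; first by rewrite lerDl.
  rewrite -ltNge => bw.
  suff : `|w| <= `|w| ^+ 3 / b ^+ 2 by have := ler_norm (- w); rewrite normrN; lra.
  by rewrite ler_pdivlMr ?exprn_gt0// [leRHS]exprS ler_wpM2l// lerXn2r ?nnegrE// ltW.
have trunc_sq w : trunc b w ^+ 2 <= w ^+ 2.
  by rewrite /trunc; case: ifP => // _; rewrite expr0n sqr_ge0.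
have norm_trunc w : `|trunc b w| <= `|w|.
  by rewrite /trunc; case: ifP => // _; rewrite normr0.
(* If one factor is truncated then t s = 0, and the missing u v is paid for by cubes: b < |w| gives
   |w| |w'| b <= |w|^2 |w'|, at most the larger of the two cubes. *)
have big_prod w w' : b < `|w| -> - (w * w') <= (`|w| ^+ 3 + `|w'| ^+ 3) / b.
  move=> bw; have w0 : 0 <= `|w| by [].
  have w'0 : 0 <= `|w'| by [].
  apply: (le_trans (ler_norm _)); rewrite normrN normrM ler_pdivlMr//.
  set p := `|w| in bw w0 *; set q := `|w'| in w'0 *.
  apply: (@le_trans _ _ (p * q * p)); first by rewrite ler_wpM2l ?mulr_ge0// ltW.
  have [pq|qp] := leP p q.
    have : p * q * p <= q * q * q by rewrite ler_pM ?mulr_ge0// ler_wpM2r.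
    have : 0 <= p ^+ 3 by rewrite exprn_ge0.
    by rewrite !exprS expr0 !mulr1; lra.
  have : p * q * p <= p * p * p by rewrite ler_wpM2r// ler_wpM2l// ltW.
  have : 0 <= q ^+ 3 by rewrite exprn_ge0.
  by rewrite !exprS expr0 !mulr1; lra.
have ts : t * s <= u * v + (`|u| ^+ 3 + `|v| ^+ 3) / b.
  have uv3 : 0 <= (`|u| ^+ 3 + `|v| ^+ 3) / b.
    by rewrite divr_ge0 ?addr_ge0 ?exprn_ge0// ltW.
  rewrite /t /s {1 2}/trunc; case: ifPn => [_|]; last first.
    by rewrite -ltNge mul0r => /(big_prod _ v); lra.
  case: ifPn => [_|]; first by rewrite lerDl.
  by rewrite -ltNge mulr0 => /(big_prod _ u); lra.
(* Convexity in the form (p + q)^3 <= 4 (p^3 + q^3): the difference is 3 (p + q) (p - q)^2. *)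
have cube : `|l * (t + s)| ^+ 3 <= 4 * l ^+ 3 * (`|u| ^+ 3 + `|v| ^+ 3).
  rewrite normrM (ger0_norm l0) exprMn -mulrA [leRHS]mulrCA ler_wpM2l ?exprn_ge0//.
  have := norm_trunc u; have := norm_trunc v; rewrite -/t -/s => hs ht.
  have ts3 : `|t + s| ^+ 3 <= (`|u| + `|v|) ^+ 3.
    rewrite lerXn2r ?nnegrE ?addr_ge0//.
    by apply: (le_trans (ler_normD _ _)); exact: lerD.
  apply: (le_trans ts3).
  have u0 : 0 <= `|u| by []. have v0 : 0 <= `|v| by [].
  set p := `|u| in u0 *; set q := `|v| in v0 *.
  have H : 0 <= (p - q) ^+ 2 by exact: sqr_ge0.
  rewrite -subr_ge0.
  rewrite (_ : _ - _ = 3 * ((p + q) * (p - q) ^+ 2)); last by ring.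
  by rewrite mulr_ge0// mulr_ge0// addr_ge0.
have rem : `|l * (t + s)| ^+ 3 * expR `|l * (t + s)| <=
    4 * l ^+ 3 * expR (2 * l * b) * (`|u| ^+ 3 + `|v| ^+ 3).
  rewrite [leRHS]mulrAC; apply: ler_pM => //; rewrite ?exprn_ge0 ?expR_ge0//.
have hu := trunc_lin u; have hv := trunc_lin v; rewrite -/t -/s in hu hv.
have qu := trunc_sq u; have qv := trunc_sq v; rewrite -/t -/s in qu qv.
set c := `|u| ^+ 3 + `|v| ^+ 3 in rem ts *.
have c0 : 0 <= c by rewrite addr_ge0 ?exprn_ge0.
have {hu hv} lin : l * (t + s) <= l * (u + v) + l / b ^+ 2 * c.
  rewrite -mulrA -mulrDr ler_wpM2l// /c mulrDr.
  rewrite [b ^- 2 * `|u| ^+ 3]mulrC [b ^- 2 * `|v| ^+ 3]mulrC; lra.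
have quad : (l * (t + s)) ^+ 2 / 2 <=
    l ^+ 2 / 2 * (u ^+ 2 + v ^+ 2) + l ^+ 2 * (u * v) + l ^+ 2 / b * c.
  have l2 : 0 <= l ^+ 2 by exact: sqr_ge0.
  have -> : (l * (t + s)) ^+ 2 / 2 = l ^+ 2 * ((t ^+ 2 + s ^+ 2) / 2 + t * s) by field.
  have -> : l ^+ 2 / 2 * (u ^+ 2 + v ^+ 2) + l ^+ 2 * (u * v) + l ^+ 2 / b * c =
    l ^+ 2 * ((u ^+ 2 + v ^+ 2) / 2 + (u * v + c / b)).
    by field; rewrite gt_eqF.
  by rewrite ler_wpM2l//; lra.
have err : l / b ^+ 2 * c + l ^+ 2 / b * c + 4 * l ^+ 3 * expR (2 * l * b) * c <=
    4 * mgf_error b (2 * l) * c.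
  rewrite -!mulrDl ler_wpM2r// /mgf_error.
  have l2 : 0 <= 2 * l by rewrite mulr_ge0.
  rewrite (ger0_norm l2).
  have a1 : 0 <= l / b ^+ 2 by rewrite divr_ge0// exprn_ge0// ltW.
  have a2 : 0 <= l ^+ 2 / b by rewrite divr_ge0// ?sqr_ge0// ltW.
  have a3 : 0 <= l ^+ 3 * expR (2 * l * b).
    by rewrite mulr_ge0 ?exprn_ge0// expR_ge0.
  rewrite exprMn [(2 * l) ^+ 3]exprMn -[2 * l / _]mulrA -[2 ^+ 2 * l ^+ 2 / b]mulrA.
  rewrite -[2 ^+ 3 * l ^+ 3 * _]mulrA -[4 * l ^+ 3 * _]mulrA.
  lra.
lra.
Qed.

End exponential_bounds.

(** * Standardized arrays *)

Section real_expectation.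
Context d (T : measurableType d) (R : realType) (P : probability T R).
Implicit Types f g : T -> R.

Definition integ f : Prop := P.-integrable setT (EFin \o f).

Lemma integ_measurable f : integ f -> measurable_fun setT f.
Proof. by move=> h; apply/measurable_EFinP; exact: measurable_int h. Qed.

Lemma integ_cst (r : R) : integ (fun=> r).
Proof. exact: finite_measure_integrable_cst. Qed.

Lemma integD f g : integ f -> integ g -> integ (fun w => f w + g w).
Proof. by move=> hf hg; have := integrableD measurableT hf hg. Qed.

Lemma integB f g : integ f -> integ g -> integ (fun w => f w - g w).
Proof. by move=> hf hg; have := integrableB measurableT hf hg. Qed.

Lemma integZ (r : R) f : integ f -> integ (fun w => r * f w).
Proof. by move=> hf; have := integrableZl measurableT r hf. Qed.

Lemma integ_norm f : integ f -> integ (fun w => `|f w|).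
Proof. by move=> hf; have := integrable_abse hf. Qed.

Lemma integ_le f g : measurable_fun setT f -> (forall w, `|f w| <= g w) ->
  integ g -> integ f.
Proof.
move=> mf fg; apply: le_integrable => //; first exact/measurable_EFinP.
move=> w _ /=; rewrite lee_fin; apply: (le_trans (fg w)); exact: ler_norm.
Qed.

Lemma integ_bounded f (M : R) : measurable_fun setT f ->
  (forall w, `|f w| <= M) -> integ f.
Proof. by move=> mf fM; apply: (integ_le mf fM); exact: integ_cst. Qed.

Lemma ler_Rint f g : integ f -> integ g -> (forall w, f w <= g w) ->
  \int[P]_w f w <= \int[P]_w g w.
Proof. by move=> hf hg fg; apply: le_Rintegral. Qed.

Lemma markov_le f (a : R) : integ f -> (forall w, 0 <= f w) -> 0 < a ->
  (P [set w | (a <= f w)%R] <= ((\int[P]_w f w) / a)%:E)%E.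
Proof.
move=> hf f0 a0; have mf := integ_measurable hf.
have mA : measurable [set w | a <= f w].
  rewrite (_ : [set _ | _] = f @^-1` `[a, +oo[); last first.
    by apply/seteqP; split => w /=; rewrite in_itv/= andbT.
  by rewrite -[X in measurable X]setTI; exact: mf.
rewrite mulrC EFinM lee_pdivlMl//.
have -> : (\int[P]_w f w)%:E = (\int[P]_w (f w)%:E)%E.
  by rewrite /Rintegral fineK//; exact: integrable_fin_num.
rewrite -[X in P X]setIT -integral_indic// -ge0_integralZl//.
- apply: ge0_le_integral => //.
  + by move=> w Tw; rewrite mule_ge0// ?lee_fin// ltW.
  + by apply/measurable_EFinP; apply: measurable_funM.
  + exact/measurable_EFinP.
  + move=> w Tw; rewrite -EFinM lee_fin indicE; case: (boolP (w \in _)) => [|_].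
      by rewrite inE /= mulr1.
    by rewrite mulr0.
- exact/measurable_EFinP.
- by rewrite lee_fin ltW.
Qed.

End real_expectation.

Section standard_array.
Context d (T : measurableType d) (R : realType) (P : probability T R).
Variables (Z : nat -> nat -> T -> R) (C : R).

(** The bound C on fourth moments is common to all entries, which makes the later error terms
    uniform over rows and columns. *)
Record std_array : Prop := StdArray {
  std_meas : forall k i, measurable_fun setT (Z k i);
  std_indep : mutually_independent P setT (fun ki : nat * nat => Z ki.1 ki.2);
  std_int4 : forall k i, integ P (fun w => Z k i w ^+ 4);
  std_E4 : forall k i, \int[P]_w (Z k i w ^+ 4) <= C;
  std_E1 : forall k i, \int[P]_w Z k i w = 0;
  std_E2 : forall k i, \int[P]_w (Z k i w ^+ 2) = 1 }.

Hypothesis H : std_array.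
Let mZ := std_meas H.
Let iZ := std_indep H.
Let intZ4 := std_int4 H.
Let EZ4 := std_E4 H.
Let EZ1 := std_E1 H.
Let EZ2 := std_E2 H.

Local Notation Y := (fun ki : nat * nat => Z ki.1 ki.2).
Local Notation mY := (fun ki : nat * nat => mZ ki.1 ki.2).

Definition row (k : nat) : set (nat * nat) := [set ki | ki.1 = k].

Lemma pow_le_1D4 (z : R) n : (n <= 4)%N -> `|z| ^+ n <= 1 + z ^+ 4.
Proof.
move=> n4; have z4 : 0 <= z ^+ 4 by rewrite exprn_even_ge0.
have [z1|z1] := leP `|z| 1.
  apply: (@le_trans _ _ 1); last by rewrite lerDl.
  by rewrite exprn_ile1.
have : `|z| ^+ n <= `|z| ^+ 4 by rewrite ler_weXn2l// ltW.
rewrite -[`|z| ^+ 4]normrX (ger0_norm z4); lra.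
Qed.

Lemma integ_norm_pow k i n : (n <= 4)%N -> integ P (fun w => `|Z k i w| ^+ n).
Proof.
move=> n4; apply: (@integ_le _ _ _ _ _ (fun w => 1 + Z k i w ^+ 4)).
- by apply: measurable_funX; apply: measurableT_comp.
- by move=> w; rewrite normrX normr_id; exact: pow_le_1D4.
- by apply: integD; [exact: integ_cst|exact: intZ4].
Qed.

Lemma integ_pow k i n : (n <= 4)%N -> integ P (fun w => Z k i w ^+ n).
Proof.
move=> n4; apply: (integ_le _ _ (integ_norm_pow k i n4)).
  exact: measurable_funX.
by move=> w; rewrite normrX.
Qed.

Lemma integ_Z k i : integ P (Z k i).
Proof. exact: (@integ_pow k i 1). Qed.

Lemma C_ge0 : 0 <= C.
Proof.
by apply: le_trans (EZ4 0 0); apply: Rintegral_ge0 => w _; rewrite exprn_even_ge0.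
Qed.

Lemma E_norm_cube_le k i : \int[P]_w (`|Z k i w| ^+ 3) <= 1 + C.
Proof.
apply: (@le_trans _ _ (\int[P]_w (1 + Z k i w ^+ 4))).
  apply: ler_Rint; first exact: integ_norm_pow.
    by apply: integD; [exact: integ_cst|exact: intZ4].
  by move=> w; exact: pow_le_1D4.
rewrite RintegralD//; [|exact: integ_cst|exact: intZ4].
by rewrite Rintegral_prob_cst lerD2l.
Qed.

Lemma sub_measurable_Z k i (J : set (nat * nat)) : J (k, i) -> sub_measurable Y J (Z k i).
Proof. by move=> Jki; exact: (@sub_measurable_coord _ _ _ _ Y J (k, i)). Qed.

Lemma indep_Z k i j (f g : R -> R) : i != j ->
  measurable_fun setT f -> measurable_fun setT g ->
  indep_pair P (fun w => f (Z k i w)) (fun w => g (Z k j w)).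
Proof.
move=> ij mf mg.
apply: (@sub_measurable_indep _ _ _ _ _ _ mY iZ [set (k, i)] [set (k, j)]).
- by apply/seteqP; split => // -[a b] [/= [-> ->]] [/eqP]; rewrite (negbTE ij).
- by apply: measurableT_comp => //; exact: sub_measurable_Z.
- by apply: measurableT_comp => //; exact: sub_measurable_Z.
Qed.

Lemma E_prod k i j (f g : R -> R) : i != j ->
  measurable_fun setT f -> measurable_fun setT g ->
  integ P (fun w => f (Z k i w)) -> integ P (fun w => g (Z k j w)) ->
  integ P (fun w => f (Z k i w) * g (Z k j w)) /\
  \int[P]_w (f (Z k i w) * g (Z k j w)) =
  \int[P]_w f (Z k i w) * \int[P]_w g (Z k j w).
Proof. by move=> ij mf mg; apply: Rintegral_mul_indep; exact: indep_Z. Qed.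

Section products.
Variables (k i j : nat).
Hypothesis ij : i != j.
Let pr w := Z k i w * Z k j w.

Lemma E_pr : integ P pr /\ \int[P]_w pr w = 0.
Proof.
have [h ->] := E_prod (f := id) (g := id) ij (@measurable_id _ _ _) (@measurable_id _ _ _)
  (integ_Z k i) (integ_Z k j).
by rewrite EZ1 mul0r.
Qed.

Lemma E_pr_sq : integ P (fun w => pr w ^+ 2) /\ \int[P]_w (pr w ^+ 2) = 1.
Proof.
have mX : measurable_fun setT (fun x : R => x ^+ 2) by exact: measurable_funX.
have [h E] := E_prod ij mX mX (@integ_pow k i 2 isT) (@integ_pow k j 2 isT).
have -> : (fun w => pr w ^+ 2) = (fun w => Z k i w ^+ 2 * Z k j w ^+ 2).
  by apply/funext => w; rewrite /pr exprMn.
split => //.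
by rewrite E !EZ2 mul1r.
Qed.

(** Independence of the two factors splits the third moment of the product, so fourth moments of
    single entries suffice. *)
Lemma E_pr_cube : integ P (fun w => `|pr w| ^+ 3) /\
  \int[P]_w (`|pr w| ^+ 3) <= (1 + C) ^+ 2.
Proof.
have mX : measurable_fun setT (fun x : R => `|x| ^+ 3) by exact: measurable_funX.
have [h E] := E_prod ij mX mX (@integ_norm_pow k i 3 isT) (@integ_norm_pow k j 3 isT).
have -> : (fun w => `|pr w| ^+ 3) = (fun w => `|Z k i w| ^+ 3 * `|Z k j w| ^+ 3).
  by apply/funext => w; rewrite /pr normrM exprMn.
split => //.
rewrite E expr2; apply: ler_pM; rewrite ?E_norm_cube_le//.
  by apply: Rintegral_ge0 => w _; rewrite exprn_ge0.
by apply: Rintegral_ge0 => w _; rewrite exprn_ge0.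
Qed.

End products.

(** The entry in column l is independent of the other factors and has mean 0. This orthogonality
    makes two pairs with a common column behave, to second order, as if they were independent. *)
Lemma E_pr_pr k i j l : i != j -> i != l -> j != l ->
  integ P (fun w => (Z k i w * Z k j w) * (Z k i w * Z k l w)) /\
  \int[P]_w ((Z k i w * Z k j w) * (Z k i w * Z k l w)) = 0.
Proof.
move=> ij il jl.
have mX : measurable_fun setT (fun x : R => x ^+ 2) by exact: measurable_funX.
have [h _] := E_prod ij mX (@measurable_id _ _ _) (@integ_pow k i 2 isT) (integ_Z k j).
have ind : indep_pair P (fun w => Z k i w ^+ 2 * Z k j w) (Z k l).
  apply: (@sub_measurable_indep _ _ _ _ _ _ mY iZ [set ki | ki = (k, i) \/ ki = (k, j)]
    [set (k, l)]).
  - apply/seteqP; split => // -[a b] /= [[[-> ->]|[-> ->]] [/eqP]].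
      by rewrite (negbTE il).
    by rewrite (negbTE jl).
  - apply: measurable_funM; last by apply: sub_measurable_Z; right.
    by apply: measurable_funX; apply: sub_measurable_Z; left.
  - exact: sub_measurable_Z.
have [h1 h2] := Rintegral_mul_indep ind h (integ_Z k l).
have -> : (fun w => Z k i w * Z k j w * (Z k i w * Z k l w)) =
  (fun w => Z k i w ^+ 2 * Z k j w * Z k l w).
  by apply/funext => w; ring.
by rewrite h2 EZ1 mulr0.
Qed.

End standard_array.

(** * Moment generating functions of truncated products *)

Section chernoff.
Context d (T : measurableType d) (R : realType) (P : probability T R).
Variables (Z : nat -> nat -> T -> R) (C : R).
Hypothesis H : std_array P Z C.

Local Notation Y := (fun ki : nat * nat => Z ki.1 ki.2).
Let mY (ki : nat * nat) : measurable_fun setT (Z ki.1 ki.2) := std_meas H ki.1 ki.2.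

Let C0 : 0 <= C := C_ge0 H.

Lemma measurable_trunc b : measurable_fun setT (trunc b : R -> R).
Proof.
apply: measurable_fun_ifT => //.
by apply: measurable_fun_ler => //; exact: measurableT_comp.
Qed.

Lemma rowI k l : k != l -> row k `&` row l = set0.
Proof.
by move=> /eqP kl; apply/seteqP; split => // ki [] h1 h2; apply: kl; rewrite -(h1 : ki.1 = k) -(h2 : ki.1 = l).
Qed.

(** Functions of different rows depend on disjoint sets of entries, so the moment generating
    function factorizes. *)
Lemma mgf_sum (s : seq nat) (V : nat -> T -> R) (l M : R) : uniq s ->
  (forall k, sub_measurable Y (row k) (V k)) ->
  (forall k w, `|V k w| <= M) ->
  integ P (fun w => expR (l * \sum_(k <- s) V k w)) /\
  \int[P]_w expR (l * \sum_(k <- s) V k w) =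
    \prod_(k <- s) \int[P]_w expR (l * V k w).
Proof.
move=> us mV bV.
have mE k : sub_measurable Y (row k) (fun w => expR (l * V k w)).
  apply: measurableT_comp => //; apply: measurable_funM => //; exact: mV.
have iE k : integ P (fun w => expR (l * V k w)).
  apply: (@integ_bounded _ _ _ _ _ (expR (`|l| * M))).
    exact: (sub_measurable_measurable mY (mE k)).
  move=> w; rewrite ger0_norm ?expR_ge0// ler_expR.
  by apply: (le_trans (ler_norm _)); rewrite normrM ler_wpM2l.
have [h1 h2] := Rintegral_prod_indep mY (std_indep H) us rowI mE iE.
have E w : expR (l * \sum_(k <- s) V k w) = \prod_(k <- s) expR (l * V k w).
  by rewrite mulr_sumr expR_sum.
split; first by rewrite /integ (_ : (fun _ => _) =
  (fun w => \prod_(k <- s) expR (l * V k w)))//; exact/funext.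
by rewrite -h2; congr fine; apply: eq_integral => w _; rewrite E.
Qed.

Lemma mgf_sum_le (s : seq nat) (V : nat -> T -> R) (l M a : R) : uniq s ->
  (forall k, sub_measurable Y (row k) (V k)) ->
  (forall k w, `|V k w| <= M) ->
  (forall k, \int[P]_w expR (l * V k w) <= 1 + a) ->
  \int[P]_w expR (l * \sum_(k <- s) V k w) <= expR ((size s)%:R * a).
Proof.
move=> us mV bV Ea; have [_ ->] := mgf_sum l us mV bV.
rewrite expRM_natl; elim: s {us} => [|k s IH] /=; first by rewrite big_nil expr0.
rewrite big_cons exprS ler_pM//.
- by apply: Rintegral_ge0 => w _; exact: expR_ge0.
- by apply: prodr_ge0 => j _; apply: Rintegral_ge0 => w _; exact: expR_ge0.
- by apply: (le_trans (Ea k)); exact: expR_ge1Dx.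
Qed.

(* For u >= 0, (1 + u) (1 - u + u^2) = 1 + u^3 >= 1. *)
Lemma expR_le_1D (u : R) : 0 <= u -> expR (u - u ^+ 2) <= 1 + u.
Proof.
move=> u0; have h := expR_ge1Dx (- (u - u ^+ 2)).
have u1 : 0 < 1 + u by lra.
have e0 := expR_gt0 (u - u ^+ 2).
rewrite expRN in h.
have : (1 - (u - u ^+ 2)) * expR (u - u ^+ 2) <= 1.
  by rewrite -ler_pdivlMr// div1r.
move=> h2; have p : 0 <= u ^+ 3 * expR (u - u ^+ 2) by rewrite mulr_ge0 ?exprn_ge0// ltW.
have : (1 + u) * ((1 - (u - u ^+ 2)) * expR (u - u ^+ 2)) <= (1 + u) * 1.
  by rewrite ler_wpM2l// ltW.
rewrite (_ : (1 + u) * ((1 - (u - u ^+ 2)) * expR (u - u ^+ 2)) =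
  expR (u - u ^+ 2) + u ^+ 3 * expR (u - u ^+ 2)); last by ring.
by rewrite mulr1; lra.
Qed.

Lemma mgf_sum_ge (s : seq nat) (V : nat -> T -> R) (l M u : R) : uniq s ->
  (forall k, sub_measurable Y (row k) (V k)) ->
  (forall k w, `|V k w| <= M) -> 0 <= u ->
  (forall k, 1 + u <= \int[P]_w expR (l * V k w)) ->
  expR ((size s)%:R * (u - u ^+ 2)) <= \int[P]_w expR (l * \sum_(k <- s) V k w).
Proof.
move=> us mV bV u0 Eu; have [_ ->] := mgf_sum l us mV bV.
rewrite expRM_natl; elim: s {us} => [|k s IH] /=; first by rewrite big_nil expr0.
rewrite big_cons exprS ler_pM ?expR_ge0//.
by apply: le_trans (Eu k); exact: expR_le_1D.
Qed.

Lemma chernoff_sum (s : seq nat) (V : nat -> T -> R) (l M a y : R) : uniq s ->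
  (forall k, sub_measurable Y (row k) (V k)) ->
  (forall k w, `|V k w| <= M) -> 0 <= l ->
  (forall k, \int[P]_w expR (l * V k w) <= 1 + a) ->
  (P [set w | (y <= \sum_(k <- s) V k w)%R] <=
    (expR ((size s)%:R * a - l * y))%:E)%E.
Proof.
move=> us mV bV l0 Ea; have [hi _] := mgf_sum l us mV bV.
have mS : measurable_fun setT (fun w => \sum_(k <- s) V k w).
  by apply: measurable_sum => k; exact: (sub_measurable_measurable mY (mV k)).
have sub : [set w | (y <= \sum_(k <- s) V k w)%R] `<=`
    [set w | expR (l * y) <= expR (l * \sum_(k <- s) V k w)].
  by move=> w /= h; rewrite ler_expR ler_wpM2l.
apply: (@le_trans _ _ (P [set w | expR (l * y) <= expR (l * \sum_(k <- s) V k w)])).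
  apply: le_measure => //; rewrite inE.
  - rewrite -[X in measurable X]setTI; exact: measurable_fun_le.
  - rewrite -[X in measurable X]setTI; apply: measurable_fun_le => //.
    exact: integ_measurable hi.
have e0 w : 0 <= expR (l * \sum_(k <- s) V k w) by exact: expR_ge0.
apply: (le_trans (markov_le hi e0 (expR_gt0 (l * y)))).
rewrite lee_fin expRB ler_wpM2r ?invr_ge0 ?expR_ge0//.
exact: (mgf_sum_le us mV bV Ea).
Qed.

Definition W (b : R) (k i j : nat) (w : T) : R := trunc b (Z k i w * Z k j w).

Lemma sub_measurable_W b k i j (J : set (nat * nat)) : J (k, i) -> J (k, j) ->
  sub_measurable Y J (W b k i j).
Proof.
move=> Ji Jj; apply: measurableT_comp; first exact: measurable_trunc.
by apply: measurable_funM; exact: sub_measurable_Z.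
Qed.

Lemma W_le b k i j w : 0 <= b -> `|W b k i j w| <= b.
Proof. exact: norm_trunc_le. Qed.

Lemma integ_expW b l k i j : 0 <= b -> integ P (fun w => expR (l * W b k i j w)).
Proof.
move=> b0; apply: (@integ_bounded _ _ _ _ _ (expR (`|l| * b))).
  apply: measurableT_comp => //; apply: measurable_funM => //.
  apply: (sub_measurable_measurable mY (J := setT)).
  exact: sub_measurable_W.
move=> w; rewrite ger0_norm ?expR_ge0// ler_expR.
by apply: (le_trans (ler_norm _)); rewrite normrM ler_wpM2l// W_le.
Qed.

(** The truncated product is not recentred: the shift of its mean is accounted for by the term |l| /
    b^2 of [mgf_error]. *)
Lemma mgf_W b l k i j : 0 < b -> i != j ->
  `|\int[P]_w expR (l * W b k i j w) - (1 + l ^+ 2 / 2)| <=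
    mgf_error b l * (1 + C) ^+ 2.
Proof.
move=> b0 ij.
have [i1 e1] := E_pr H k ij; have [i2 e2] := E_pr_sq H k ij.
have [i3 e3] := E_pr_cube H k ij.
pose q w := 1 + l * (Z k i w * Z k j w) + l ^+ 2 / 2 * (Z k i w * Z k j w) ^+ 2.
have iq : integ P q.
  by apply: integD; [apply: integD; [exact: integ_cst|exact: integZ]|exact: integZ].
have Eq : \int[P]_w q w = 1 + l ^+ 2 / 2.
  rewrite /q RintegralD//; [|by apply: integD; [exact: integ_cst|exact: integZ]|exact: integZ].
  rewrite RintegralD//; [|exact: integ_cst|exact: integZ].
  by rewrite !RintegralZl// Rintegral_prob_cst e1 e2 mulr0 addr0 mulr1.
have iW := integ_expW l k i j (ltW b0).
rewrite -Eq -RintegralB//.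
have iD : integ P (fun w => expR (l * W b k i j w) - q w) by exact: integB.
apply: (le_trans (le_normr_Rintegral _ iD)); first by [].
apply: (@le_trans _ _ (\int[P]_w (mgf_error b l * `|Z k i w * Z k j w| ^+ 3))).
  apply: ler_Rint; [|exact: integZ|by move=> w; exact: expR_trunc].
  exact: integ_norm.
rewrite RintegralZl// ler_wpM2l// mgf_error_ge0//.
Qed.

Lemma mgf_W2 b l k i j m : 0 < b -> 0 <= l -> i != j -> i != m -> j != m ->
  \int[P]_w expR (l * (W b k i j w + W b k i m w)) <=
    1 + l ^+ 2 + 8 * mgf_error b (2 * l) * (1 + C) ^+ 2.
Proof.
move=> b0 l0 ij im jm.
have [i1 e1] := E_pr H k ij; have [i2 e2] := E_pr_sq H k ij.
have [i3 e3] := E_pr_cube H k ij.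
have [i1' e1'] := E_pr H k im; have [i2' e2'] := E_pr_sq H k im.
have [i3' e3'] := E_pr_cube H k im.
have [ip ep] := E_pr_pr H k ij im jm.
have iA : integ P (fun w => 1 + l * (Z k i w * Z k j w + Z k i w * Z k m w)).
  by apply: integD; [exact: integ_cst|apply: integZ; exact: integD].
have iB : integ P (fun w => l ^+ 2 / 2 *
    ((Z k i w * Z k j w) ^+ 2 + (Z k i w * Z k m w) ^+ 2)).
  by apply: integZ; exact: integD.
have iC : integ P (fun w => l ^+ 2 * ((Z k i w * Z k j w) * (Z k i w * Z k m w))).
  exact: integZ.
have iD : integ P (fun w => 4 * mgf_error b (2 * l) *
    (`|Z k i w * Z k j w| ^+ 3 + `|Z k i w * Z k m w| ^+ 3)).
  by apply: integZ; exact: integD.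
have iAB := integD iA iB; have iABC := integD iAB iC; have iABCD := integD iABC iD.
apply: (@le_trans _ _ (\int[P]_w (1 + l * (Z k i w * Z k j w + Z k i w * Z k m w) +
  l ^+ 2 / 2 * ((Z k i w * Z k j w) ^+ 2 + (Z k i w * Z k m w) ^+ 2) +
  l ^+ 2 * ((Z k i w * Z k j w) * (Z k i w * Z k m w)) +
  4 * mgf_error b (2 * l) * (`|Z k i w * Z k j w| ^+ 3 + `|Z k i w * Z k m w| ^+ 3)))).
  apply: ler_Rint => // [|w]; last exact: expR_trunc2.
  have e0 w : 0 <= expR (l * (W b k i j w + W b k i m w)) by exact: expR_ge0.
  apply: (integ_le _ _ iABCD) => [|w]; last by rewrite ger0_norm//; exact: expR_trunc2.
  apply: measurableT_comp => //; apply: measurable_funM => //.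
  by apply: measurable_funD; apply: (sub_measurable_measurable mY (J := setT));
    exact: sub_measurable_W.
rewrite RintegralD// RintegralD// RintegralD// RintegralD//; last 2 first.
- exact: integ_cst.
- by apply: integZ; exact: integD.
rewrite !RintegralZl//; try exact: integD.
rewrite !RintegralD// Rintegral_prob_cst e1 e1' e2 e2' ep.
have c := mgf_error_ge0 (2 * l) b0.
have := ler_wpM2l c e3; have := ler_wpM2l c e3'.
lra.
Qed.

End chernoff.

(** * Moderate deviations *)

Section scales.
Context (R : realType).
Implicit Types (t e x : R) (n : nat).

Definition scale n : R := Num.sqrt (n%:R * ln n%:R).
(** The minimizer l of n l^2 / 2 - l t [scale n], that is, the Chernoff parameter for n variables of
    variance 1 at level t [scale n]. *)
Definition tilt t n : R := t * Num.sqrt (ln n%:R / n%:R).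

Lemma near_ln_ge (M : R) : \forall n \near \oo, M <= ln (n%:R : R).
Proof.
near=> n.
have h : expR M <= n%:R by near: n; exact: nbhs_infty_ger.
rewrite -(expRK M) ler_ln ?posrE ?expR_gt0//.
exact: lt_le_trans (expR_gt0 M) h.
Unshelve. all: by end_near. Qed.

Lemma nat_expR n : 0 < ln (n%:R : R) -> n%:R = expR (ln n%:R) :> R.
Proof.
move=> l0; rewrite lnK// posrE ltr0n lt0n; apply/eqP => n0.
by move: l0; rewrite n0 ln0// ltxx.
Qed.

Lemma sqrt_nat_expR n : 0 < ln (n%:R : R) ->
  Num.sqrt n%:R = expR (ln n%:R / 2) :> R.
Proof.
move=> l0; rewrite {1}(nat_expR l0) {1}(splitr (ln n%:R)) expRD -expr2 sqrtr_sqr.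
by rewrite ger0_norm// expR_ge0.
Qed.

Lemma scaleE n : scale n = Num.sqrt n%:R * Num.sqrt (ln n%:R).
Proof. by rewrite /scale sqrtrM. Qed.

Lemma tiltE t n : 0 < ln (n%:R : R) ->
  tilt t n = t * (Num.sqrt (ln n%:R) / Num.sqrt n%:R).
Proof. by move=> l0; rewrite /tilt sqrtrM ?ltW// sqrtrV. Qed.

Lemma scale_gt0 n : 0 < ln (n%:R : R) -> 0 < scale n.
Proof.
move=> l0; rewrite /scale sqrtr_gt0 mulr_gt0// (nat_expR l0).
exact: expR_gt0.
Qed.

Lemma tilt_scale t n : 0 < ln (n%:R : R) -> tilt t n * scale n = t * ln n%:R.
Proof.
move=> l0; rewrite tiltE// scaleE.
have n0 : 0 < Num.sqrt (n%:R : R) by rewrite sqrt_nat_expR// expR_gt0.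
rewrite (_ : _ * _ = t * Num.sqrt (ln n%:R) ^+ 2); last by field; rewrite gt_eqF.
by rewrite sqr_sqrtr// ltW.
Qed.

Lemma tilt_sq t n : 0 < ln (n%:R : R) -> n%:R * tilt t n ^+ 2 = t ^+ 2 * ln n%:R.
Proof.
move=> l0; have n0 : 0 < (n%:R : R) by rewrite (nat_expR l0) expR_gt0.
rewrite /tilt exprMn sqr_sqrtr ?divr_ge0 ?ltW//.
by field; rewrite gt_eqF.
Qed.

Lemma tilt_ge0 t n : 0 <= t -> 0 <= tilt t n.
Proof. by move=> t0; rewrite mulr_ge0// sqrtr_ge0. Qed.

(* n * error = O(s^2 exp(-s/4)) with s = ln n, as t e <= 1/4. *)
Lemma mgf_error_small t e K : 0 <= t -> 0 < e -> t * e <= 4^-1 -> 0 <= K ->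
  \forall n \near \oo, n%:R * (mgf_error (e * scale n) (tilt t n) * K) <= 1.
Proof.
move=> t0 e0 te K0; pose c := t / e ^+ 2 + t ^+ 2 / e + t ^+ 3.
have c0 : 0 <= c.
  by rewrite !addr_ge0 ?divr_ge0 ?exprn_ge0// ltW.
near=> n.
have s1 : 1 <= ln (n%:R : R) by near: n; exact: near_ln_ge.
have sM : 384 * (c * K) <= ln (n%:R : R) by near: n; exact: near_ln_ge.
have s0 : 0 < ln (n%:R : R) by exact: lt_le_trans s1.
set s := ln n%:R in s1 sM s0 *.
(* With u = sqrt (ln n) and v = sqrt n, the scale is u v and the tilt is t u / v. *)
pose u : R := Num.sqrt s.
have us : u ^+ 2 = s by rewrite sqr_sqrtr// ltW.
have u0 : 0 < u by rewrite sqrtr_gt0.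
have u1 : 1 <= u by rewrite -(@sqrtr1 R) ler_wsqrtr.
pose v : R := expR (s / 2).
have v0 : 0 < v by exact: expR_gt0.
have vn : n%:R = v ^+ 2 by rewrite /v -expRM_natl mulrCA divff ?mulr1 ?pnatr_eq0//= -nat_expR.
have lE : tilt t n = t * (u / v) by rewrite tiltE// sqrt_nat_expR.
have bE : scale n = v * u by rewrite scaleE sqrt_nat_expR.
have l0 : 0 <= t * (u / v) by rewrite mulr_ge0// divr_ge0// ltW.
pose E := expR (t * e * s).
have EE : E <= expR (s / 4).
  by rewrite ler_expR [leRHS]mulrC ler_wpM2r// ltW.
have -> : n%:R * (mgf_error (e * scale n) (tilt t n) * K) =
    (t / e ^+ 2 / (u * v) + t ^+ 2 / e * u / v + t ^+ 3 * u ^+ 3 * (E / v)) * K.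
  rewrite vn /mgf_error lE bE ger0_norm//.
  rewrite (_ : t * (u / v) * (e * (v * u)) = t * e * s); last first.
    by rewrite -us; field; rewrite gt_eqF.
  by rewrite -/E; field; rewrite !gt_eqF.
pose g := expR (- (s / 4)).
have g0 : 0 < g by exact: expR_gt0.
have vg : v^-1 <= g by rewrite /v -expRN ler_expR; lra.
have Evg : E / v <= g.
  rewrite /v -expRN; apply: (@le_trans _ _ (expR (s / 4) * expR (- (s / 2)))).
    by rewrite ler_wpM2r ?expR_ge0.
  by rewrite -expRD ler_expR; lra.
have s2 : 1 <= s ^+ 2 by rewrite exprn_ege1.
have us2 : u <= s ^+ 2.
  apply: (@le_trans _ _ (u ^+ 4)); first by rewrite -{1}(expr1 u) ler_weXn2l.
  by rewrite -us -exprM.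
have u3s2 : u ^+ 3 <= s ^+ 2.
  by rewrite -us -exprM ler_weXn2l.
have T1 : t / e ^+ 2 / (u * v) <= t / e ^+ 2 * (s ^+ 2 * g).
  rewrite ler_wpM2l ?divr_ge0 ?exprn_ge0 ?(ltW e0)// invfM.
  by rewrite ler_pM// ?invr_ge0 ?(ltW u0) ?(ltW v0)// (le_trans _ s2)// invf_le1.
have T2 : t ^+ 2 / e * u / v <= t ^+ 2 / e * (s ^+ 2 * g).
  rewrite -mulrA ler_wpM2l ?divr_ge0 ?exprn_ge0 ?(ltW e0)//.
  by rewrite ler_pM// ?invr_ge0 ?(ltW u0) ?(ltW v0).
have T3 : t ^+ 3 * u ^+ 3 * (E / v) <= t ^+ 3 * (s ^+ 2 * g).
  rewrite -mulrA ler_wpM2l ?exprn_ge0// ler_pM// ?exprn_ge0 ?(ltW u0)//.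
  by rewrite divr_ge0 ?expR_ge0.
(* From exp (s / 4) >= (s / 4)^3 / 3! = s^3 / 384; hence the 384 in [sM]. *)
have sg : s ^+ 2 * g <= 384 / s.
  rewrite /g expRN ler_pdivrMr ?expR_gt0// mulrAC ler_pdivlMr//.
  have s4 : 0 <= s / 4 by rewrite divr_ge0// ltW.
  have := expR_ge1Dxn 2 s4; rewrite (_ : 3`! = 6)%N//.
  by rewrite exprMn -exprSr; lra.
apply: (@le_trans _ _ (c * (s ^+ 2 * g) * K)).
  by rewrite ler_wpM2r// /c !mulrDl; lra.
apply: (@le_trans _ _ (c * (384 / s) * K)).
  by rewrite ler_wpM2r// ler_wpM2l.
rewrite (_ : _ * K = (384 * (c * K)) / s); last by ring.
by rewrite ler_pdivrMr// mul1r.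
Unshelve. all: by end_near. Qed.

End scales.

(** * Comparison of three exponential tilts *)

Section tilted_comparison.
Context (R : realType).
Implicit Types (x g s c u : R) (n : nat).

(** Bookkeeping for [sum_W_lower]: from a total tilted mass of at least e^(c-2), two outer parts of
    at most e^(c-5) each are removed, and e^(c-3) remains. *)
Lemma expR_gap c : expR (c - 3) + 2 * expR (c - 5) <= expR (c - 2).
Proof.
have e1 : expR (- 1) <= 2^-1 :> R.
  rewrite expRN lef_pV2 ?posrE ?expR_gt0//.
  by apply: le_trans (expR_ge1Dx 1); rewrite (_ : 2 = 1 + 1).
have cE k : expR (c - k%:R) = expR c * expR (- 1) ^+ k.
  by rewrite -expRM_natl -expRD mulrN1.
rewrite !cE; set p := expR (- 1) in e1 *.
have p0 : 0 <= p by exact: expR_ge0.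
have p3 : p ^+ 3 <= 4^-1.
  rewrite exprS (_ : 4^-1 = 2^-1 * 2^-1); last by field.
  apply: ler_pM => //; first exact: exprn_ge0.
  by apply: (le_trans _ e1); rewrite expr2 ler_piMl// (le_trans e1)// invf_le1// ler1n.
have pp : p + 2 * p ^+ 3 <= 1 by lra.
have cp : 0 <= expR c * p ^+ 2 by rewrite mulr_ge0 ?exprn_ge0 ?expR_ge0.
have := ler_wpM2l cp pp.
rewrite (_ : _ * (p + 2 * p ^+ 3) = expR c * p ^+ 3 + 2 * (expR c * p ^+ 5)); last by ring.
by rewrite mulr1.
Qed.

(** Completing the square: g x + x^2 / 2 and -g (x + 2g) + (x + 2g)^2 / 2 both equal (x + g)^2 / 2 -
    g^2 / 2. The gain g^2 s / 2 is at least 6, which covers the constants 1 and 5. *)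
Lemma tilt_cost x g s : 0 < g -> 12 / g ^+ 2 <= s ->
  expR (g * x * s + (x ^+ 2 / 2 * s + 1)) <= expR ((x + g) ^+ 2 / 2 * s - 5) /\
  expR (- (g * (x + 2 * g) * s) + ((x + 2 * g) ^+ 2 / 2 * s + 1)) <=
    expR ((x + g) ^+ 2 / 2 * s - 5).
Proof.
move=> g0; rewrite ler_pdivrMr ?exprn_gt0// => h.
have gs : 0 <= g ^+ 2 / 2 * s - 6 by lra.
split; rewrite ler_expR -subr_ge0; apply: (le_trans gs); rewrite le_eqVlt; apply/orP; left;
  by apply/eqP; field.
Qed.

(** Three ranges of u, cut at x and x + 2g times the scale. Below, the smaller tilt x dominates up
    to a constant factor; above, the larger tilt x + 2g does; in between, the exponential is at most
    its value at the upper end. *)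
Lemma expR_tilt_le x g n u : 0 < ln (n%:R : R) -> 0 <= x -> 0 < g ->
  expR (tilt (x + g) n * u) <=
    expR ((x + g) * (x + 2 * g) * ln n%:R) * (x * scale R n <= u)%R%:R +
    (expR (g * x * ln n%:R) * expR (tilt x n * u) +
    expR (- (g * (x + 2 * g) * ln n%:R)) * expR (tilt (x + 2 * g) n * u)).
Proof.
move=> s0 x0 g0.
have xg0 : 0 <= x + g by rewrite addr_ge0// ltW.
have lin (t : R) : tilt t n * scale R n = t * ln n%:R by exact: tilt_scale.
have tiltD (t r v : R) : tilt (t + r) n * v = tilt t n * v + tilt r n * v.
  by rewrite /tilt; ring.
have tilt_mono (t v r : R) : 0 <= t -> v <= r * scale R n -> tilt t n * v <= t * r * ln n%:R.
  move=> t0 vr; apply: (le_trans (ler_wpM2l (tilt_ge0 n t0) vr)).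
  by rewrite mulrCA lin mulrCA mulrA.
have p1 : 0 <= expR (g * x * ln n%:R) * expR (tilt x n * u).
  by rewrite mulr_ge0 ?expR_ge0.
have p2 : 0 <= expR (- (g * (x + 2 * g) * ln n%:R)) * expR (tilt (x + 2 * g) n * u).
  by rewrite mulr_ge0 ?expR_ge0.
have p3 : 0 <= expR ((x + g) * (x + 2 * g) * ln n%:R) * (x * scale R n <= u)%R%:R.
  by rewrite mulr_ge0 ?expR_ge0.
have [ux|xu] := leP u (x * scale R n).
  apply: ler_wpDl => //; apply: ler_wpDr => //.
  by rewrite -expRD ler_expR tiltD addrC lerD2r; exact/tilt_mono/ux/ltW.
have [uxg|xgu] := leP u ((x + 2 * g) * scale R n).
  apply: ler_wpDr; first exact: addr_ge0.
  by rewrite (ltW xu) mulr1 ler_expR; exact: tilt_mono.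
apply: ler_wpDl => //; apply: ler_wpDl => //.
rewrite -expRD ler_expR (_ : x + 2 * g = x + g + g); last by ring.
rewrite (tiltD (x + g) g) addrCA lerDl addrC subr_ge0.
rewrite (_ : g * (x + g + g) * _ = tilt g n * ((x + 2 * g) * scale R n)).
  exact: ler_wpM2l (tilt_ge0 n (ltW g0)) _ _ (ltW xgu).
by rewrite [RHS]mulrCA lin; ring.
Qed.

End tilted_comparison.

(** * Tails of sums of truncated products *)

Section moderate_deviations.
Context d (T : measurableType d) (R : realType) (P : probability T R).
Variables (Z : nat -> nat -> T -> R) (C : R).
Hypothesis H : std_array P Z C.

Local Notation Y := (fun ki : nat * nat => Z ki.1 ki.2).
Let mY (ki : nat * nat) : measurable_fun setT (Y ki) := std_meas H ki.1 ki.2.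
Let C0 : 0 <= C := C_ge0 H.
Let D : R := (1 + C) ^+ 2.
Let D0 : 0 <= D. Proof. by rewrite exprn_ge0// addr_ge0. Qed.
Local Notation level e n := (e * scale R n).

Let mW b k i j : sub_measurable Y (row k) (W Z b k i j).
Proof. exact: sub_measurable_W. Qed.

Lemma measurable_sumW b i j (s : seq nat) :
  measurable_fun setT (fun w => \sum_(k <- s) W Z b k i j w).
Proof.
apply: measurable_sum => k.
exact: (sub_measurable_measurable mY (@mW b k i j)).
Qed.

(** Level and tilt are fixed by n, while the sum runs over any set of at most r n rows. Thus one
    bound serves full sums (r = 1) and increments inside a block (r = 1 / c). *)
Lemma sum_W_tail t e : 0 <= t -> 0 < e -> t * e <= 4^-1 ->
  \forall n \near \oo, forall i j (s : seq nat) (r x : R), i != j -> uniq s ->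
    (size s <= n)%N -> (size s)%:R <= r * n%:R -> 
    (P [set w | (x * scale R n <= `|\sum_(k <- s) W Z (level e n) k i j w|)%R] <=
     (2 * expR (1 + r * (t ^+ 2 / 2) * ln n%:R - t * x * ln n%:R))%:E)%E.
Proof.
move=> t0 e0 te.
near=> n => i j s r x ij us sn sr.
have s1 : 1 <= ln (n%:R : R) by near: n; exact: near_ln_ge.
have s0 : 0 < ln (n%:R : R) by exact: lt_le_trans s1.
have err : n%:R * (mgf_error (level e n) (tilt t n) * D) <= 1.
  by near: n; exact: mgf_error_small.
have b0 : 0 < level e n by rewrite mulr_gt0// scale_gt0.
set l := tilt t n in err.
have l0 : 0 <= l by exact: tilt_ge0.
set a := l ^+ 2 / 2 + mgf_error (level e n) l * D.
have err0 : 0 <= mgf_error (level e n) l * D by rewrite mulr_ge0// mgf_error_ge0.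
have n0 : 0 < (n%:R : R) by rewrite nat_expR// expR_gt0.
have expo : (size s)%:R * a - l * (x * scale R n) <=
    1 + r * (t ^+ 2 / 2) * ln n%:R - t * x * ln n%:R.
  rewrite (mulrCA l) tilt_scale// (_ : x * _ = t * x * ln n%:R); last by ring.
  rewrite lerD2r /a mulrDr addrC lerD//.
    by apply: le_trans err; rewrite ler_wpM2r// ler_nat.
  rewrite (_ : r * _ * _ = r * (t ^+ 2 * ln n%:R / 2)); last by ring.
  rewrite -tilt_sq// -/l.
  rewrite (_ : r * _ = r * n%:R * (l ^+ 2 / 2)); last by ring.
  by rewrite ler_wpM2r// divr_ge0// sqr_ge0.
have E1 k : \int[P]_w expR (l * W Z (level e n) k i j w) <= 1 + a.
  have /ler_normlP[_] := mgf_W H l k b0 ij.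
  by rewrite /a -/D; lra.
have E2 k : \int[P]_w expR (l * - W Z (level e n) k i j w) <= 1 + a.
  have /ler_normlP[_] := mgf_W H (- l) k b0 ij.
  rewrite (_ : mgf_error _ (- l) = mgf_error (level e n) l); last first.
    by rewrite /mgf_error normrN sqrrN.
  rewrite (_ : (\int[P]_w _) = \int[P]_w expR (l * - W Z (level e n) k i j w)).
    by rewrite sqrrN /a -/D; lra.
  by apply: eq_Rintegral => w _; rewrite mulrN mulNr.
have bW k w : `|W Z (level e n) k i j w| <= level e n by exact/W_le/ltW.
have bW' k w : `|- W Z (level e n) k i j w| <= level e n by rewrite normrN; exact/W_le/ltW.
have mW' k : sub_measurable Y (row k) (fun w => - W Z (level e n) k i j w).
  by apply: measurableT_comp => //; exact: mW.
have c1 := @chernoff_sum _ _ _ _ _ _ H s (fun k => W Z (level e n) k i j) l (level e n) a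
  (x * scale R n) us (fun k => @mW _ k i j) bW l0 E1.
have c2 := @chernoff_sum _ _ _ _ _ _ H s (fun k w => - W Z (level e n) k i j w) l (level e n) a
  (x * scale R n) us mW' bW' l0 E2.
have mS := measurable_sumW (level e n) i j s.
have mS' : measurable_fun setT (fun w => \sum_(k <- s) - W Z (level e n) k i j w).
  rewrite (_ : (fun _ => _) = (fun w => - (\sum_(k <- s) W Z (level e n) k i j w))).
    exact: measurableT_comp.
  by apply/funext => w; rewrite sumrN.
have mA (f : T -> R) y : measurable_fun setT f -> measurable [set w | y <= f w].
  by move=> mf; rewrite -[X in measurable X]setTI; apply: measurable_fun_le.
pose A1 := [set w | x * scale R n <= \sum_(k <- s) W Z (level e n) k i j w].
pose A2 := [set w | x * scale R n <= \sum_(k <- s) - W Z (level e n) k i j w].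
have mA1 : measurable A1 by exact: mA.
have mA2 : measurable A2 by exact: mA.
rewrite (_ : [set w | _] = A1 `|` A2); last first.
  by apply/seteqP; split=> w /=; rewrite /A1 /A2 /= sumrN ler_normr => /orP.
apply: (@le_trans _ _ (P A1 + P A2)%E); first exact: measureU2.
rewrite mulr_natl mulr2n EFinD; apply: leeD.
  by apply: (le_trans c1); rewrite lee_fin ler_expR.
by apply: (le_trans c2); rewrite lee_fin ler_expR.
Unshelve. all: by end_near. Qed.

Lemma sum_W_upper t e : 0 <= t -> 0 < e -> t * e <= 4^-1 ->
  \forall n \near \oo, forall i j, i != j ->
    (P [set w | (t * scale R n <= \sum_(0 <= k < n) W Z (level e n) k i j w)%R] <=
     (expR (1 - t ^+ 2 / 2 * ln n%:R))%:E)%E.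
Proof.
move=> t0 e0 te.
near=> n => i j ij.
have s1 : 1 <= ln (n%:R : R) by near: n; exact: near_ln_ge.
have s0 : 0 < ln (n%:R : R) by exact: lt_le_trans s1.
have err : n%:R * (mgf_error (level e n) (tilt t n) * D) <= 1.
  by near: n; exact: mgf_error_small.
have b0 : 0 < level e n by rewrite mulr_gt0// scale_gt0.
set l := tilt t n in err.
have l0 : 0 <= l by exact: tilt_ge0.
set a := l ^+ 2 / 2 + mgf_error (level e n) l * D.
have E1 k : \int[P]_w expR (l * W Z (level e n) k i j w) <= 1 + a.
  have /ler_normlP[_] := mgf_W H l k b0 ij.
  by rewrite /a -/D; lra.
have bW k w : `|W Z (level e n) k i j w| <= level e n by exact/W_le/ltW.
apply: (le_trans (@chernoff_sum _ _ _ _ _ _ H (index_iota 0 n)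
  (fun k => W Z (level e n) k i j) l (level e n) a
  (t * scale R n) (iota_uniq _ _) (fun k => @mW _ k i j) bW l0 E1)).
rewrite lee_fin ler_expR size_iota subn0 (mulrCA l) tilt_scale// /a mulrDr.
have := tilt_sq t s0; rewrite -/l; lra.
Unshelve. all: by end_near. Qed.

(** On the joint event the two sums add up to at least 2 t [scale n]. Chernoff's bound for the added
    sums at tilt l has exponent n l^2 - 2 l t [scale n] up to a constant, which is -t^2 ln n. *)
Lemma sum_W_joint t e : 0 <= t -> 0 < e -> 2 * t * e <= 4^-1 ->
  \forall n \near \oo, forall i j m, i != j -> i != m -> j != m ->
    (P [set w | (t * scale R n <= \sum_(0 <= k < n) W Z (level e n) k i j w)%R /\
                (t * scale R n <= \sum_(0 <= k < n) W Z (level e n) k i m w)%R] <=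
     (expR (1 - t ^+ 2 * ln n%:R))%:E)%E.
Proof.
move=> t0 e0 te.
near=> n => i j m ij im jm.
have s1 : 1 <= ln (n%:R : R) by near: n; exact: near_ln_ge.
have s0 : 0 < ln (n%:R : R) by exact: lt_le_trans s1.
have err : n%:R * (mgf_error (level e n) (tilt (2 * t) n) * (8 * D)) <= 1.
  by near: n; apply: mgf_error_small => //; rewrite mulr_ge0.
have b0 : 0 < level e n by rewrite mulr_gt0// scale_gt0.
set l := tilt t n.
have l0 : 0 <= l by exact: tilt_ge0.
have l2 : tilt (2 * t) n = 2 * l by rewrite /tilt mulrA.
rewrite l2 in err.
pose V k w := W Z (level e n) k i j w + W Z (level e n) k i m w.
set a := l ^+ 2 + 8 * mgf_error (level e n) (2 * l) * D.
have E1 k : \int[P]_w expR (l * V k w) <= 1 + a.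
  by rewrite /V /a addrA; exact: mgf_W2.
have bW k w : `|V k w| <= 2 * level e n.
  apply: (le_trans (ler_normD _ _)); rewrite mulrDl mul1r.
  by apply: lerD; exact/W_le/ltW.
have mV k : sub_measurable Y (row k) (V k) by apply: measurable_funD; exact: mW.
apply: (@le_trans _ _ (P [set w | (2 * (t * scale R n) <= \sum_(0 <= k < n) V k w)%R])).
  have mS i' j' : measurable [set w | t * scale R n <=
      \sum_(0 <= k < n) W Z (level e n) k i' j' w].
    rewrite -[X in measurable X]setTI; apply: measurable_fun_le => //.
    exact: measurable_sumW.
  apply: le_measure; rewrite ?inE.
  - by have := measurableI _ _ (mS i j) (mS i m).
  - rewrite -[X in measurable X]setTI; apply: measurable_fun_le => //.
    apply: measurable_sum => k.
    by apply: (sub_measurable_measurable mY (@mV k)).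
  - by move=> w /= [h1 h2]; rewrite /V big_split/= mulr2n mulrDl mul1r lerD.
apply: (le_trans (@chernoff_sum _ _ _ _ _ _ H (index_iota 0 n) V l (2 * level e n) a
  (2 * (t * scale R n)) (iota_uniq _ _) (@mV) bW l0 E1)).
rewrite lee_fin ler_expR size_iota subn0 (mulrCA l) (mulrCA l) tilt_scale// /a mulrDr.
have := tilt_sq t s0; rewrite -/l; lra.
Unshelve. all: by end_near. Qed.

Lemma sum_W_mgf_le b t n i j : 0 < ln (n%:R : R) -> 0 < b -> i != j ->
  n%:R * (mgf_error b (tilt t n) * D) <= 1 ->
  integ P (fun w => expR (tilt t n * \sum_(0 <= k < n) W Z b k i j w)) /\
  \int[P]_w expR (tilt t n * \sum_(0 <= k < n) W Z b k i j w) <=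
    expR (t ^+ 2 / 2 * ln n%:R + 1).
Proof.
move=> s0 b0 ij err.
have bW k w : `|W Z b k i j w| <= b by exact/W_le/ltW.
split; first exact: (mgf_sum H _ (iota_uniq _ _) (fun k => @mW _ k i j) bW).1.
have lsq := tilt_sq t s0; set l := tilt t n in err lsq *.
have E1 k : \int[P]_w expR (l * W Z b k i j w) <= 1 + (l ^+ 2 / 2 + mgf_error b l * D).
  by have /ler_normlP[_] := mgf_W H l k b0 ij; rewrite -/D; lra.
apply: (le_trans (mgf_sum_le H (iota_uniq 0 (n - 0)) (fun k => @mW _ k i j) bW E1)).
rewrite ler_expR size_iota subn0 mulrDr mulrA lsq mulrAC lerD2l.
exact: err.
Qed.

(** The loss 2 has two parts, each at most 1: the error of the second-order expansion and the u^2 of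
    [expR_le_1D], both summed over n rows. *)
Lemma sum_W_mgf_ge b t n i j : 0 < ln (n%:R : R) -> 0 < b -> i != j -> 0 < t ->
  2 * t ^+ 4 <= ln (n%:R : R) -> 2 / t ^+ 2 <= ln (n%:R : R) ->
  n%:R * (mgf_error b (tilt t n) * D) <= 1 ->
  expR (t ^+ 2 / 2 * ln n%:R - 2) <=
    \int[P]_w expR (tilt t n * \sum_(0 <= k < n) W Z b k i j w).
Proof.
move=> s0 b0 ij t0 sM sM' Err1.
have nE : (n%:R : R) = expR (ln n%:R) by exact: nat_expR.
have n0 : 0 < (n%:R : R) by rewrite nE expR_gt0.
have bW k w : `|W Z b k i j w| <= b by exact/W_le/ltW.
have lsq := tilt_sq t s0; set s : R := ln n%:R in sM sM' s0 nE lsq *.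
set l := tilt t n in Err1 lsq *; set er := mgf_error b l * D in Err1 *.
have er0 : 0 <= er by rewrite mulr_ge0// mgf_error_ge0.
set u := l ^+ 2 / 2 - er.
have u0 : 0 <= u.
  rewrite /u subr_ge0 -(ler_pM2l n0).
  apply: (le_trans Err1); rewrite mulrA lsq.
  by move: sM'; rewrite ler_pdivrMr ?exprn_gt0// ler_pdivlMr// mul1r mulrC.
have E1 k : 1 + u <= \int[P]_w expR (l * W Z b k i j w).
  have /ler_normlP[+ _] := mgf_W H l k b0 ij.
  by rewrite -/D -/er /u opprB lerBlDr => h; rewrite addrA lerBlDl.
apply: (le_trans _ (mgf_sum_ge H (iota_uniq 0 (n - 0)) (fun k => @mW _ k i j) bW u0 E1)).
rewrite ler_expR size_iota subn0.
have u2 : u ^+ 2 <= (l ^+ 2 / 2) ^+ 2.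
  by rewrite lerXn2r ?nnegrE ?divr_ge0 ?sqr_ge0// /u lerBlDr lerDl.
(* The left side is t^4 s^2 / (4 n), and n = e^s >= s^3 / 6 while s >= 2 t^4. *)
have nu2 : n%:R * (l ^+ 2 / 2) ^+ 2 <= 1.
  rewrite (_ : _ * _ = (n%:R * l ^+ 2) ^+ 2 / (4 * n%:R)); last first.
    by field; rewrite gt_eqF.
  rewrite lsq ler_pdivrMr ?mulr_gt0// mul1r.
  have := expR_ge1Dxn 2 (ltW s0); rewrite -nE (_ : 3`! = 6)%N// => h.
  have h2 : 2 * t ^+ 4 * s ^+ 2 <= s ^+ 3.
    by rewrite [leRHS]exprS ler_wpM2r// exprn_ge0// ltW.
  have h3 : s ^+ 3 <= 6 * n%:R.
    rewrite mulrC -ler_pdivrMr//; apply: le_trans h.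
    by rewrite lerDr.
  rewrite exprMn -exprM -(ler_pM2l (_ : 0 < 2))// mulrA; apply: (le_trans h2).
  by apply: (le_trans h3); rewrite mulrA ler_pM2r// -natrM ler_nat.
have nu2' : n%:R * u ^+ 2 <= 1.
  by apply: le_trans nu2; rewrite ler_wpM2l// ltW.
have -> : n%:R * (u - u ^+ 2) = t ^+ 2 / 2 * s - (n%:R * er + n%:R * u ^+ 2).
  by rewrite mulrBr {1}/u mulrBr mulrA lsq mulrAC; ring.
by rewrite lerD2l lerN2 (_ : 2 = 1 + 1)// lerD.
Qed.

(* Comparing the moment generating functions at t = x, x + g and x + 2g: under
   the tilting at x + g, the sum lies in [x, x + 2g] times [scale n] with
   probability close to 1. *)
Lemma sum_W_lower x g e : 0 <= x -> 0 < g -> 0 < e -> (x + 2 * g) * e <= 4^-1 ->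
  \forall n \near \oo, forall i j, i != j ->
    ((expR (- 3 - (x + g) * (x + 3 * g) / 2 * ln n%:R))%:E <=
    P [set w | (x * scale R n <= \sum_(0 <= k < n) W Z (level e n) k i j w)%R])%E.
Proof.
move=> x0 g0 e0 xge.
have xg0 : 0 < x + g by rewrite ltr_wpDl.
have xgg0 : 0 <= x + 2 * g by rewrite addr_ge0// mulr_ge0// ltW.
have le1 : x * e <= 4^-1.
  by apply: le_trans xge; rewrite ler_wpM2r ?(ltW e0)// lerDl mulr_ge0// ltW.
have le2 : (x + g) * e <= 4^-1.
  by apply: le_trans xge; rewrite ler_wpM2r ?(ltW e0)// lerD2l ler_peMl ?ler1n// ltW.
have err0 : \forall n \near \oo, n%:R * (mgf_error (level e n) (tilt x n) * D) <= 1.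
  exact: mgf_error_small.
have err1 : \forall n \near \oo, n%:R * (mgf_error (level e n) (tilt (x + g) n) * D) <= 1.
  by apply: mgf_error_small => //; exact: ltW.
have err2 : \forall n \near \oo, n%:R * (mgf_error (level e n) (tilt (x + 2 * g) n) * D) <= 1.
  exact: mgf_error_small.
near=> n => i j ij.
have s1 : 1 <= ln (n%:R : R) by near: n; exact: near_ln_ge.
have sM : 2 * (x + g) ^+ 4 <= ln (n%:R : R) by near: n; exact: near_ln_ge.
have sM' : 2 / (x + g) ^+ 2 <= ln (n%:R : R) by near: n; exact: near_ln_ge.
have sg : 12 / g ^+ 2 <= ln (n%:R : R) by near: n; exact: near_ln_ge.
have s0 : 0 < ln (n%:R : R) by exact: lt_le_trans s1.
have b0 : 0 < level e n by rewrite mulr_gt0// scale_gt0.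
have Err0 : n%:R * (mgf_error (level e n) (tilt x n) * D) <= 1 by near: n.
have Err1 : n%:R * (mgf_error (level e n) (tilt (x + g) n) * D) <= 1 by near: n.
have Err2 : n%:R * (mgf_error (level e n) (tilt (x + 2 * g) n) * D) <= 1 by near: n.
have [i0 m0] := @sum_W_mgf_le _ x n i j s0 b0 ij Err0.
have [i1 _] := @sum_W_mgf_le _ (x + g) n i j s0 b0 ij Err1.
have [i2 m2] := @sum_W_mgf_le _ (x + 2 * g) n i j s0 b0 ij Err2.
have m1 := @sum_W_mgf_ge _ (x + g) n i j s0 b0 ij xg0 sM sM' Err1.
pose S w := \sum_(0 <= k < n) W Z (level e n) k i j w.
set s : R := ln n%:R in s0 m0 m1 m2 sg *.
pose A := [set w | x * scale R n <= S w].
have mS : measurable_fun setT S by exact: measurable_sumW.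
have mA : measurable A.
  by rewrite -[X in measurable X]setTI; apply: measurable_fun_le.
have iA : integ P (\1_A : T -> R).
  apply: (@integ_bounded _ _ _ _ _ 1); first exact: measurable_indic.
  by move=> w; rewrite indicE; case: (_ \in _); rewrite ?normr1 ?normr0.
have EA : \int[P]_w (\1_A w : R) = fine (P A).
  by rewrite /Rintegral integral_indic// setIT.
have point w : expR (tilt (x + g) n * S w) <=
    expR ((x + g) * (x + 2 * g) * s) * \1_A w +
    (expR (g * x * s) * expR (tilt x n * S w) +
    expR (- (g * (x + 2 * g) * s)) * expR (tilt (x + 2 * g) n * S w)).
  rewrite indicE (_ : (w \in A) = (x * scale R n <= S w)).
    exact: expR_tilt_le.
  by apply/idP/idP; rewrite inE.
have j0 := integZ (expR (g * x * s)) i0.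
have j2 := integZ (expR (- (g * (x + 2 * g) * s))) i2.
have jA := integZ (expR ((x + g) * (x + 2 * g) * s)) iA.
have j02 := integD j0 j2.
have := ler_Rint i1 (integD jA j02) point.
rewrite RintegralD// RintegralD// !RintegralZl// EA => hint.
have q0 := ler_wpM2l (expR_ge0 (g * x * s)) m0.
have q2 := ler_wpM2l (expR_ge0 (- (g * (x + 2 * g) * s))) m2.
rewrite -!expRD in q0 q2.
have [] := tilt_cost x g0 sg; move: m1; set c := (x + g) ^+ 2 / 2 * s => m1 r0 r2.
(* Under the tilt x + g the outer ranges carry at most 2 e^(c-5) of a mass of at least e^(c-2), so
   the event A must carry the rest. *)
have fin : expR (c - 3) <= expR ((x + g) * (x + 2 * g) * s) * fine (P A).
  have h0 := le_trans q0 r0.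
  have h2 := le_trans q2 r2.
  have h3 := lerD h0 h2.
  have h4 := lerD (lexx (expR ((x + g) * (x + 2 * g) * s) * fine (P A))) h3.
  have h5 := le_trans m1 hint.
  have h := le_trans h5 h4.
  rewrite -(lerD2r (expR (c - 5) + expR (c - 5))).
  apply: le_trans h.
  by rewrite -mulr2n -[_ *+ 2]mulr_natl; exact: expR_gap.
have fA : P A \is a fin_num by exact: fin_num_measure.
rewrite -(fineK fA) lee_fin.
rewrite -(ler_pM2l (expR_gt0 ((x + g) * (x + 2 * g) * s))).
apply: le_trans fin; rewrite -expRD ler_expR /c.
by rewrite le_eqVlt; apply/orP; left; apply/eqP; field.
Unshelve. all: by end_near. Qed.

End moderate_deviations.

(** * Borel-Cantelli lemmas and the second-moment method *)

Section borel_cantelli_tools.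
Context d (T : measurableType d) (R : realType) (P : probability T R).

Lemma union_bound (K : eqType) (s : seq K) (F : K -> set T) (b : R) :
  (forall k, k \in s -> measurable (F k)) ->
  (forall k, k \in s -> (P (F k) <= b%:E)%E) ->
  (P (\big[setU/set0]_(k <- s) F k) <= ((size s)%:R * b)%:E)%E.
Proof.
elim: s => [|k s IH] mF Fb; first by rewrite big_nil measure0 mul0r.
have mFs j : j \in s -> measurable (F j) by move=> js; apply: mF; rewrite inE js orbT.
have mk : measurable (F k) by apply: mF; rewrite inE eqxx.
have ms : measurable (\big[setU/set0]_(k <- s) F k).
  by rewrite big_seq; apply: bigsetU_measurable => j js; exact: mFs.
rewrite big_cons; apply: (@le_trans _ _ (P (F k) + P (\big[setU/set0]_(k <- s) F k))%E).
  exact: measureU2.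
have -> : (size (k :: s))%:R * b = b + (size s)%:R * b by rewrite /= -natr1; ring.
rewrite EFinD; apply: leeD.
  by apply: Fb; rewrite inE eqxx.
by apply: IH => [j|j] js; [exact: mFs|apply: Fb; rewrite inE js orbT].
Qed.

Lemma nneseries_le (u : nat -> \bar R) (B : \bar R) : (forall n, (0 <= u n)%E) ->
  (forall N, (\sum_(0 <= n < N) u n <= B)%E) -> (\sum_(0 <= n <oo) u n <= B)%E.
Proof.
move=> u0 uB; apply: lime_le; first by apply: is_cvg_nneseries.
by apply: nearW.
Qed.

Lemma borel_cantelli (F : nat -> set T) : (forall l, measurable (F l)) ->
  (\sum_(0 <= l <oo) P (F l) < +oo)%E ->
  {ae P, forall w, \forall l \near \oo, ~ F l w}.
Proof.
move=> mF h; have h0 := lim_sup_set_cvg0 mF h.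
exists (lim_sup_set F); split => //.
  by apply: bigcapT_measurable => n; apply: bigcup_measurable.
move=> w /= hw n _; apply: contrapT => hn; apply: hw.
exists n => // l /= nl Fl; apply: hn; exists l => //.
Qed.

(** Along n = c 2^l a bound K n^-a is geometric in l with ratio 2^-a, so any polynomial gain,
    however small, is summable. *)
Lemma borel_cantelli_geometric (F : nat -> set T) (c : nat) (K a : R) :
  (0 < c)%N -> 0 < a -> (forall l, measurable (F l)) ->
  (\forall l \near \oo, (P (F l) <= (K * expR (- (a * ln (c * 2 ^ l)%:R)))%:E)%E) ->
  {ae P, forall w, \forall l \near \oo, ~ F l w}.
Proof.
move=> c0 a0 mF [N _ hN].
pose G l := if (N <= l)%N then F l else set0.
have mG l : measurable (G l) by rewrite /G; case: ifP.
pose q : R := expR (- (a * ln 2)).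
have q0 : 0 < q by exact: expR_gt0.
have q1 : q < 1.
  by rewrite expR_lt1 oppr_lt0 mulr_gt0// ln_gt0// ltr1n.
have GK l : (P (G l) <= (`|K| * q ^+ l)%:E)%E.
  rewrite /G; case: ifP => Nl; last first.
    by rewrite measure0 lee_fin mulr_ge0// exprn_ge0// ltW.
  apply: (le_trans (hN l Nl)); rewrite lee_fin.
  apply: (le_trans (ler_wpM2r (expR_ge0 _) (ler_norm K))).
  rewrite ler_wpM2l// /q -expRM_natl ler_expR mulrN lerN2.
  rewrite natrM natrX lnM ?posrE ?exprn_gt0 ?ltr0n// lnXn// mulrDr -mulr_natr.
  have : 0 <= a * ln (c%:R : R) by rewrite mulr_ge0 ?(ltW a0)// ln_ge0// ler1n.
  lra.
have : {ae P, forall w, \forall l \near \oo, ~ G l w}.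
  apply: borel_cantelli => //.
  apply: (@le_lt_trans _ _ (`|K| / (1 - q))%:E); last by rewrite ltry.
  apply: nneseries_le => // n.
  apply: (@le_trans _ _ (\sum_(0 <= l < n) (`|K| * q ^+ l)%:E)%E).
    by apply: lee_sum => l _.
  rewrite sumEFin lee_fin -mulr_sumr ler_wpM2l//.
  rewrite -[leRHS]mul1r ler_pdivlMr ?subr_gt0//.
  have : (1 - q) * (\sum_(0 <= l < n) q ^+ l) = 1 - q ^+ n.
    by rewrite big_mkord -(opprB q) mulNr -subrX1 opprB.
  by rewrite mulrC => ->; rewrite gerBl exprn_ge0// ltW.
apply: filterS => w [N' _ h]; exists (maxn N N') => // l /=.
rewrite geq_max => /andP[Nl N'l] Fl; apply: (h l N'l).
by rewrite /G Nl.
Qed.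

Lemma measurable_none (h : nat) (D : 'I_h -> 'I_h -> set T) :
  (forall i j, measurable (D i j)) -> measurable [set w | forall i j, ~ D i j w].
Proof.
move=> mD.
rewrite (_ : [set _ | _] = \bigcap_(i in setT) \bigcap_(j in setT) ~` D i j).
  apply: fin_bigcap_measurable => [|i _]; first exact: finite_finset.
  apply: fin_bigcap_measurable => [|j _]; first exact: finite_finset.
  exact: measurableC.
apply/seteqP; split => w /= hw i; last by move=> j; exact: (hw i I j I).
by move=> _ j _; exact: hw.
Qed.

(* Chebyshev's inequality for the number of events that occur. *)
Lemma second_moment (h : nat) (D : 'I_h -> 'I_h -> set T) (a1 a2 q : R) :
  (0 < h)%N -> 0 < q -> 0 <= a2 ->
  (forall i j, measurable (D i j)) ->
  (forall i j, (q%:E <= P (D i j))%E) -> (forall i j, (P (D i j) <= a1%:E)%E) ->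
  (forall i j j', j != j' -> (P (D i j `&` D i j') <= a2%:E)%E) ->
  (forall i i' j, i != i' -> (P (D i j `&` D i' j) <= a2%:E)%E) ->
  (forall i j i' j', i != i' -> j != j' ->
    P (D i j `&` D i' j') = (P (D i j) * P (D i' j'))%E) ->
  (P [set w | forall i j, ~ D i j w] <=
    ((a1 + 2 * h%:R * a2) / (h%:R ^+ 2 * q ^+ 2))%:E)%E.
Proof.
move=> h0 q0 a20 mD qD Da1 Dr Dc Di.
pose E := ('I_h * 'I_h)%type.
pose A (e : E) := D e.1 e.2.
pose p (e : E) : R := fine (P (A e)).
have mA (e : E) : measurable (A e) by exact: mD.
have fA (e : E) : P (A e) \is a fin_num by exact: fin_num_measure.
have pE (e : E) : P (A e) = (p e)%:E by rewrite /p fineK.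
pose f (e : E) (w : T) : R := \1_(A e) w - p e.
have i1 (B : set T) : measurable B -> integ P (\1_B : T -> R).
  move=> mB; apply: (@integ_bounded _ _ _ _ _ 1); first exact: measurable_indic.
  by move=> w; rewrite indicE; case: (_ \in _); rewrite ?normr1 ?normr0.
have EB (B : set T) : measurable B -> \int[P]_w (\1_B w : R) = fine (P B).
  by move=> mB; rewrite /Rintegral integral_indic// setIT.
pose g (e e' : E) (w : T) : R := f e w * f e' w.
have gE (e e' : E) : integ P (g e e') /\
    \int[P]_w g e e' w = fine (P (A e `&` A e')) - p e * p e'.
  have mI : measurable (A e `&` A e') by exact: measurableI.
  have -> : g e e' = (fun w => \1_(A e `&` A e') w - p e' * \1_(A e) w
      - p e * \1_(A e') w + p e * p e').
    by apply/funext => w; rewrite /g /f indicI /=; ring.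
  have j1 := i1 _ mI; have j2 := integZ (p e') (i1 _ (mD e.1 e.2)).
  have j3 := integZ (p e) (i1 _ (mD e'.1 e'.2)).
  have j12 := integB j1 j2; have j123 := integB j12 j3.
  split; first by apply: integD => //; exact: integ_cst.
  rewrite RintegralD//; last exact: integ_cst.
  rewrite RintegralB// RintegralB// !RintegralZl//; try exact: i1; last exact: integ_cst.
  rewrite Rintegral_prob_cst !EB//.
  by rewrite -/(A e) -/(A e') -/(p e) -/(p e'); ring.
pose N w := \sum_(e : E) f e w.
have N2 w : N w ^+ 2 = \sum_(e : E) \sum_(e' : E) g e e' w.
  rewrite expr2 /N mulr_suml; apply: eq_bigr => e1 _.
  by rewrite mulr_sumr.
have isum (I : finType) (F : I -> T -> R) : (forall i, integ P (F i)) ->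
    integ P (fun w => \sum_(i : I) F i w) /\
    \int[P]_w (\sum_(i : I) F i w) = \sum_(i : I) \int[P]_w F i w.
  move=> hF; elim: (index_enum I) => [|i s [IH1 IH2]].
    rewrite big_nil (_ : (fun _ => _) = cst 0); last first.
      by apply/funext => w; rewrite big_nil.
    by split; [exact: integ_cst|exact: Rintegral_prob_cst].
  rewrite big_cons (_ : (fun _ => _) = (fun w => F i w + \sum_(i <- s) F i w)); last first.
    by apply/funext => w; rewrite big_cons.
  split; first exact: integD.
  by rewrite RintegralD//; [rewrite IH2|exact: hF].
have iN e : integ P (fun w => \sum_(e' : E) g e e' w).
  by apply: (isum _ _ _).1 => e'; exact: (gE e e').1.
have iNN : integ P (fun w => N w ^+ 2).
  rewrite (_ : (fun _ => _) = (fun w => \sum_(e : E) \sum_(e' : E) g e e' w)).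
    exact: (isum _ _ _).1.
  exact/funext.
have EN : \int[P]_w (N w ^+ 2) = \sum_(e : E) \sum_(e' : E)
    (fine (P (A e `&` A e')) - p e * p e').
  transitivity (\int[P]_w (\sum_(e : E) \sum_(e' : E) g e e' w)).
    by congr fine; apply: eq_integral => w _; rewrite N2.
  rewrite (isum _ _ iN).2; apply: eq_bigr => e _.
  rewrite (isum _ (g e) (fun e' => (gE e e').1)).2.
  by apply: eq_bigr => e' _; exact: (gE e e').2.
have p0 e : 0 <= p e by exact: fine_ge0.
have fineP (B : set T) (b : R) : measurable B -> (P B <= b%:E)%E -> fine (P B) <= b.
  by move=> mB PB; rewrite -lee_fin fineK// fin_num_measure.
have a10 : 0 <= a1.
  rewrite -lee_fin; apply: le_trans (Da1 (Ordinal h0) (Ordinal h0)) => //.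
(* Covariances vanish for pairs without a common index; a pair with itself costs at most a1, and a
   single common index at most a2. *)
have cov (e e' : E) : fine (P (A e `&` A e')) - p e * p e' <=
    a1 * (e' == e)%:R + (a2 * (e'.1 == e.1)%:R + a2 * (e'.2 == e.2)%:R).
  have pp : 0 <= p e * p e' by rewrite mulr_ge0.
  have b0 (b : bool) (a : R) : 0 <= a -> 0 <= a * b%:R by move=> ?; rewrite mulr_ge0.
  have z1 := b0 (e' == e) _ a10.
  have z2 := b0 (e'.1 == e.1) _ a20; have z3 := b0 (e'.2 == e.2) _ a20.
  have [e1|e1] := eqVneq e'.1 e.1; have [e2|e2] := eqVneq e'.2 e.2.
  - have ee : e' = e by move: e e' e1 e2 {pp z1 z2 z3} => [x y] [x' y'] /= -> ->.
    rewrite ee eqxx !mulr1.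
    have : fine (P (A e `&` A e)) <= a1 by apply: fineP; rewrite setIid//; exact: Da1.
    by rewrite ee in pp; lra.
  - rewrite mulr1 mulr0.
    have : fine (P (A e `&` A e')) <= a2.
      apply: fineP; first exact: measurableI.
      by rewrite /A e1; apply: Dr; rewrite eq_sym.
    lra.
  - rewrite mulr1 mulr0.
    have : fine (P (A e `&` A e')) <= a2.
      apply: fineP; first exact: measurableI.
      by rewrite /A e2; apply: Dc; rewrite eq_sym.
    lra.
  - rewrite !mulr0 /p -fineM// -Di; [|by rewrite eq_sym|by rewrite eq_sym].
    by rewrite subrr; lra.
have ENle : \int[P]_w (N w ^+ 2) <= h%:R ^+ 2 * (a1 + 2 * h%:R * a2).
  rewrite EN; apply: (@le_trans _ _ (\sum_(e : E) (a1 + 2 * h%:R * a2))); last first.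
    rewrite sumr_const (_ : #|_| = (h ^ 2)%N); last by rewrite card_prod card_ord mulnn.
    by rewrite -[leLHS]mulr_natl natrX.
  apply: ler_sum => e _.
  apply: (@le_trans _ _ (\sum_(e' : E) (a1 * (e' == e)%:R +
     (a2 * (e'.1 == e.1)%:R + a2 * (e'.2 == e.2)%:R)))).
    by apply: ler_sum => e' _; exact: cov.
  rewrite !big_split/= -!mulr_sumr.
  have -> : \sum_(e' : E) (e' == e)%:R = 1 :> R.
    by rewrite (bigD1 e)//= eqxx big1 ?addr0// => e' /negbTE ->.
  have s1 (i0 : 'I_h) : \sum_(i : 'I_h) (i == i0)%:R = 1 :> R.
    by rewrite (bigD1 i0)//= eqxx big1 ?addr0// => e' /negbTE ->.
  have -> : \sum_(e' : E) (e'.1 == e.1)%:R = h%:R :> R.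
    rewrite -(pair_big xpredT xpredT (fun i j : 'I_h => (i == e.1)%:R))/=.
    rewrite exchange_big/= (eq_bigr (fun=> 1)); last by move=> i _; exact: s1.
    by rewrite sumr_const card_ord.
  have -> : \sum_(e' : E) (e'.2 == e.2)%:R = h%:R :> R.
    rewrite -(pair_big xpredT xpredT (fun i j : 'I_h => (j == e.2)%:R))/=.
    rewrite (eq_bigr (fun=> 1)); last by move=> i _; exact: s1.
    by rewrite sumr_const card_ord.
  lra.
have m_ge : h%:R ^+ 2 * q <= \sum_(e : E) p e.
  apply: (@le_trans _ _ (\sum_(e : E) q)).
    rewrite sumr_const (_ : #|_| = (h ^ 2)%N); last by rewrite card_prod card_ord mulnn.
    by rewrite -[leRHS]mulr_natl natrX.
  apply: ler_sum => e _; rewrite -lee_fin -pE; exact: qD.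
have hq0 : 0 < h%:R ^+ 2 * q by rewrite mulr_gt0 ?exprn_gt0 ?ltr0n.
(* If no event occurs, the centred count N is minus the sum of all probabilities, of modulus at
   least h^2 q. *)
have sub : [set w | forall i j, ~ D i j w] `<=` [set w | (h%:R ^+ 2 * q) ^+ 2 <= N w ^+ 2].
  move=> w /= hw.
  have -> : N w = - \sum_(e : E) p e.
    rewrite /N -sumrN; apply: eq_bigr => e _; rewrite /f indicE memNset ?sub0r//.
    exact: hw.
  rewrite sqrrN lerXn2r ?nnegrE ?(ltW hq0)//.
  by apply: sumr_ge0 => e _.
have mN : measurable [set w | (h%:R ^+ 2 * q) ^+ 2 <= N w ^+ 2].
  rewrite -[X in measurable X]setTI; apply: measurable_fun_le => //.
  exact: integ_measurable iNN.
have mn := measurable_none mD.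
apply: (@le_trans _ _ (P [set w | ((h%:R ^+ 2 * q) ^+ 2 <= N w ^+ 2)%R])).
  by apply: le_measure; rewrite ?inE.
have hq2 : 0 < (h%:R ^+ 2 * q) ^+ 2 by rewrite exprn_gt0.
apply: (le_trans (markov_le iNN (fun w => sqr_ge0 (N w)) hq2)).
rewrite lee_fin ler_pdivrMr//.
rewrite (_ : _ / _ * _ = h%:R ^+ 2 * (a1 + 2 * h%:R * a2))//.
by field; rewrite (gt_eqF q0) gt_eqF ?ltr0n.
Qed.

End borel_cantelli_tools.

(** * Inner products along blocks *)

Section blocks.

Lemma near_lt_bound (c0 B : nat) (Q : nat -> nat -> Prop) :
  (forall c, (c0 <= c)%N -> \forall l \near \oo, Q c l) ->
  \forall l \near \oo, forall c, (c0 <= c < B)%N -> Q c l.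
Proof.
move=> h; elim: B => [|B IH]; first by apply: nearW => l c /andP[].
have [cB|cB] := leqP c0 B; last first.
  apply: filterS IH => l hl c /andP[c0c]; rewrite ltnS => cB'; exfalso.
  by move: (leq_trans c0c cB'); rewrite leqNgt cB.
apply: filterS2 IH (h B cB) => l hl hB c /andP[c0c]; rewrite ltnS leq_eqVlt.
by move=> /predU1P[->//|cB']; apply: hl; rewrite c0c.
Qed.

(* Every n >= 2^s lies in a block [c 2^l, (c + 1) 2^l] with 2^s <= c < 2^(s+1). *)
Lemma near_blocks (s : nat) (Q : nat -> Prop) :
  (forall c, (2 ^ s <= c)%N -> \forall l \near \oo, forall n,
     (c * 2 ^ l <= n <= c * 2 ^ l + 2 ^ l)%N -> Q n) ->
  \forall n \near \oo, Q n.
Proof.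
move=> /near_lt_bound - /(_ (2 ^ s.+1)%N)[L _ hL].
exists (2 ^ (L + s))%N => // n /= Ln.
have n0 : (0 < n)%N by apply: leq_trans Ln; rewrite expn_gt0.
set t := trunc_log 2 n.
have /andP[tn nt] : (2 ^ t <= n < 2 ^ t.+1)%N by apply: trunc_log_bounds.
have Lst : (L + s <= t)%N by rewrite -ltnS -(@ltn_exp2l 2)//; exact: leq_ltn_trans nt.
have st : (s <= t)%N by apply: leq_trans Lst; exact: leq_addl.
have tE : (2 ^ t = 2 ^ s * 2 ^ (t - s))%N by rewrite -expnD subnKC.
have tE' : (2 ^ t.+1 = 2 ^ s.+1 * 2 ^ (t - s))%N by rewrite -expnD addSn subnKC.
have p0 : (0 < 2 ^ (t - s))%N by rewrite expn_gt0.
apply: (hL (t - s)%N _ (n %/ 2 ^ (t - s))%N).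
- by rewrite /= leq_subRL// addnC.
- by rewrite leq_divRL// -tE tn /= ltn_divLR// -tE'.
- rewrite leq_trunc_div /= {1}(divn_eq n (2 ^ (t - s))) leq_add2l ltnW//.
  by rewrite ltn_pmod.
Qed.

Lemma near_mul_exp2 (c : nat) (Q : nat -> Prop) : (0 < c)%N ->
  (\forall n \near \oo, Q n) -> \forall l \near \oo, Q (c * 2 ^ l)%N.
Proof.
move=> c0 [N _ hN]; exists N => // l /= Nl; apply: hN => /=.
apply: (leq_trans Nl); apply: (leq_trans (ltnW (ltn_expl l (isT : 1 < 2)%N))).
by rewrite leq_pmull.
Qed.

End blocks.

Section pair_events.
Context d (T : measurableType d) (R : realType) (P : probability T R).

Definition some_pair (m : nat) (G : nat -> nat -> set T) : set T :=
  [set w | exists i j, [/\ (i < m)%N, (j < m)%N, i != j & G i j w]].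

Lemma some_pair_bound m (G : nat -> nat -> set T) (b : R) : 0 <= b ->
  (forall i j, i != j -> measurable (G i j)) ->
  (forall i j, i != j -> (P (G i j) <= b%:E)%E) ->
  measurable (some_pair m G) /\ (P (some_pair m G) <= ((m%:R * m%:R) * b)%:E)%E.
Proof.
move=> b0 mG Gb.
pose s := [seq (i, j) | i <- iota 0 m, j <- iota 0 m].
pose F (ij : nat * nat) := if ij.1 != ij.2 then G ij.1 ij.2 else set0.
have mF ij : measurable (F ij) by rewrite /F; case: ifP => // h; exact: mG.
have E : some_pair m G = \big[setU/set0]_(ij <- s) F ij.
  rewrite -bigcup_seq; apply/seteqP; split => w /=.
    move=> [i [j [im jm ij Gw]]]; exists (i, j); last by rewrite /F /= ij.
    by apply/allpairsP; exists (i, j); rewrite !mem_iota.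
  move=> [[i j] /allpairsP[[i' j'] [/= + + [-> ->]]]]; rewrite !mem_iota /=.
  move=> im jm; rewrite /F /=; case: ifPn => // ij Gw.
  by exists i', j'.
split; first by rewrite E; apply: bigsetU_measurable.
rewrite E (_ : m%:R * m%:R = (size s)%:R :> R); last first.
  by rewrite size_allpairs !size_iota natrM.
apply: union_bound => // -[i j] _; rewrite /F /=.
by case: ifPn => [/Gb//|_]; rewrite measure0 lee_fin.
Qed.

End pair_events.

(** * Upper bounds along blocks *)

Section block_events.
Context d (T : measurableType d) (R : realType) (P : probability T R).
Variables (Z : nat -> nat -> T -> R) (C : R).
Hypothesis H : std_array P Z C.
Local Notation level e n := (e * scale R n).
Local Notation S e n a b := (fun i j w => \sum_(a <= k < b) W Z (level e n) k i j w).

Let mnorm e n a b i j y : measurable [set w : T | y <= `|S e n a b i j w|].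
Proof.
rewrite -[X in measurable X]setTI; apply: measurable_fun_le => //.
apply: measurableT_comp => //; exact: (measurable_sumW H).
Qed.

(** The (M n)^2 pairs, each with tail of order n^(-(2 + y)^2 / 2), contribute O(n^(-2y)), which is
    geometric in l at n = c 2^l. *)
Lemma block_upper (M c : nat) (y e : R) : (0 < c)%N -> 0 < y -> 0 < e ->
  (2 + y) * e <= 4^-1 ->
  {ae P, forall w, \forall l \near \oo, forall i j,
    (i < M * (c * 2 ^ l))%N -> (j < M * (c * 2 ^ l))%N -> i != j ->
    `|S e (c * 2 ^ l)%N 0 (c * 2 ^ l)%N i j w| <= (2 + y) * scale R (c * 2 ^ l)}.
Proof.
move=> c0 y0 e0 ye.
pose G n i j := [set w | (2 + y) * scale R n <= `|S e n 0%N n i j w|].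
pose F l := some_pair (M * (c * 2 ^ l)) (G (c * 2 ^ l)%N).
have mF l : measurable (F l).
  by have [] := @some_pair_bound _ _ R P (M * (c * 2 ^ l)) (G (c * 2 ^ l)%N) 1 ler01
    (fun i j _ => mnorm _ _ _ _ _ _ _) (fun i j _ => probability_le1 P (mnorm _ _ _ _ _ _ _)).
have y20 : 0 <= 2 + y by rewrite addr_ge0// ltW.
have bF : \forall l \near \oo, (P (F l) <=
    (2 * M%:R ^+ 2 * expR 1 * expR (- (2 * y * ln (c * 2 ^ l)%:R)))%:E)%E.
  apply: (@near_mul_exp2 c (fun n => (P (some_pair (M * n) (G n)) <=
    (2 * M%:R ^+ 2 * expR 1 * expR (- (2 * y * ln n%:R)))%:E)%E)) => //.
  have tail := sum_W_tail H y20 e0 ye.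
  near=> n.
  have s1 : 1 <= ln (n%:R : R) by near: n; exact: near_ln_ge.
  have s0 : 0 < ln (n%:R : R) by exact: lt_le_trans s1.
  have hn := near tail n.
  pose b : R := 2 * expR (1 + 1 * ((2 + y) ^+ 2 / 2) * ln n%:R - (2 + y) * (2 + y) * ln n%:R).
  have b0 : 0 <= b by rewrite mulr_ge0// expR_ge0.
  have Gb i j : i != j -> (P (G n i j) <= b%:E)%E.
    move=> ij; apply: hn => //; rewrite ?iota_uniq ?size_iota ?subn0//.
    by rewrite mul1r.
  have [_ h] := some_pair_bound (M * n) b0 (fun i j _ => mnorm _ _ _ _ _ _ _) Gb.
  apply: (le_trans h); rewrite lee_fin natrM.
  rewrite (_ : _ * b = 2 * M%:R ^+ 2 * (n%:R ^+ 2 *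
    expR (1 + 1 * ((2 + y) ^+ 2 / 2) * ln n%:R - (2 + y) * (2 + y) * ln n%:R))); last first.
    by rewrite /b; ring.
  have -> : n%:R ^+ 2 = expR (2 * ln n%:R) :> R by rewrite expRM_natl -nat_expR.
  rewrite -expRD -[leRHS]mulrA -expRD ler_wpM2l ?mulr_ge0 ?exprn_ge0// ler_expR.
  have : 0 <= y ^+ 2 * ln (n%:R : R) by rewrite mulr_ge0 ?sqr_ge0// ltW.
  lra.
have y2 : 0 < 2 * y by rewrite mulr_gt0.
have := borel_cantelli_geometric c0 y2 mF bF; apply: filterS => w; apply: filterS => l Fl i j im jm ij.
rewrite leNgt; apply/negP => /ltW h; apply: Fl.
by exists i, j.
Unshelve. all: by end_near. Qed.

(** The tilt t = 5 / y makes t y = 5, and c >= t^2 keeps the variance term below 1/2, so one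
    increment has tail O(n^(-9/2)). This beats the n^2 pairs and at most 2 n values of r by a plain
    union bound, without a maximal inequality. *)
Lemma block_increment (M c : nat) (y e : R) : 0 < y -> 0 < e -> (5 / y) ^+ 2 <= c%:R ->
  5 / y * e <= 4^-1 ->
  {ae P, forall w, \forall l \near \oo, forall r i j, (r <= 2 ^ l)%N ->
    (i < M * (c * 2 ^ l))%N -> (j < M * (c * 2 ^ l))%N -> i != j ->
    `|S e (c * 2 ^ l)%N (c * 2 ^ l)%N (c * 2 ^ l + r)%N i j w| <= y * scale R (c * 2 ^ l)}.
Proof.
move=> y0 e0 yc ye.
set t := 5 / y in yc ye.
have t0 : 0 < t by rewrite divr_gt0.
have c0 : (0 < c)%N.
  by rewrite -(ltr0n R); apply: lt_le_trans yc; rewrite exprn_gt0.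
pose B l r i j := [set w | y * scale R (c * 2 ^ l) <=
  `|S e (c * 2 ^ l)%N (c * 2 ^ l)%N (c * 2 ^ l + r)%N i j w|].
pose G l i j := \big[setU/set0]_(r <- iota 0 (2 ^ l).+1) B l r i j.
have mG l i j : measurable (G l i j).
  by apply: bigsetU_measurable => r _; exact: mnorm.
pose F l := some_pair (M * (c * 2 ^ l)) (G l).
have mF l : measurable (F l).
  by have [] := @some_pair_bound _ _ R P (M * (c * 2 ^ l)) (G l) 1 ler01
    (fun i j _ => mG _ _ _) (fun i j _ => probability_le1 P (mG _ _ _)).
have bF : \forall l \near \oo, (P (F l) <=
    (4 * M%:R ^+ 2 * expR 1 * expR (- (1 * ln (c * 2 ^ l)%:R)))%:E)%E.
  have tail := near_mul_exp2 c0 (sum_W_tail H (ltW t0) e0 ye).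
  have lbig := near_mul_exp2 c0 (near_ln_ge (1 : R)).
  near=> l.
  have s1 : 1 <= ln ((c * 2 ^ l)%:R : R) by near: l.
  have hn := near tail l.
  have s0 : 0 < ln ((c * 2 ^ l)%:R : R) by exact: lt_le_trans s1.
  set n := (c * 2 ^ l)%N in s1 s0 hn *.
  have ln2 : (2 ^ l <= n)%N by rewrite leq_pmull.
  pose b : R := 2 * expR (1 + c%:R^-1 * (t ^+ 2 / 2) * ln n%:R - t * y * ln n%:R).
  have b0 : 0 <= b by rewrite mulr_ge0// expR_ge0.
  have Gb i j : i != j -> (P (G l i j) <= ((2 ^ l).+1%:R * b)%:E)%E.
    move=> ij; rewrite -[X in X%:R * b](size_iota 0).
    apply: union_bound => r; first by move=> _; exact: mnorm.
    rewrite mem_iota add0n ltnS /= => rl.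
    have sz : size (index_iota n (n + r)) = r by rewrite size_iota addKn.
    apply: hn; rewrite ?sz ?iota_uniq//; first exact: leq_trans ln2.
    rewrite /n natrM mulrA mulVf ?mul1r ?pnatr_eq0 -?lt0n// ler_nat//.
  have Gb0 : 0 <= (2 ^ l).+1%:R * b by rewrite mulr_ge0.
  have [_ h] := some_pair_bound (M * n) Gb0 (fun i j _ => mG _ _ _) Gb.
  apply: (le_trans h); rewrite lee_fin natrM.
  have l2n : (2 ^ l).+1%:R <= 2 * n%:R :> R.
    rewrite -natrM ler_nat mul2n -addnn -addn1 leq_add//.
    by rewrite /n muln_gt0 c0 expn_gt0.
  apply: (@le_trans _ _ (M%:R * n%:R * (M%:R * n%:R) * (2 * n%:R * b))).
    by rewrite ler_wpM2l ?mulr_ge0// ler_wpM2r.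
  rewrite (_ : _ * _ * (2 * n%:R * b) = 4 * M%:R ^+ 2 * (n%:R ^+ 3 *
    expR (1 + c%:R^-1 * (t ^+ 2 / 2) * ln n%:R - t * y * ln n%:R))); last first.
    by rewrite /b; ring.
  have -> : n%:R ^+ 3 = expR (3 * ln n%:R) :> R by rewrite expRM_natl -nat_expR.
  rewrite -expRD -[leRHS]mulrA -expRD ler_wpM2l ?mulr_ge0 ?exprn_ge0// ler_expR.
  have ty : t * y = 5 by rewrite /t divfK// gt_eqF.
  have ct : c%:R^-1 * (t ^+ 2 / 2) <= 2^-1.
    rewrite ler_pdivrMl ?ltr0n//; move: yc; rewrite -/t; lra.
  have := ler_wpM2r (ltW s0) ct.
  rewrite ty; lra.
have := borel_cantelli_geometric c0 ltr01 mF bF; apply: filterS => w; apply: filterS => l Fl r i j rl im jm ij.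
rewrite leNgt; apply/negP => /ltW h; apply: Fl.
have rin : r \in iota 0 (2 ^ l).+1 by rewrite mem_iota add0n ltnS.
by exists i, j; split => //; rewrite /G -bigcup_seq; exists r.
Unshelve. all: by end_near. Qed.

End block_events.

(** * Lower bound along blocks *)

Section block_lower_bound.
Context d (T : measurableType d) (R : realType) (P : probability T R).
Variables (Z : nat -> nat -> T -> R) (C : R).
Hypothesis H : std_array P Z C.
Local Notation level e n := (e * scale R n).
Local Notation S e n a b := (fun i j w => \sum_(a <= k < b) W Z (level e n) k i j w).
Local Notation Y := (fun ki : nat * nat => Z ki.1 ki.2).
Let mY (ki : nat * nat) : measurable_fun setT (Y ki) := std_meas H ki.1 ki.2.

Lemma sub_measurable_sumW b i j (s : seq nat) :
  sub_measurable Y [set ki | ki.2 = i \/ ki.2 = j] (fun w => \sum_(k <- s) W Z b k i j w).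
Proof.
by apply: measurable_sum => k; apply: sub_measurable_W; [left|right].
Qed.

Lemma indep_sumW b i j i' j' (s : seq nat) (y : R) : i != i' -> i != j' ->
  j != i' -> j != j' ->
  P ([set w | y <= \sum_(k <- s) W Z b k i j w] `&`
     [set w | y <= \sum_(k <- s) W Z b k i' j' w]) =
  (P [set w | (y <= \sum_(k <- s) W Z b k i j w)%R] *
   P [set w | (y <= \sum_(k <- s) W Z b k i' j' w)%R])%E.
Proof.
move=> /eqP ii' /eqP ij' /eqP ji' /eqP jj'.
have mI : measurable [set z : R | y <= z].
  by rewrite -[X in measurable X]setTI; apply: measurable_fun_le.
apply: (sub_measurable_indep mY (std_indep H) _ (@sub_measurable_sumW b i j s)
  (@sub_measurable_sumW b i' j' s) mI mI).
apply/seteqP; split => // -[a c] /= [] [->|->] [].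
- exact: ii'.
- exact: ij'.
- exact: ji'.
- exact: jj'.
Qed.

(** The condition on E keeps the large pair among the first n / E columns, where it will count
    towards the maximum over p n columns. *)
Lemma block_lower (E c : nat) (y e : R) : (0 < c)%N -> (0 < E)%N -> 0 < y ->
  y <= 2^-1 -> 0 < e -> e <= 16^-1 ->
  {ae P, forall w, \forall l \near \oo, exists i j,
    [/\ (i < j)%N, (E * j.+1 <= c * 2 ^ l)%N &
    (2 - y) * scale R (c * 2 ^ l) <= S e (c * 2 ^ l)%N 0 (c * 2 ^ l)%N i j w]}.
Proof.
move=> c0 E0 y0 y1 e0 e1.
(* Small enough that, with x = 2 - y, the tilting loss 4 g x + 3 g^2 leaves both exponents of the
   second-moment ratio, -2 - x^2 / 2 + (x + g)(x + 3g) and -1 - x^2 + (x + g)(x + 3g), at most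
   -y. *)
pose g : R := y / 22.
have g0 : 0 < g by rewrite divr_gt0.
pose x : R := 2 - y.
have x0 : 0 <= x by rewrite /x; lra.
have xe : x * e <= 4^-1.
  apply: (@le_trans _ _ (2 * 16^-1)); last by lra.
  by rewrite ler_pM// ?(ltW e0)// /x; lra.
have x2e : 2 * x * e <= 4^-1.
  apply: (@le_trans _ _ (4 * 16^-1)); last by lra.
  by rewrite ler_pM// ?(ltW e0) ?mulr_ge0// /x; lra.
have xge : (x + 2 * g) * e <= 4^-1.
  apply: (@le_trans _ _ (4 * 16^-1)); last by lra.
  by rewrite ler_pM// ?(ltW e0)// /x /g; lra.
(* Columns i < h are paired with columns h + j, j < h. Such a pair is never diagonal, two of them
   share a column only if i = i' or j = j', and all columns stay below n / E. *)
pose h n := (n %/ (2 * E))%N.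
pose D n (i j : 'I_(h n)) := [set w | x * scale R n <= S e n 0%N n i (h n + j)%N w].
have mD n (i j : 'I_(h n)) : measurable (D n i j).
  rewrite -[X in measurable X]setTI; apply: measurable_fun_le => //.
  exact: (measurable_sumW H).
pose F l := [set w | forall i j, ~ D (c * 2 ^ l)%N i j w].
have mF l : measurable (F l) by apply: measurable_none => i j; exact: mD.
pose K : R := (16 * E%:R ^+ 2 + 8 * E%:R) * expR 7.
have bF : \forall l \near \oo,
    (P (F l) <= (K * expR (- (y * ln (c * 2 ^ l)%:R)))%:E)%E.
  apply: (@near_mul_exp2 c (fun n => (P [set w | forall i j, ~ D n i j w] <=
    (K * expR (- (y * ln n%:R)))%:E)%E)) => //.
  have up := sum_W_upper H x0 e0 xe.
  have jo := sum_W_joint H x0 e0 x2e.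
  have lo := sum_W_lower H x0 g0 e0 xge.
  apply: filterS2 (filterI (near_ln_ge (1 : R)) (nbhs_infty_ge (2 * E)))
    (filterI up (filterI jo lo)) => n [s1 nE] [up' [jo' lo']].
  have s0 : 0 < ln (n%:R : R) by exact: lt_le_trans s1.
  have h0 : (0 < h n)%N by rewrite divn_gt0 ?muln_gt0.
  have hE : n%:R <= 4 * E%:R * (h n)%:R :> R.
    rewrite -!natrM ler_nat {1}(divn_eq n (2 * E)) -/(h n).
    apply: (@leq_trans (h n * (2 * E) + 2 * E)).
      by rewrite leq_add2l ltnW// ltn_pmod// muln_gt0.
    apply: (@leq_trans (h n * (2 * E) + h n * (2 * E))); first by rewrite leq_add2l leq_pmull.
    by rewrite addnn -mul2n [(h n * _)%N]mulnC !mulnA.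
  set s : R := ln n%:R in s1 s0 *.
  pose a1 := expR (1 - x ^+ 2 / 2 * s).
  pose a2 := expR (1 - x ^+ 2 * s).
  pose q := expR (- 3 - (x + g) * (x + 3 * g) / 2 * s).
  have neq (i j : 'I_(h n)) : (i : nat) != (h n + j)%N.
    by rewrite neq_ltn (leq_trans (ltn_ord i))// leq_addr.
  have hj (j j' : 'I_(h n)) : j != j' -> (h n + j != h n + j')%N by rewrite eqn_add2l.
  have := @second_moment _ _ _ P (h n) (D n) a1 a2 q h0 (expR_gt0 _) (expR_ge0 _) (mD n).
  move=> /(_ (fun i j => lo' _ _ (neq i j)) (fun i j => up' _ _ (neq i j))).
  have r1 (i j j' : 'I_(h n)) : j != j' -> (P (D n i j `&` D n i j') <= a2%:E)%E.
    by move=> jj'; exact: (jo' _ _ _ (neq i j) (neq i j') (hj _ _ jj')).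
  have r2 (i i' j : 'I_(h n)) : i != i' -> (P (D n i j `&` D n i' j) <= a2%:E)%E.
    move=> ii'; have := jo' (h n + j)%N i i'; rewrite eq_sym (neq i j) eq_sym (neq i' j).
    move=> /(_ isT isT ii'); congr (P _ <= _)%E.
    have sym i0 j0 w : S e n 0%N n i0 j0 w = S e n 0%N n j0 i0 w.
      by apply: eq_bigr => k _; rewrite /W [Z k i0 w * _]mulrC.
    by apply/seteqP; split => w /=; rewrite /D /= (sym i) (sym i').
  have r3 (i j i' j' : 'I_(h n)) : i != i' -> j != j' ->
      P (D n i j `&` D n i' j') = (P (D n i j) * P (D n i' j'))%E.
    move=> ii' jj'; by apply: indep_sumW; [exact: ii'|exact: neq|rewrite eq_sym; exact: neq|exact: hj].
  move=> /(_ r1 r2 r3) hb; apply: (le_trans hb); rewrite lee_fin.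
  have hp : 0 < (h n)%:R :> R by rewrite ltr0n.
  have nexp : n%:R = expR s by exact: nat_expR.
  have hinv : (h n)%:R^-1 <= 4 * E%:R * expR (- s) :> R.
    rewrite expRN -nexp ler_pdivlMr; last by rewrite nexp expR_gt0.
    by rewrite ler_pdivrMl// mulrC.
  have qq : (q ^+ 2)^-1 = expR (6 + (x + g) * (x + 3 * g) * s).
    by rewrite /q -expRM_natl -expRN; congr expR; field.
  have E2 : (a1 + 2 * (h n)%:R * a2) / ((h n)%:R ^+ 2 * q ^+ 2) =
     (h n)%:R^-1 ^+ 2 * (a1 * (q ^+ 2)^-1) + 2 * (h n)%:R^-1 * (a2 * (q ^+ 2)^-1).
    by field; rewrite !gt_eqF// expR_gt0.
  rewrite E2 qq /a1 /a2 -!expRD.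
  have y2 : y ^+ 2 <= y / 2 by rewrite expr2 ler_wpM2l// ltW.
  have yy : 0 <= y ^+ 2 by exact: sqr_ge0.
  have Ep : 0 <= E%:R :> R by [].
  have t1 : (h n)%:R^-1 ^+ 2 * expR (1 - x ^+ 2 / 2 * s + (6 + (x + g) * (x + 3 * g) * s)) <=
      16 * E%:R ^+ 2 * (expR 7 * expR (- (y * s))).
    apply: (@le_trans _ _ ((4 * E%:R * expR (- s)) ^+ 2 *
        expR (1 - x ^+ 2 / 2 * s + (6 + (x + g) * (x + 3 * g) * s)))).
      by rewrite ler_wpM2r ?expR_ge0// lerXn2r// nnegrE ?invr_ge0// !mulr_ge0 ?expR_ge0.
    rewrite (_ : _ ^+ 2 * _ = 16 * E%:R ^+ 2 * (expR (- s) ^+ 2 *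
      expR (1 - x ^+ 2 / 2 * s + (6 + (x + g) * (x + 3 * g) * s)))); last by ring.
    rewrite -expRM_natl -!expRD ler_wpM2l ?mulr_ge0 ?exprn_ge0// ler_expR.
    have k1 : 2 * - 1 - x ^+ 2 / 2 + (x + g) * (x + 3 * g) <= - y.
      by rewrite /x /g; lra.
    have := ler_wpM2r (ltW s0) k1; lra.
  have t2 : 2 * (h n)%:R^-1 * expR (1 - x ^+ 2 * s + (6 + (x + g) * (x + 3 * g) * s)) <=
      8 * E%:R * (expR 7 * expR (- (y * s))).
    apply: (@le_trans _ _ (2 * (4 * E%:R * expR (- s)) *
        expR (1 - x ^+ 2 * s + (6 + (x + g) * (x + 3 * g) * s)))).
      by rewrite ler_wpM2r ?expR_ge0// ler_wpM2l.
    rewrite (_ : 2 * (4 * E%:R * expR (- s)) = 8 * E%:R * expR (- s)); last by ring.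
    rewrite -mulrA -!expRD ler_wpM2l ?mulr_ge0// ler_expR.
    have k1 : - 1 - x ^+ 2 + (x + g) * (x + 3 * g) <= - y.
      by rewrite /x /g; lra.
    have := ler_wpM2r (ltW s0) k1; lra.
  apply: (le_trans (lerD t1 t2)); rewrite /K; lra.
have := borel_cantelli_geometric c0 y0 mF bF; apply: filterS => w; apply: filterS => l Fl.
set n := (c * 2 ^ l)%N in Fl *.
have [i [j Dij]] : exists i j, D n i j w.
  apply: contrapT => hn; apply: Fl => i j Dij; apply: hn; by exists i, j.
exists i, (h n + j)%N; split => //.
  by rewrite (leq_trans (ltn_ord i))// leq_addr.
apply: (@leq_trans (E * (h n + h n))).
  by rewrite leq_mul2l -addnS leq_add2l ltn_ord orbT.
by rewrite addnn -mul2n mulnA [(E * 2)%N]mulnC mulnC leq_trunc_div.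
Qed.

End block_lower_bound.

(** * From block end points to all n *)

Section inner_products.
Context d (T : measurableType d) (R : realType) (P : probability T R).
Variables (Z : nat -> nat -> T -> R) (C : R).
Hypothesis H : std_array P Z C.

(** The rows also range up to M n, so that the bound at the left end of a block applies to the later
    rows of that block. *)
Definition small_products : Prop := forall (M : nat) (e : R), 0 < e ->
  {ae P, forall w, \forall n \near \oo, forall k i j, (k < M * n)%N ->
     (i < M * n)%N -> (j < M * n)%N -> i != j ->
     `|Z k i w * Z k j w| <= e * scale R n}.

Lemma scale_mono m n : (1 <= m)%N -> (m <= n)%N -> scale R m <= scale R n.
Proof.
move=> m1 mn; have n1 := leq_trans m1 mn.
apply: ler_wsqrtr; rewrite ler_pM ?ler_nat// ?ln_ge0 ?ler1n//.
by rewrite ler_ln ?posrE ?ltr0n// ler_nat.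
Qed.

(** Inside a block both n and ln n grow by a factor of at most 1 + 1 / c, and the scale is the
    square root of their product. *)
Lemma scale_window c l n : (0 < c)%N -> 1 <= ln ((c * 2 ^ l)%:R : R) ->
  (c * 2 ^ l <= n <= c * 2 ^ l + 2 ^ l)%N ->
  scale R n <= (1 + c%:R^-1) * scale R (c * 2 ^ l).
Proof.
move=> c0 ln1 /andP[n1 n2]; set m := (c * 2 ^ l)%N in ln1 n1 n2 *.
have m0 : (0 < m)%N by rewrite muln_gt0 c0 expn_gt0.
have n0 : (0 < n)%N by exact: leq_trans n1.
have ci : 0 < c%:R^-1 :> R by rewrite invr_gt0 ltr0n.
have nm : n%:R <= (1 + c%:R^-1) * m%:R :> R.
  apply: (@le_trans _ _ (m + 2 ^ l)%:R); first by rewrite ler_nat.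
  by rewrite natrD mulrDl mul1r /m natrM mulKf// pnatr_eq0 -lt0n.
have lnm : ln n%:R <= (1 + c%:R^-1) * ln (m%:R : R).
  apply: (@le_trans _ _ (ln ((1 + c%:R^-1) * m%:R))).
    by rewrite ler_ln ?posrE ?mulr_gt0 ?ltr0n// addr_gt0.
  rewrite lnM ?posrE ?ltr0n// ?addr_gt0// mulrDl mul1r addrC lerD2l.
  apply: (@le_trans _ _ (c%:R^-1 : R)); first by apply: le_ln1Dx; lra.
  by rewrite ler_peMr// ltW.
rewrite -(@ger0_norm _ (1 + c%:R^-1)) ?addr_ge0 ?(ltW ci)//.
rewrite -sqrtr_sqr /scale -sqrtrM ?sqr_ge0//.
apply: ler_wsqrtr.
rewrite (_ : _ ^+ 2 * _ = ((1 + c%:R^-1) * m%:R) * ((1 + c%:R^-1) * ln m%:R)); last by ring.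
by rewrite ler_pM// ln_ge0// ler1n.
Qed.

Lemma inner_products_bounds (M E : nat) (y : R) : small_products -> (0 < E)%N ->
  0 < y -> y <= 2^-1 ->
  {ae P, forall w, \forall n \near \oo,
    (forall i j, (i < M * n)%N -> (j < M * n)%N -> i != j ->
       `|\sum_(0 <= k < n) Z k i w * Z k j w| <= (2 + 2 * y) * scale R n) /\
    (exists i j, [/\ (i < j)%N, (E * j.+1 <= n)%N &
       (2 - 4 * y) * scale R n <= \sum_(0 <= k < n) Z k i w * Z k j w])}.
Proof.
move=> sp E0 y0 y1.
(* Chosen with (4 + 5 / y) e = 1/4, which meets the conditions of all three block lemmas at once. *)
pose e : R := (4 * (4 + 5 / y))^-1.
have y5 : 0 < 5 / y by rewrite divr_gt0.
have e0 : 0 < e by rewrite invr_gt0 mulr_gt0// addr_gt0.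
have e4 : (4 + 5 / y) * e = 4^-1.
  by rewrite /e; field; rewrite !gt_eqF//; lra.
have ey : 0 <= 5 / y * e by rewrite mulr_ge0// ltW.
have e16 : e <= 16^-1 by lra.
have e1 : (2 + y) * e <= 4^-1.
  have : (2 + y) * e <= 4 * e by rewrite ler_wpM2r ?(ltW e0)//; lra.
  lra.
have e2 : 5 / y * e <= 4^-1 by lra.
have [s hs] : exists s, (5 / y) ^+ 2 <= (2 ^ s)%:R :> R.
  have [s _ hs] := nbhs_infty_ger ((5 / y) ^+ 2).
  exists s; apply: (le_trans (hs s (leqnn s))).
  by rewrite ler_nat ltnW// ltn_expl.
have cP c : (2 ^ s <= c)%N -> (0 < c)%N by apply: leq_trans; rewrite expn_gt0.
(* In a block n <= 2 m, so columns below M n lie below 2 M m; the extra 2 accommodates the rows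
   below 2 m. *)
pose M' := (2 * M + 2)%N.
pose good c w := (2 ^ s <= c)%N -> \forall l \near \oo,
  [/\ forall i j, (i < M' * (c * 2 ^ l))%N -> (j < M' * (c * 2 ^ l))%N -> i != j ->
    `|\sum_(0 <= k < c * 2 ^ l) W Z (e * scale R (c * 2 ^ l)) k i j w|
      <= (2 + y) * scale R (c * 2 ^ l),
   forall r i j, (r <= 2 ^ l)%N ->
    (i < M' * (c * 2 ^ l))%N -> (j < M' * (c * 2 ^ l))%N -> i != j ->
    `|\sum_(c * 2 ^ l <= k < c * 2 ^ l + r) W Z (e * scale R (c * 2 ^ l)) k i j w|
      <= y * scale R (c * 2 ^ l) &
   exists i j,
    [/\ (i < j)%N, (E * j.+1 <= c * 2 ^ l)%N &
    (2 - y) * scale R (c * 2 ^ l) <=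
      \sum_(0 <= k < c * 2 ^ l) W Z (e * scale R (c * 2 ^ l)) k i j w]].
have hgood : {ae P, forall w, forall c, good c w}.
  apply: ae_foralln => c; have [c1|c1] := leqP (2 ^ s) c; last first.
    by apply: aeW => w; rewrite /good leqNgt c1.
  have c2 : (5 / y) ^+ 2 <= c%:R by apply: (le_trans hs); rewrite ler_nat.
  have b1 := block_upper H M' (cP c c1) y0 e0 e1.
  have b2 := block_increment H M' y0 e0 c2 e2.
  have b3 := block_lower H (cP c c1) E0 y0 y1 e0 e16.
  apply: filterS3 b1 b2 b3 => w h1 h2 h3 _.
  by apply: filterS3 h1 h2 h3 => l h1 h2 h3; split.
apply: filterS2 hgood (sp M' e e0) => w hw hsp.
apply: (@near_blocks s) => c c1; have c0 := cP c c1.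
apply: filterS3 (hw c c1) (near_mul_exp2 c0 hsp)
  (near_mul_exp2 c0 (near_ln_ge (1 : R))) => l [h1 h2 h3] {}hsp ln1 n nwin.
have win := scale_window c0 ln1 nwin.
have /andP[n1 n2] := nwin.
set m := (c * 2 ^ l)%N in h1 h2 h3 hsp ln1 n1 n2 nwin win *.
have m0 : (0 < m)%N by rewrite muln_gt0 c0 expn_gt0.
have l2m : (2 ^ l <= m)%N by rewrite leq_pmull.
have nm : (n <= 2 * m)%N by rewrite mul2n -addnn (leq_trans n2)// leq_add2l.
have mono : scale R m <= scale R n by exact: scale_mono.
have sm0 : 0 <= scale R m by exact: sqrtr_ge0.
have WZ k i j : (k < n)%N -> (i < M' * m)%N -> (j < M' * m)%N -> i != j ->
    W Z (e * scale R m) k i j w = Z k i w * Z k j w.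
  move=> kn im jm ij; rewrite /W /trunc hsp//.
  apply: (leq_trans kn); apply: (leq_trans nm).
  by rewrite leq_mul2r leq_addl orbT.
(* The whole sum up to n is truncated at the level of the left end m, where the products are already
   small, and is split there. *)
have SE i j : (i < M' * m)%N -> (j < M' * m)%N -> i != j ->
    \sum_(0 <= k < n) Z k i w * Z k j w =
    \sum_(0 <= k < m) W Z (e * scale R m) k i j w +
    \sum_(m <= k < m + (n - m)) W Z (e * scale R m) k i j w.
  move=> im jm ij; rewrite subnKC// -big_cat_nat//=.
  by rewrite !big_nat; apply: eq_bigr => k /= kn; rewrite WZ.
have nml : (n - m <= 2 ^ l)%N by rewrite leq_subLR.
have Mn i : (i < M * n)%N -> (i < M' * m)%N.
  move=> /leq_trans; apply; apply: (@leq_trans (M * (2 * m))).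
    by rewrite leq_mul2l nm orbT.
  by rewrite mulnA /M' leq_mul2r [(M * 2)%N]mulnC leq_addr orbT.
split.
  move=> i j /Mn im /Mn jm ij; rewrite SE//.
  apply: (le_trans (ler_normD _ _)).
  apply: (le_trans (lerD (h1 i j im jm ij) (h2 _ i j nml im jm ij))).
  rewrite -mulrDl.
  by apply: ler_pM => //; lra.
have [i [j [ij Ej hij]]] := h3.
have jm : (j < M' * m)%N.
  apply: (@leq_trans m).
    by apply: leq_trans Ej; rewrite leq_pmull.
  by rewrite leq_pmull// /M' addn2.
have im : (i < M' * m)%N by exact: ltn_trans jm.
have nij : i != j by rewrite neq_ltn ij.
exists i, j; split => //; first exact: leq_trans Ej n1.
rewrite SE//.
have /ler_normlP[h2' _] := h2 _ i j nml im jm nij.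
(* The passage from the scale of m to that of n costs 1 + 1 / c <= 1 + y, and (2 - 4 y)(1 + y) <= 2
   - 2 y. *)
have cy : c%:R^-1 <= y.
  rewrite invf_ple ?posrE ?ltr0n//.
  apply: (@le_trans _ _ ((5 / y) ^+ 2)); last by apply: (le_trans hs); rewrite ler_nat.
  rewrite expr_div_n ler_pdivlMr ?exprn_gt0// expr2 mulKf ?gt_eqF//; lra.
have y4 : 0 <= 2 - 4 * y by lra.
have := ler_wpM2l y4 win.
have k1 : (2 - 4 * y) * (1 + c%:R^-1) <= 2 - 2 * y.
  have := ler_wpM2l y4 cy; have := sqr_ge0 y; rewrite expr2; lra.
have := ler_wpM2r sm0 k1; lra.
Qed.

End inner_products.

(** * Column sums *)

Section column_sums.
Context d (T : measurableType d) (R : realType) (P : probability T R).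

(** For n >= 1, n^-2 is at most 6 / ((n + 1)(n + 2)), which telescopes; 6 is the value needed at n =
    1. *)
Lemma borel_cantelli_square (F : nat -> set T) : (forall n, measurable (F n)) ->
  (\forall n \near \oo, (P (F n) <= (n%:R ^- 2)%:E)%E) ->
  {ae P, forall w, \forall n \near \oo, ~ F n w}.
Proof.
move=> mF [N _ hN].
pose G n := if (maxn N 1 <= n)%N then F n else set0.
have mG n : measurable (G n) by rewrite /G; case: ifP.
pose v n : R := 6 / n.+1%:R.
have Gv n : (P (G n) <= (v n - v n.+1)%:E)%E.
  have vE : v n - v n.+1 = 6 / (n.+1%:R * n.+2%:R).
    have a0 : 0 < n.+1%:R :> R by rewrite ltr0n.
    rewrite /v -[n.+2%:R]natr1; set a := n.+1%:R in a0 *.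
    by field; rewrite !gt_eqF// addr_gt0.
  rewrite /G; case: ifP => [|_]; last by rewrite measure0 lee_fin vE divr_ge0// mulr_ge0.
  rewrite geq_max => /andP[Nn n1]; apply: (le_trans (hN n Nn)).
  have n0 : 0 < n%:R :> R by rewrite ltr0n.
  rewrite lee_fin vE -div1r ler_pdivrMr ?exprn_gt0// mulrAC ler_pdivlMr ?mulr_gt0//.
  have : 1 <= n%:R :> R by rewrite ler1n.
  rewrite -!natr1 => n1'; have : 0 <= (n%:R - 1) * (n%:R : R) by rewrite mulr_ge0 ?subr_ge0.
  rewrite expr2; lra.
have : {ae P, forall w, \forall l \near \oo, ~ G l w}.
  apply: borel_cantelli => //.
  apply: (@le_lt_trans _ _ 6%:E); last by rewrite ltry.
  apply: nneseries_le => // n.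
  apply: (@le_trans _ _ (\sum_(0 <= l < n) (v l - v l.+1)%:E)%E).
    by apply: lee_sum => l _.
  rewrite sumEFin lee_fin.
  have -> : \sum_(0 <= l < n) (v l - v l.+1) = v 0%N - v n.
    elim: n => [|n IH]; first by rewrite big_geq// subrr.
    by rewrite big_nat_recr//= IH; ring.
  by rewrite /v divr1 gerBl divr_ge0.
apply: filterS => w [N' _ h]; exists (maxn (maxn N 1) N') => // l /=.
rewrite geq_max => /andP[Nl N'l] Fl; apply: (h l N'l).
by rewrite /G Nl.
Qed.

Variables (Z : nat -> nat -> T -> R) (C : R).
Hypothesis H : std_array P Z C.
Local Notation Y := (fun ki : nat * nat => Z ki.1 ki.2).
Let mY (ki : nat * nat) : measurable_fun setT (Y ki) := std_meas H ki.1 ki.2.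

(** At tilt 1 / b the exponent is bounded by 1, so second moments control the moment generating
    function. The sign v serves the two tails. *)
Lemma expR_trunc_le b (u v : R) : 0 < b -> v = 1 \/ v = - 1 ->
  expR (b^-1 * (v * trunc b u)) <= 1 + v / b * u + (1 + expR 1) / b ^+ 2 * u ^+ 2.
Proof.
move=> b0 vE; set t := trunc b u; set x := b^-1 * (v * t).
have v1 : `|v| = 1 by case: vE => ->; rewrite ?normrN normr1.
have x1 : `|x| <= 1.
  rewrite !normrM v1 mul1r normfV (gtr0_norm b0) ler_pdivrMl// mulr1.
  exact/norm_trunc_le/ltW.
have x2 : x ^+ 2 <= u ^+ 2 / b ^+ 2.
  rewrite /x !exprMn exprVn -[v ^+ 2]real_normK ?num_real// v1 expr1n mul1r mulrC.
  rewrite ler_wpM2r ?invr_ge0 ?sqr_ge0// /t /trunc.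
  by case: ifP => // _; rewrite expr0n sqr_ge0.
have xu : x <= v / b * u + u ^+ 2 / b ^+ 2.
  have u2 : 0 <= u ^+ 2 / b ^+ 2 by rewrite divr_ge0// sqr_ge0.
  rewrite /x /t /trunc; case: ifPn => [_|].
    by rewrite (_ : b^-1 * (v * u) = v / b * u) ?lerDl//; ring.
  rewrite -ltNge !mulr0 => bu.
  have : `|v / b * u| <= u ^+ 2 / b ^+ 2.
    rewrite normrM normrM v1 mul1r normfV (gtr0_norm b0) ler_pdivlMr ?exprn_gt0//.
    rewrite (_ : b^-1 * `|u| * b ^+ 2 = b * `|u|); last by field; rewrite gt_eqF.
    by rewrite -[u ^+ 2]real_normK ?num_real// [leRHS]expr2 ler_wpM2r// ltW.
  by move=> /ler_normlP[]; lra.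
apply: (le_trans (expR_taylor1 x)).
have : x ^+ 2 * expR `|x| <= u ^+ 2 / b ^+ 2 * expR 1.
  by rewrite ler_pM ?sqr_ge0 ?expR_ge0// ler_expR.
rewrite (_ : (1 + expR 1) / b ^+ 2 * u ^+ 2 =
  u ^+ 2 / b ^+ 2 + u ^+ 2 / b ^+ 2 * expR 1); last by ring.
lra.
Qed.

Section centered_columns.
Variables (V : nat -> nat -> T -> R) (C' : R).
Hypothesis mV : forall k i, sub_measurable Y (row k) (V k i).
Hypothesis iV : forall k i, integ P (V k i).
Hypothesis iV2 : forall k i, integ P (fun w => V k i w ^+ 2).
Hypothesis EV : forall k i, \int[P]_w V k i w = 0.
Hypothesis EV2 : forall k i, \int[P]_w (V k i w ^+ 2) <= C'.

Let K : R := (1 + expR 1) * C'.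

Let mtV b k i : sub_measurable Y (row k) (fun w => trunc b (V k i w)).
Proof. by apply: measurableT_comp; [exact: measurable_trunc|exact: mV]. Qed.

Lemma column_tail b (y : R) n i : 0 < b ->
  (P [set w | (y <= `|\sum_(0 <= k < n) trunc b (V k i w)|)%R] <=
    (2 * expR (n%:R * (K / b ^+ 2) - b^-1 * y))%:E)%E.
Proof.
move=> b0.
have side v : v = 1 \/ v = - 1 ->
    (P [set w | (y <= \sum_(0 <= k < n) v * trunc b (V k i w))%R] <=
    (expR (n%:R * (K / b ^+ 2) - b^-1 * y))%:E)%E.
  move=> vE.
  have v1 : `|v| = 1 by case: vE => ->; rewrite ?normrN normr1.
  have mW k : sub_measurable Y (row k) (fun w => v * trunc b (V k i w)).
    by apply: measurable_funM => //; exact: mtV.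
  have bW k w : `|v * trunc b (V k i w)| <= b.
    by rewrite normrM v1 mul1r; exact/norm_trunc_le/ltW.
  have E1 k : \int[P]_w expR (b^-1 * (v * trunc b (V k i w))) <= 1 + K / b ^+ 2.
    have j1 := integD (integ_cst P 1) (integZ (v / b) (iV k i)).
    have j2 := integZ ((1 + expR 1) / b ^+ 2) (iV2 k i).
    apply: (@le_trans _ _ (\int[P]_w (1 + v / b * V k i w +
        (1 + expR 1) / b ^+ 2 * V k i w ^+ 2))).
      apply: ler_Rint; [|exact: integD|by move=> w; exact: expR_trunc_le].
      apply: (integ_le _ _ (integD j1 j2)) => [|w]; last first.
        by rewrite ger0_norm ?expR_ge0//; exact: expR_trunc_le.
      apply: measurableT_comp => //; apply: measurable_funM => //.
      exact: (sub_measurable_measurable mY (mW k)).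
    rewrite RintegralD// RintegralD//; [|exact: integ_cst|exact: integZ].
    rewrite !RintegralZl//; [|exact: iV|exact: iV2].
    rewrite Rintegral_prob_cst EV mulr0 addr0 lerD2l.
    rewrite (_ : K / b ^+ 2 = (1 + expR 1) / b ^+ 2 * C'); last by rewrite /K mulrAC.
    rewrite ler_wpM2l// divr_ge0 ?sqr_ge0// addr_ge0 ?expR_ge0//.
  have b1 : 0 <= b^-1 by rewrite invr_ge0 ltW.
  have := @chernoff_sum _ _ _ _ _ _ H (index_iota 0 n) _ b^-1 b _ y (iota_uniq _ _) mW bW b1 E1.
  by rewrite size_iota subn0.
have mS v : measurable [set w | y <= \sum_(0 <= k < n) v * trunc b (V k i w)].
  rewrite -[X in measurable X]setTI; apply: measurable_fun_le => //.
  apply: measurable_sum => k; apply: measurable_funM => //.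
  exact: (sub_measurable_measurable mY (@mtV b k i)).
have -> : [set w | (y <= `|\sum_(0 <= k < n) trunc b (V k i w)|)%R] =
    [set w | y <= \sum_(0 <= k < n) 1 * trunc b (V k i w)] `|`
    [set w | y <= \sum_(0 <= k < n) - 1 * trunc b (V k i w)].
  by apply/seteqP; split => w /=; rewrite -!mulr_sumr mul1r mulN1r ler_normr => /orP.
apply: (@le_trans _ _ (P [set w | y <= \sum_(0 <= k < n) 1 * trunc b (V k i w)]%R +
  P [set w | y <= \sum_(0 <= k < n) - 1 * trunc b (V k i w)]%R)%E).
  exact: measureU2.
rewrite mulr_natl mulr2n EFinD; apply: leeD; apply: side; by [left|right].
Qed.

(** The condition n <= b^2 keeps the moment generating function below e^K, and y / b >= a n^(1/10)
    gives a stretched exponential tail. It beats the M n columns and is summable over all n, so no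
    blocks are needed. *)
Lemma column_sums_bound (M : nat) (b y : nat -> R) (a : R) : 0 < a ->
  (\forall n \near \oo, [/\ 0 < b n, n%:R <= b n ^+ 2 &
     a * expR (ln n%:R / 10) * b n <= y n]) ->
  {ae P, forall w, \forall n \near \oo, forall i, (i < M * n)%N ->
    `|\sum_(0 <= k < n) trunc (b n) (V k i w)| <= y n}.
Proof.
move=> a0 hb.
pose B n i := [set w | y n <= `|\sum_(0 <= k < n) trunc (b n) (V k i w)|].
have mB n i : measurable (B n i).
  rewrite -[X in measurable X]setTI; apply: measurable_fun_le => //.
  apply: measurableT_comp => //; apply: measurable_sum => k.
  exact: (sub_measurable_measurable mY (@mtV _ k i)).
pose F n := \big[setU/set0]_(i <- iota 0 (M * n)) B n i.
have mF n : measurable (F n) by apply: bigsetU_measurable.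
have C'0 : 0 <= C'.
  by apply: le_trans (EV2 0 0); apply: Rintegral_ge0 => w _; exact: sqr_ge0.
have K0 : 0 <= K by rewrite mulr_ge0// addr_ge0// expR_ge0.
have bF : \forall n \near \oo, (P (F n) <= (n%:R ^- 2)%:E)%E.
  near=> n.
  have [b0 nb yb] : [/\ 0 < b n, n%:R <= b n ^+ 2 &
     a * expR (ln n%:R / 10) * b n <= y n] by near: n.
  have s1 : 1 <= ln (n%:R : R) by near: n; exact: near_ln_ge.
  have sM : 200 * (2 * M%:R + K + 3) / a <= ln (n%:R : R) by near: n; exact: near_ln_ge.
  have s0 : 0 < ln (n%:R : R) by exact: lt_le_trans s1.
  have nE := nat_expR s0.
  set s := ln (n%:R : R) in yb s1 sM s0 nE.
  pose q : R := 2 * expR (K - a * expR (s / 10)).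
  have tail i : (P (B n i) <= q%:E)%E.
    apply: (le_trans (column_tail (y n) n i b0)).
    rewrite lee_fin ler_wpM2l// ler_expR lerB//.
      rewrite mulrA ler_pdivrMr ?exprn_gt0// mulrC ler_wpM2l//.
    by rewrite ler_pdivlMl// mulrC.
  have := @union_bound _ _ _ P _ (iota 0 (M * n)) (B n) q (fun i _ => mB n i) (fun i _ => tail i).
  move=> /le_trans; apply; rewrite lee_fin size_iota natrM /q.
  have -> : n%:R ^- 2 = expR (- (2 * s)) by rewrite expRN expRM_natl -nE.
  apply: (@le_trans _ _ (expR s * expR (2 * M%:R) * expR (K - a * expR (s / 10)))).
    rewrite -nE mulrA ler_wpM2r ?expR_ge0// (mulrC M%:R) -mulrA ler_wpM2l//.
    by have := expR_ge1Dx (2 * M%:R : R); rewrite (mulrC M%:R); lra.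
  rewrite -!expRD ler_expR.
  have s10 : 0 <= s / 10 by rewrite divr_ge0// ltW.
  (* A quadratic in s = ln n suffices: the exponents to beat, s + 2 s and the constants, are
     linear. *)
  have e2 : s ^+ 2 / 200 <= expR (s / 10).
    have := expR_ge1Dxn 1 s10; rewrite (_ : 2`! = 2)%N// expr_div_n.
    lra.
  have ae2 := ler_wpM2l (ltW a0) e2.
  have k1 : (2 * M%:R + K + 3) * s <= a * (s ^+ 2 / 200).
    move: sM; rewrite ler_pdivrMr// => sM.
    have := ler_wpM2r (ltW s0) sM; rewrite expr2; lra.
  have k2 : 2 * M%:R + K <= (2 * M%:R + K) * s by rewrite ler_peMr// addr_ge0// mulr_ge0.
  lra.
have := borel_cantelli_square mF bF; apply: filterS => w; apply: filterS => n Fn i iM.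
rewrite leNgt; apply/negP => /ltW h; apply: Fn; rewrite /F -bigcup_seq.
by exists i => //=; rewrite mem_iota.
Unshelve. all: by end_near. Qed.

End centered_columns.

(** As 9/20 < 1/2, the squares stay below n^(9/10), a factor n^(1/10) under the deviations of order
    n in [column_sums]. *)
Definition small_entries : Prop := forall M : nat,
  {ae P, forall w, \forall n \near \oo, forall k i, (k < M * n)%N -> (i < M * n)%N ->
     `|Z k i w| <= expR (9 / 20 * ln n%:R)}.

(** With column sums below n^(3/4), the centring term of a covariance, a product of two of them
    divided by n, is at most n^(1/2) = o(sqrt (n log n)). *)
Lemma column_sums (M : nat) (y : R) : small_entries -> 0 < y ->
  {ae P, forall w, \forall n \near \oo, forall i, (i < M * n)%N ->
    `|\sum_(0 <= k < n) Z k i w| <= expR (3 / 4 * ln n%:R) /\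
    `|\sum_(0 <= k < n) (Z k i w ^+ 2 - 1)| <= y * n%:R}.
Proof.
move=> se y0.
have mZ k i : sub_measurable Y (row k) (Z k i) by exact: sub_measurable_Z.
have mZ2 k i : sub_measurable Y (row k) (fun w => Z k i w ^+ 2 - 1).
  apply: measurable_funB => //; apply: measurable_funX; exact: mZ.
have iZ2 k i : integ P (fun w => Z k i w ^+ 2) by exact: (integ_pow H k i (isT : 2 <= 4)%N).
have E2 k i : \int[P]_w (Z k i w ^+ 2) <= 1 by rewrite (std_E2 H).
have iV k i : integ P (fun w => Z k i w ^+ 2 - 1) by apply: integB => //; exact: integ_cst.
have EV k i : \int[P]_w (Z k i w ^+ 2 - 1) = 0.
  by rewrite RintegralB//; [rewrite Rintegral_prob_cst (std_E2 H) subrr|exact: iZ2|exact: integ_cst].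
have V2E k i w : (Z k i w ^+ 2 - 1) ^+ 2 = Z k i w ^+ 4 - 2 * Z k i w ^+ 2 + 1 by ring.
have jV k i := integB (std_int4 H k i) (integZ 2 (iZ2 k i)).
have iV2 k i : integ P (fun w => (Z k i w ^+ 2 - 1) ^+ 2).
  rewrite (_ : (fun _ => _) = (fun w => Z k i w ^+ 4 - 2 * Z k i w ^+ 2 + 1)); last first.
    by apply/funext => w; rewrite V2E.
  by apply: integD; [exact: jV|exact: integ_cst].
have EV2 k i : \int[P]_w ((Z k i w ^+ 2 - 1) ^+ 2) <= C.
  have -> : \int[P]_w ((Z k i w ^+ 2 - 1) ^+ 2) =
      \int[P]_w (Z k i w ^+ 4 - 2 * Z k i w ^+ 2 + 1).
    by congr fine; apply: eq_integral => w _; rewrite V2E.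
  rewrite RintegralD//; [|exact: jV|exact: integ_cst].
  rewrite RintegralB//; [|exact: (std_int4 H)|exact: integZ].
  rewrite RintegralZl//; last exact: iZ2.
  rewrite Rintegral_prob_cst (std_E2 H).
  by have := std_E4 H k i; lra.
(* Levels that truncate nothing in the end: b1 = n^(1/2) for the entries, b2 = n^(9/10) for the
   centred squares. Times n^(1/10) they stay within n^(3/4) and n. *)
pose b1 n : R := expR (ln n%:R / 2).
pose b2 n : R := expR (9 / 10 * ln n%:R).
have c1 := @column_sums_bound Z 1 mZ (fun k i => integ_Z H k i) iZ2 (std_E1 H) E2 M b1
  (fun n => expR (3 / 4 * ln n%:R)) 1 ltr01.
have c2 := @column_sums_bound _ C mZ2 iV iV2 EV EV2 M b2 (fun n => y * n%:R) y y0.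
have {}c1 : {ae P, forall w, \forall n \near \oo, forall i, (i < M * n)%N ->
    `|\sum_(0 <= k < n) trunc (b1 n) (Z k i w)| <= expR (3 / 4 * ln n%:R)}.
  apply: c1; near=> n.
  have s1 : 1 <= ln (n%:R : R) by near: n; exact: near_ln_ge.
  have s0 : 0 < ln (n%:R : R) by exact: lt_le_trans s1.
  split; first exact: expR_gt0.
    by rewrite /b1 -expRM_natl mulrC divfK ?pnatr_eq0// -nat_expR.
  by rewrite mul1r -expRD ler_expR; lra.
have {}c2 : {ae P, forall w, \forall n \near \oo, forall i, (i < M * n)%N ->
    `|\sum_(0 <= k < n) trunc (b2 n) (Z k i w ^+ 2 - 1)| <= y * n%:R}.
  apply: c2; near=> n.
  have s1 : 1 <= ln (n%:R : R) by near: n; exact: near_ln_ge.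
  have s0 : 0 < ln (n%:R : R) by exact: lt_le_trans s1.
  split; first exact: expR_gt0.
    by rewrite /b2 -expRM_natl {1}(nat_expR s0) ler_expR; lra.
  rewrite {2}(nat_expR s0) -mulrA -expRD ler_wpM2l ?(ltW y0)// ler_expR; lra.
apply: filterS3 (se (M + 1)%N) c1 c2 => w hse h1 h2.
apply: filterS3 (filterI hse (near_ln_ge (1 : R))) h1 h2 => n [hn s1] {}h1 {}h2 i iM.
have small k : (k < n)%N -> `|Z k i w| <= expR (9 / 20 * ln n%:R).
  move=> kn; apply: hn; first by apply: (leq_trans kn); rewrite leq_pmull// addn1.
  by apply: (leq_trans iM); rewrite leq_mul2r leq_addr orbT.
split.
  rewrite (eq_big_nat _ _ (F2 := fun k => trunc (b1 n) (Z k i w))); first exact: h1.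
  move=> k /= kn; rewrite /trunc ifT//; apply: (le_trans (small k kn)).
  by rewrite ler_expR; lra.
rewrite (eq_big_nat _ _ (F2 := fun k => trunc (b2 n) (Z k i w ^+ 2 - 1))); first exact: h2.
move=> k /= kn; rewrite /trunc ifT//.
have z2 : Z k i w ^+ 2 <= b2 n.
  rewrite -[Z k i w ^+ 2]real_normK ?num_real// /b2.
  rewrite (_ : 9 / 10 * ln n%:R = 2 * (9 / 20 * ln n%:R)); last by field.
  by rewrite expRM_natl lerXn2r ?nnegrE ?expR_ge0//; exact: small.
have b21 : 1 <= b2 n.
  by apply: le_trans (expR_ge1Dx _); rewrite lerDl mulr_ge0//; lra.
rewrite ler_norml; have := sqr_ge0 (Z k i w); lra.
Unshelve. all: by end_near. Qed.

End column_sums.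

(** * Consequences of the summability hypothesis *)

Section joint_laws.
Context d (T : measurableType d) (R : realType) (P : probability T R).
Variables (K : choiceType) (Y : K -> T -> R).
Hypothesis mY : forall j, measurable_fun setT (Y j).
Hypothesis iY : mutually_independent P setT Y.
Hypothesis dY : identically_distributed P setT Y.

Lemma prob_box m (f : 'I_m -> K) (B : 'I_m -> set R) : injective f ->
  (forall i, measurable (B i)) ->
  P (\bigcap_(i in [set: 'I_m]) (Y (f i) @^-1` B i)) =
  (\prod_(i < m) P (Y (f i) @^-1` B i))%E.
Proof.
move=> finj mB.
pose B' (x : K) := if [pick i | f i == x] is Some i then B i else setT.
have B'E i : B' (f i) = B i.
  rewrite /B'; case: pickP => [j /eqP/finj ->//|/(_ i)]; by rewrite eqxx.
have us : uniq [seq f i | i <- index_enum 'I_m].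
  by rewrite map_inj_uniq ?index_enum_uniq.
have mB' x : measurable (B' x) by rewrite /B'; case: pickP.
have := iY us (fun _ _ => I) mB'.
rewrite big_map; under [X in _ = X -> _]eq_bigr do rewrite B'E.
move=> <-; congr (P _); apply/seteqP; split => w /= hw.
  by move=> x /mapP[i _ ->]; rewrite B'E; exact: hw.
by move=> i _; rewrite -B'E; apply: hw; apply/mapP; exists i => //; rewrite mem_index_enum.
Qed.

(** Exchangeability: the two laws agree on boxes, which form a generating pi-system. It moves an
    event from any row and any columns to row 0 and the first columns. *)
Lemma prob_tuple m (f f' : 'I_m -> K) (A : set (m.-tuple R)) :
  injective f -> injective f' -> measurable A ->
  P ((fun w => [tuple Y (f i) w | i < m]) @^-1` A) =
  P ((fun w => [tuple Y (f' i) w | i < m]) @^-1` A).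
Proof.
move=> finj f'inj mA.
have mt (g : 'I_m -> K) : measurable_fun setT (fun w => [tuple Y (g i) w | i < m]).
  apply/measurable_fun_tnthP => i.
  rewrite (_ : _ \o _ = Y (g i)); first exact: mY.
  by apply/funext => w /=; rewrite tnth_mktuple.
pose t1 : {mfun T >-> m.-tuple R} := 
  HB.pack (fun w => [tuple Y (f i) w | i < m]) (isMeasurableFun.Build _ _ _ _ _ (mt f)).
pose t2 : {mfun T >-> m.-tuple R} := 
  HB.pack (fun w => [tuple Y (f' i) w | i < m]) (isMeasurableFun.Build _ _ _ _ _ (mt f')).
pose box (B : 'I_m -> set R) : set (m.-tuple R) :=
  \bigcap_(i in [set: 'I_m]) ((fun t => tnth t i) @^-1` B i).
pose G : set (set (m.-tuple R)) :=
  [set A | exists B : 'I_m -> set R, (forall i, measurable (B i)) /\ A = box B].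
have boxE (g : 'I_m -> K) B : (fun w => [tuple Y (g i) w | i < m]) @^-1` box B =
    \bigcap_(i in [set: 'I_m]) (Y (g i) @^-1` B i).
  by apply/seteqP; split => w /= hw i Ii; have := hw i Ii; rewrite /= tnth_mktuple.
have GT : G setT.
  exists (fun=> setT); split => //; by apply/seteqP; split.
apply: (measure_unique G (fun=> setT) _ _ _ _ (distribution P t1) (distribution P t2)) => //.
- apply/seteqP; split.
    apply: smallest_sub; first exact: smallest_sigma_algebra.
    rewrite -bigcup_seq => B [i _ [C mC <-]]; apply: sub_sigma_algebra.
    exists (fun j => if j == i then C else setT); split => [j|]; first by case: ifP.
    apply/seteqP; split => t /=.
      by move=> [_ Ct] j _ /=; case: eqP => // ->.
    by move=> /(_ i I) /=; rewrite eqxx.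
  apply: smallest_sub; first exact: sigma_algebra_measurable.
  move=> _ [B [mB ->]]; apply: fin_bigcap_measurable => [|i _]; first exact: finite_finset.
  by rewrite -[X in measurable X]setTI; exact: measurable_tnth.
- move=> _ _ [B [mB ->]] [B' [mB' ->]]; exists (fun i => B i `&` B' i); split.
    by move=> i; exact: measurableI.
  by rewrite /box -bigcapI.
- by apply/seteqP; split => // t _; exists 0%N.
- move=> _ [B [mB ->]]; rewrite /distribution /pushforward.
  transitivity (P (\bigcap_(i in [set: 'I_m]) (Y (f i) @^-1` B i))); first by rewrite -boxE.
  transitivity (P (\bigcap_(i in [set: 'I_m]) (Y (f' i) @^-1` B i))); last by rewrite -boxE.
  by rewrite !prob_box//; apply: eq_bigr => i _; exact: dY.
- by move=> _; rewrite /= probability_setT ltry.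
Qed.

End joint_laws.

(** * Large products within a row *)

Section row_events.
Context d (T : measurableType d) (R : realType) (P : probability T R).
Variable X : nat -> nat -> T -> R.
Hypothesis mX : forall k i, measurable_fun setT (X k i).
Local Notation Y := (fun ki : nat * nat => X ki.1 ki.2).
Hypothesis iX : mutually_independent P setT Y.
Hypothesis dX : identically_distributed P setT Y.
Let mY (ki : nat * nat) : measurable_fun setT (Y ki) := mX ki.1 ki.2.

Definition row_event (k : nat) (s : seq nat) (b : R) : set T :=
  [set w | exists i j, [/\ i \in s, j \in s, i != j & b <= `|X k i w * X k j w|]].

Lemma measurable_row_event k s b : measurable (row_event k s b).
Proof.
rewrite (_ : row_event k s b = \bigcup_(i in [set` s]) \bigcup_(j in [set` s])
  (if i != j then [set w | b <= `|X k i w * X k j w|] else set0)).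
  apply: fin_bigcup_measurable => // i _; apply: fin_bigcup_measurable => // j _.
  case: ifP => // _; rewrite -[X in measurable X]setTI; apply: measurable_fun_le => //.
  by apply: measurableT_comp => //; apply: measurable_funM.
apply/seteqP; split => w /=.
  by move=> [i [j [si sj ij h]]]; exists i => //; exists j => //; rewrite ij.
by move=> [i si [j sj]]; case: ifPn => // ij h; exists i, j.
Qed.

(** By exchangeability only the number of distinct columns matters, neither which columns nor which
    row. *)
Lemma row_event_le k s m b : (size (undup s) <= m)%N ->
  (P (row_event k s b) <= P (row_event 0 (iota 0 m) b))%E.
Proof.
set s' := undup s => sm.
have us : uniq s' := undup_uniq s.
set n := size s' in sm *.
pose f (i : 'I_n) := (k, nth 0%N s' i).
pose g (i : 'I_n) := (0%N, i : nat).
have finj : injective f.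
  move=> i j [] /eqP; rewrite nth_uniq// => /eqP; exact: val_inj.
have ginj : injective g by move=> i j [] /val_inj.
pose A : set (n.-tuple R) := \bigcup_(i in [set: 'I_n]) \bigcup_(j in [set: 'I_n])
  (if i != j then [set t | b <= `|tnth t i * tnth t j|] else set0).
have mA : measurable A.
  apply: fin_bigcup_measurable => [|i _]; first exact: finite_finset.
  apply: fin_bigcup_measurable => [|j _]; first exact: finite_finset.
  case: ifP => // _; rewrite -[X in measurable X]setTI; apply: measurable_fun_le => //.
  apply: measurableT_comp => //; apply: measurable_funM; exact: measurable_tnth.
have E1 : row_event k s b = (fun w => [tuple Y (f i) w | i < n]) @^-1` A.
  apply/seteqP; split => w /=.
    move=> [i [j [si sj ij h]]].
    rewrite -mem_undup in si; rewrite -mem_undup in sj.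
    have ii : (index i s' < n)%N by rewrite index_mem.
    have jj : (index j s' < n)%N by rewrite index_mem.
    exists (Ordinal ii) => //; exists (Ordinal jj) => //.
    have -> : Ordinal ii != Ordinal jj.
      apply: contra ij => /eqP[] hij; apply/eqP.
      by rewrite -(nth_index 0%N si) -(nth_index 0%N sj) hij.
    by rewrite /= !tnth_mktuple /f /= !nth_index.
  move=> [i _ [j _]]; case: ifPn => // ij; rewrite /= !tnth_mktuple /f /= => h.
  exists (nth 0%N s' i), (nth 0%N s' j); split => //.
  - by rewrite -mem_undup mem_nth.
  - by rewrite -mem_undup mem_nth.
  - by rewrite nth_uniq.
rewrite E1 (prob_tuple mY iX dX finj ginj mA).
apply: le_measure; rewrite ?inE.
- rewrite -[X in measurable X]setTI.
  have mt : measurable_fun setT (fun w => [tuple Y (g i) w | i < n]).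
    apply/measurable_fun_tnthP => i.
    rewrite (_ : _ \o _ = Y (g i)); first exact: mY.
    by apply/funext => w /=; rewrite tnth_mktuple.
  exact: mt.
- exact: measurable_row_event.
- move=> w [i _ [j _]]; case: ifPn => // ij; rewrite /= !tnth_mktuple /g /= => h.
  exists (i : nat), (j : nat); split => //; rewrite mem_iota add0n /=.
    exact: leq_trans (ltn_ord i) sm.
  exact: leq_trans (ltn_ord j) sm.
Qed.

Lemma row_event_mono k s b b' : b' <= b ->
  (P (row_event k s b) <= P (row_event k s b'))%E.
Proof.
move=> bb; apply: le_measure; rewrite ?inE; try exact: measurable_row_event.
move=> w [i [j [si sj ij h]]]; exists i, j; split => //; exact: le_trans h.
Qed.

Definition dyadic_prob (l : nat) : R :=
  fine (P (row_event 0 (iota 0 (2 ^ l)) (scale R (2 ^ l.+1)))).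

Hypothesis summable :
  (\sum_(0 <= n <oo) P (row_event 0 (iota 0 n) (scale R n)) < +oo)%E.

Lemma dyadic_prob_ge0 l : 0 <= dyadic_prob l.
Proof. exact: fine_ge0. Qed.

Lemma dyadic_probE l :
  P (row_event 0 (iota 0 (2 ^ l)) (scale R (2 ^ l.+1))) = (dyadic_prob l)%:E.
Proof. by rewrite fineK// fin_num_measure//; exact: measurable_row_event. Qed.

(** Cauchy condensation: for 2^L <= n < 2^(L+1) the row has at least 2^L columns and the threshold
    is at most that of 2^(L+1), so each of the 2^L terms dominates [dyadic_prob L]. *)
Lemma dyadic_sum_bound : exists B : R, 0 <= B /\ forall L,
  \sum_(0 <= l < L) 2 ^+ l * dyadic_prob l <= B.
Proof.
set p := fun n => P (row_event 0 (iota 0 n) (scale R n)).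
have p0 n : (0 <= p n)%E by exact: measure_ge0.
have fin : (\sum_(0 <= n <oo) p n)%E \is a fin_num.
  by rewrite ge0_fin_numE//; apply: nneseries_ge0 => n _ _.
exists (fine (\sum_(0 <= n <oo) p n)%E); split.
  by apply: fine_ge0; apply: nneseries_ge0 => n _ _.
move=> L; rewrite -lee_fin fineK//.
apply: (@le_trans _ _ (\sum_(0 <= n < 2 ^ L) p n)%E); last first.
  by apply: (nneseries_lim_ge (P := xpredT)) => n _ _.
elim: L => [|L IH].
  by rewrite big_geq//; apply: sume_ge0 => n _.
rewrite big_nat_recr//= EFinD.
rewrite [leRHS](@big_cat_nat _ _ _ (2 ^ L))//=; last by rewrite leq_exp2l.
apply: leeD => //.
apply: (@le_trans _ _ (\sum_(2 ^ L <= n < 2 ^ L.+1) (dyadic_prob L)%:E)%E).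
  have E2 : (2 ^ L.+1 - 2 ^ L)%N = (2 ^ L)%N by rewrite expnS mul2n -addnn addnK.
  by rewrite sumEFin lee_fin sumr_const_nat E2 -[leRHS]mulr_natl natrX.
rewrite [leLHS]big_nat [leRHS]big_nat; apply: lee_sum => n /andP[n1 n2].
rewrite -dyadic_probE.
apply: (@le_trans _ _ (P (row_event 0 (iota 0 (2 ^ L)) (scale R n)))).
  by apply: row_event_mono; apply: scale_mono (ltnW n2); rewrite (leq_trans _ n1)// expn_gt0.
by apply: row_event_le; rewrite undup_id ?iota_uniq// size_iota.
Qed.

Lemma scale_pow2_ratio (u l : nat) (e : R) : 0 <= e -> (0 < u <= l)%N ->
  2 <= e ^+ 2 * 2 ^+ u -> scale R (2 ^ (l - u).+1) <= e * scale R (2 ^ l).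
Proof.
move=> e0 /andP[u0 ul] eu.
rewrite /scale -{1}(ger0_norm e0) -sqrtr_sqr -sqrtrM ?sqr_ge0//.
apply: ler_wsqrtr.
have ln0 : 0 <= ln ((2 ^ l)%:R : R) by rewrite ln_ge0// ler1n expn_gt0.
apply: (@le_trans _ _ ((2 ^ (l - u).+1)%:R * ln ((2 ^ l)%:R : R))).
  rewrite ler_wpM2l// ler_ln ?posrE ?ltr0n ?expn_gt0// ler_nat leq_exp2l//.
  by rewrite ltn_subrL u0 (leq_trans u0 ul).
rewrite mulrA ler_wpM2r//.
rewrite -[in leRHS](subnK ul) expnS natrM expnD natrM !natrX.
rewrite [leRHS](_ : _ = (e ^+ 2 * 2 ^+ u) * 2 ^+ (l - u)); last by ring.
by rewrite ler_wpM2r// exprn_ge0.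
Qed.

(** The columns are cut into M 2^(u+1) groups of 2^(l-u-1). Any two columns lie in the union of two
    groups, so one event per pair of groups suffices, on at most 2^(l-u) columns. *)
Lemma row_event_cover k (M u l : nat) (b : R) : (u < l)%N ->
  (P (row_event k (iota 0 (M * 2 ^ l)) b) <=
   ((M * 2 ^ u.+1)%:R * (M * 2 ^ u.+1)%:R)%:E *
   P (row_event 0 (iota 0 (2 ^ (l - u))) b))%E.
Proof.
move=> ul; set N := (M * 2 ^ u.+1)%N; pose h := (2 ^ (l - u.+1))%N.
have h0 : (0 < h)%N by rewrite expn_gt0.
have hh : (h + h = 2 ^ (l - u))%N by rewrite addnn -mul2n -expnS -subSn.
have Nh : (N * h = M * 2 ^ l)%N by rewrite /N /h -mulnA -expnD subnKC.
pose s (bg : nat * nat) := iota (bg.1 * h) h ++ iota (bg.2 * h) h.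
pose pairs := [seq (i, j) | i <- iota 0 N, j <- iota 0 N].
set p := P (row_event 0 (iota 0 (2 ^ (l - u))) b).
have fp : p \is a fin_num by rewrite fin_num_measure//; exact: measurable_row_event.
have mU : measurable (\big[setU/set0]_(bg <- pairs) row_event k (s bg) b).
  by apply: bigsetU_measurable => bg _; exact: measurable_row_event.
apply: (@le_trans _ _ (P (\big[setU/set0]_(bg <- pairs) row_event k (s bg) b))).
  apply: le_measure; rewrite ?inE//; first exact: measurable_row_event.
  move=> w [i [j [si sj ij hw]]].
  rewrite mem_iota add0n /= -Nh in si; rewrite mem_iota add0n /= -Nh in sj.
  rewrite -bigcup_seq; exists ((i %/ h)%N, (j %/ h)%N).
    by apply/allpairsP; exists ((i %/ h)%N, (j %/ h)%N); rewrite !mem_iota !add0n /= !ltn_divLR.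
  have mem x : x \in iota (x %/ h * h) h.
    by rewrite mem_iota leq_trunc_div /= {1}(divn_eq x h) ltn_add2l ltn_pmod.
  by exists i, j; split => //; rewrite /s mem_cat mem ?orbT.
rewrite -(fineK fp) -EFinM -natrM (_ : (N * N)%N = size pairs); last first.
  by rewrite size_allpairs !size_iota.
apply: union_bound => bg _; first exact: measurable_row_event.
rewrite fineK//; apply: row_event_le.
by apply: leq_trans (size_undup _) _; rewrite size_cat !size_iota hh.
Qed.

(** Going back u generations makes the threshold [scale R (2 ^ (l - u).+1)] at most e times the
    scale of 2^l, at the price of a number of copies independent of l. The union over M 2^l rows
    costs 2^l, exactly the weight in [dyadic_sum_bound]. *)
Lemma small_products_X : small_products P X.
Proof.
move=> M e e0.
have [B [B0 hB]] := dyadic_sum_bound.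
have [u u0 hu] : exists2 u, (0 < u)%N & 2 <= e ^+ 2 * 2 ^+ u.
  have [N _ hN] := nbhs_infty_ger (2 / e ^+ 2).
  exists N.+1 => //; rewrite mulrC -ler_pdivrMr ?exprn_gt0//.
  apply: (le_trans (hN N (leqnn N))).
  by rewrite -natrX ler_nat (leq_trans (ltnW (ltn_expl N (isT : 1 < 2)%N)))// leq_exp2l.
pose bad M' l := \big[setU/set0]_(k <- iota 0 (M' * 2 ^ l))
  row_event k (iota 0 (M' * 2 ^ l)) (e * scale R (2 ^ l)).
have mbad M' l : measurable (bad M' l).
  by apply: bigsetU_measurable => k _; exact: measurable_row_event.
have Pbad M' l : (u < l)%N -> (P (bad M' l) <=
    (M'%:R * (M' * 2 ^ u.+1)%:R ^+ 2 * 2 ^+ u * (2 ^+ (l - u) * dyadic_prob (l - u)))%:E)%E.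
  move=> ul.
  have Pk k : (P (row_event k (iota 0 (M' * 2 ^ l)) (e * scale R (2 ^ l))) <=
      ((M' * 2 ^ u.+1)%:R ^+ 2 * dyadic_prob (l - u))%:E)%E.
    apply: (le_trans (row_event_cover _ _ _ ul)).
    rewrite expr2 [leRHS]EFinM; apply: lee_wpmul2l; first by rewrite lee_fin mulr_ge0.
    rewrite -dyadic_probE; apply: row_event_mono; apply: scale_pow2_ratio => //; first exact: ltW.
    by rewrite u0 ltnW.
  have := union_bound (s := iota 0 (M' * 2 ^ l)) (fun k _ => measurable_row_event k _ _) (fun k _ => Pk k).
  rewrite size_iota => h; apply: (le_trans h); rewrite lee_fin natrM natrX.
  rewrite -[in X in 2 ^+ X](subnK (ltnW ul)) exprD le_eqVlt; apply/orP; left; apply/eqP.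
  by ring.
have good M' : {ae P, forall w, \forall l \near \oo, ~ bad M' l w}.
  (* The shift by u + 1 keeps l above u, as [Pbad] requires. *)
  have : {ae P, forall w, \forall l \near \oo, ~ bad M' (l + u.+1)%N w}.
    apply: borel_cantelli => [l|]; first exact: mbad.
    set K := M'%:R * (M' * 2 ^ u.+1)%:R ^+ 2 * 2 ^+ u : R.
    have K0 : 0 <= K by rewrite !mulr_ge0// exprn_ge0.
    apply: (@le_lt_trans _ _ (K * B)%:E); last by rewrite ltry.
    apply: nneseries_le => // L.
    apply: (@le_trans _ _ (\sum_(0 <= l < L) (K * (2 ^+ l.+1 * dyadic_prob l.+1))%:E)%E).
      apply: lee_sum => l _.
      apply: (le_trans (Pbad M' (l + u.+1)%N _)); first by rewrite addnS ltnS leq_addl.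
      by rewrite addnS -addSn addnK.
    rewrite sumEFin lee_fin -mulr_sumr ler_wpM2l//.
    apply: le_trans (hB L.+1); rewrite big_nat_recl//= lerDr mulr_ge0 ?exprn_ge0//.
    exact: dyadic_prob_ge0.
  apply: filterS => w [N _ h]; exists (N + u.+1)%N => // l /= Nl.
  have ul : (u.+1 <= l)%N by apply: leq_trans Nl; exact: leq_addl.
  rewrite -(subnK ul); apply: h => /=.
  by rewrite leq_subRL// addnC.
(* For n in the block from c 2^l to (c + 1) 2^l the indices reach M (c + 1) 2^l. *)
have : {ae P, forall w, forall c, \forall l \near \oo, ~ bad (M * c.+1)%N l w}.
  by apply: ae_foralln => c; exact: good.
apply: filterS => w hw; apply: (@near_blocks 0) => c c1.
apply: filterS (hw c) => l hl n /andP[n1 n2] k i j kn in' jn ij.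
have nM : (M * n <= M * c.+1 * 2 ^ l)%N.
  by rewrite -mulnA leq_mul2l (leq_trans n2) ?orbT// mulSn addnC.
have l2n : (2 ^ l <= n)%N by apply: leq_trans n1; rewrite leq_pmull.
apply: (@le_trans _ _ (e * scale R (2 ^ l))); last first.
  by rewrite ler_wpM2l ?(ltW e0)//; apply: scale_mono => //; rewrite expn_gt0.
rewrite leNgt; apply/negP => /ltW h; apply: hl; rewrite /bad -bigcup_seq.
exists k; first by rewrite /= mem_iota add0n (leq_trans kn).
by exists i, j; split => //; rewrite mem_iota add0n /= (leq_trans _ nM).
Qed.

End row_events.

(** * Polynomial tail of one entry *)

Section tail_bound.
Context d (T : measurableType d) (R : realType) (P : probability T R).
Variable X : nat -> nat -> T -> R.
Hypothesis mX : forall k i, measurable_fun setT (X k i).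
Local Notation Y := (fun ki : nat * nat => X ki.1 ki.2).
Hypothesis iX : mutually_independent P setT Y.
Hypothesis dX : identically_distributed P setT Y.
Let mY (ki : nat * nat) : measurable_fun setT (Y ki) := mX ki.1 ki.2.

Definition tail_prob (r : R) : R := fine (P [set w | r <= `|X 0 0 w|]).

Lemma measurable_tail k i r : measurable [set w | r <= `|X k i w|].
Proof.
rewrite -[X in measurable X]setTI; apply: measurable_fun_le => //.
exact: measurableT_comp.
Qed.

Lemma tail_probE k i r : P [set w | r <= `|X k i w|] = (tail_prob r)%:E.
Proof.
rewrite /tail_prob fineK; last by rewrite fin_num_measure//; exact: measurable_tail.
have mB : measurable [set x : R | r <= `|x|].
  by rewrite -[X in measurable X]setTI; apply: measurable_fun_le.
exact: (dX (i := (k, i)) (j := (0, 0)%N) I I mB).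
Qed.

Lemma tail_prob_ge0 r : 0 <= tail_prob r.
Proof. exact: fine_ge0. Qed.

Lemma tail_prob_le1 r : tail_prob r <= 1.
Proof.
by rewrite -lee_fin -(tail_probE 0 0); apply: probability_le1; exact: measurable_tail.
Qed.

Lemma tail_prob_mono r r' : r <= r' -> tail_prob r' <= tail_prob r.
Proof.
move=> rr; rewrite -lee_fin -!(tail_probE 0 0); apply: le_measure; rewrite ?inE;
  try exact: measurable_tail.
by move=> w /=; exact: le_trans.
Qed.

(* If both halves of the row contain an entry of size at least r, then some
   product of two distinct entries has size at least r^2. *)
Lemma row_event_ge h r : 0 <= r ->
  (((1 - (1 - tail_prob r) ^+ h) ^+ 2)%:E <=
   P (row_event X 0 (iota 0 (h + h)) (r ^+ 2)))%E.
Proof.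
move=> r0.
pose B : set R := [set x | `|x| < r].
have mB : measurable B.
  rewrite (_ : B = ~` [set x | r <= `|x|]).
    apply: measurableC; rewrite -[X in measurable X]setTI.
    exact: measurable_fun_le.
  by apply/seteqP; split => x /=; rewrite /B /= ltNge => /negP.
pose J a := [seq (0%N, i) | i <- iota a h].
have uJ a : uniq (J a) by rewrite map_inj_uniq ?iota_uniq// => i j [].
pose A a := \bigcap_(j in [set j | j \in J a]) (Y j @^-1` B).
have PB j : P (Y j @^-1` B) = (1 - tail_prob r)%:E.
  rewrite (_ : Y j @^-1` B = ~` [set w | r <= `|X j.1 j.2 w|]).
    rewrite probability_setC; last exact: measurable_tail.
    by rewrite tail_probE.
  by apply/seteqP; split => x /=; rewrite /B /= ltNge => /negP.
have PA a : P (A a) = ((1 - tail_prob r) ^+ h)%:E.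
  rewrite /A (iX (uJ a) (fun _ _ => I) (fun _ => mB)).
  rewrite (eq_bigr (fun=> (1 - tail_prob r)%:E)); last by move=> j _; exact: PB.
  rewrite prodEFin; congr EFin.
  by rewrite big_const_seq count_predT size_map size_iota iter_mulr_1.
have cA a : cylinders Y [set j | j \in J a] (A a).
  by exists (J a), (fun=> B); split.
have mA a : measurable (A a) by exact: (cylinders_measurable mY (cA a)).
have sA a : <<s cylinders Y [set j | j \in J a] >> (~` A a).
  by apply: sigma_algebraC; apply: sub_sigma_algebra; exact: cA.
have disj : [set j | j \in J 0%N] `&` [set j | j \in J h] = set0.
  apply/seteqP; split => // x /= [] /mapP[i i0 ->] /mapP[j jh [ij]].
  move: i0 jh; rewrite -ij !mem_iota add0n => /andP[_ ih] /andP[hi _].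
  by rewrite leqNgt ih in hi.
have ind := sigma_cylinders_indep mY iX disj (sA 0%N) (sA h).
have -> : ((1 - (1 - tail_prob r) ^+ h) ^+ 2)%:E = P (~` A 0%N `&` ~` A h).
  by rewrite ind !probability_setC// !PA expr2 EFinM EFinB.
apply: le_measure; rewrite ?inE; [|exact: measurable_row_event|].
  by apply: measurableI; exact: measurableC.
have big a w : (~` A a) w -> exists2 i, i \in iota a h & r <= `|X 0 i w|.
  move=> hw; apply: contrapT => hn; apply: hw => -[b i] /= /mapP[j ja [-> ->]] /=.
  by rewrite /B /= ltNge; apply/negP => h'; apply: hn; exists j.
move=> w [/big[i ii hi] /big[j jj hj]]; exists i, j.
rewrite mem_iota add0n in ii; rewrite mem_iota in jj.
case/andP: ii => _ ih; case/andP: jj => hj' jhh.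
split; rewrite ?mem_iota ?add0n//=.
- by rewrite (leq_trans ih)// leq_addr.
- by rewrite neq_ltn (leq_trans ih hj').
- by rewrite normrM expr2 ler_pM.
Qed.

Hypothesis summable :
  (\sum_(0 <= n <oo) P (row_event X 0 (iota 0 n) (scale R n)) < +oo)%E.

(* This is (1 - p)^h <= 1 / (1 + h p) without the division. *)
Lemma one_sub_exp_ge (p : R) h : 0 <= p <= 1 ->
  h%:R * p <= (1 - (1 - p) ^+ h) * (1 + h%:R * p).
Proof.
move=> /andP[p0 p1].
suff : (1 - p) ^+ h * (1 + h%:R * p) <= 1 by lra.
elim: h => [|h IH]; first by rewrite expr0 mul0r addr0 mulr1.
apply: le_trans IH; rewrite exprS -natr1.
have q0 : 0 <= (1 - p) ^+ h by rewrite exprn_ge0// subr_ge0.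
rewrite (mulrC (1 - p)) -mulrA ler_wpM2l//.
have : 0 <= h%:R * p ^+ 2 :> R by rewrite mulr_ge0// sqr_ge0.
have := sqr_ge0 p; rewrite expr2; lra.
Qed.

(** With h = 2^(l-1) and u the probability of a large entry among h, u^2 <= [dyadic_prob l] <= B
    2^-l. For large l this forces u <= 1/2, so [one_sub_exp_ge] linearizes to h p <= 2 u. *)
Lemma dyadic_tail : exists K : R, \forall l \near \oo,
  forall r, 0 <= r -> scale R (2 ^ l.+1) <= r ^+ 2 ->
  tail_prob r ^+ 2 <= K * (2 ^+ l) ^- 3.
Proof.
have [B [B0 hB]] := dyadic_sum_bound mX iX dX summable.
exists (16 * B); near=> l => r r0 hr.
have l1 : (0 < l)%N by near: l; exact: nbhs_infty_gt.
have lB : 4 * B <= 2 ^+ l.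
  apply: (@le_trans _ _ l%:R); first by near: l; exact: nbhs_infty_ger.
  by rewrite -natrX ler_nat ltnW// ltn_expl.
pose h := (2 ^ l.-1)%N.
have hh : (h + h = 2 ^ l)%N by rewrite addnn -mul2n -expnS prednK.
have hR : 2 ^+ l = 2 * h%:R :> R by rewrite -natrX -hh addnn -muln2 natrM mulrC.
have h0 : 0 < h%:R :> R by rewrite ltr0n expn_gt0.
set p := tail_prob r.
have p01 : 0 <= p <= 1 by rewrite tail_prob_ge0 tail_prob_le1.
have p0 : 0 <= p by case/andP: p01.
set u := 1 - (1 - p) ^+ h.
have u2 : u ^+ 2 <= dyadic_prob P X l.
  rewrite -lee_fin -(dyadic_probE P mX) -hh.
  apply: (le_trans (row_event_ge h r0)).
  exact: row_event_mono.
have lq : 2 ^+ l * dyadic_prob P X l <= B.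
  apply: le_trans (hB l.+1); rewrite big_nat_recr//= lerDr.
  by apply: sumr_ge0 => i _; rewrite mulr_ge0 ?exprn_ge0// dyadic_prob_ge0.
have l0 : 0 < 2 ^+ l :> R by rewrite exprn_gt0.
have u2B : 2 ^+ l * u ^+ 2 <= B by apply: le_trans lq; rewrite ler_wpM2l// ltW.
have u0 : 0 <= u.
  by case/andP: p01 => ? ?; rewrite /u subr_ge0 exprn_ile1// ?subr_ge0// gerBl.
have uh : u <= 2^-1.
  rewrite leNgt; apply/negP => hu.
  have : 4^-1 < u ^+ 2.
    by rewrite (_ : 4^-1 = 2^-1 ^+ 2); [rewrite ltrXn2r|by field].
  have := ler_wpM2l (ltW l0) (ltW hu).
  move=> _ hu2.
  have : 2 ^+ l * 4^-1 < 2 ^+ l * u ^+ 2 by rewrite ltr_pM2l.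
  lra.
have key := one_sub_exp_ge h p01; rewrite -/u in key.
have hp : h%:R * p <= 2 * u.
  have : u * (h%:R * p) <= 2^-1 * (h%:R * p) by rewrite ler_wpM2r// mulr_ge0.
  lra.
have hp2 : (h%:R * p) ^+ 2 <= 4 * u ^+ 2.
  rewrite (_ : 4 * u ^+ 2 = (2 * u) ^+ 2); last by ring.
  by rewrite lerXn2r// nnegrE mulr_ge0// ltW.
rewrite ler_pdivlMr ?exprn_gt0// hR.
rewrite (_ : p ^+ 2 * _ = 8 * h%:R * (h%:R * p) ^+ 2); last by ring.
apply: (@le_trans _ _ (8 * h%:R * (4 * u ^+ 2))).
  by rewrite ler_wpM2l// mulr_ge0// ltW.
rewrite hR in u2B; lra.
Unshelve. all: by end_near. Qed.

(** [dyadic_tail] at r = 2^(3l/10): here r^2 = 2^(3l/5) eventually exceeds the threshold, of order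
    2^(l/2) sqrt l, and the bound 2^(-3l/2) is r^-5. *)
Lemma tail_exp : exists K : R, 0 <= K /\
  forall t, 0 <= t -> tail_prob (expR t) <= K * expR (- (5 * t)).
Proof.
have [K0 hK] := dyadic_tail.
pose g : R := ln 2.
have g0 : 0 < g by rewrite ln_gt0// ltr1n.
have e2 : expR g = 2 by rewrite lnK// posrE.
have [L hL] : exists L, forall l, (L <= l)%N ->
    tail_prob (expR (3 / 10 * (l%:R * g))) ^+ 2 <= K0 * (2 ^+ l) ^- 3.
  have big : \forall l \near \oo, 200 <= l.+1%:R * g.
    have [N _ hN] := nbhs_infty_ger (200 / g).
    exists N => // l /= Nl; rewrite -ler_pdivrMr//.
    by apply: le_trans (hN l Nl) _; rewrite ler_nat.
  have [L _ h] := filterI hK big.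
  exists L => l Ll; have [h1 h2] := h l Ll; apply: h1; first exact: expR_ge0.
  set s := l.+1%:R * g in h2.
  have sE : ln ((2 ^ l.+1)%:R : R) = s by rewrite natrX lnXn// -[LHS]mulr_natl.
  have nE : (2 ^ l.+1)%:R = expR s by rewrite natrX -e2 -expRM_natl.
  rewrite /scale sE nE.
  have -> : expR (3 / 10 * (l%:R * g)) ^+ 2 = Num.sqrt (expR (6 / 5 * (l%:R * g))).
    rewrite -expRM_natl -[LHS]ger0_norm ?expR_ge0// -sqrtr_sqr -expRM_natl.
    by congr (Num.sqrt (expR _)); field.
  apply: ler_wsqrtr.
  have lg : l%:R * g = s - g by rewrite /s -natr1; ring.
  rewrite lg.
  have s0 : 0 <= s / 5 by lra.
  (* It remains to see s e^(6g/5) <= e^(s/5). The left side is at most 4 s, the right at least s^2 /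
     50, and s >= 200. *)
  have e := expR_ge1Dxn 1 s0; rewrite (_ : 2`! = 2)%N// in e.
  rewrite (_ : 6 / 5 * (s - g) = s + (s / 5 - 6 / 5 * g)); last by field.
  rewrite expRD ler_wpM2l ?expR_ge0// expRB ler_pdivlMr ?expR_gt0//.
  have e4 : expR (6 / 5 * g) <= 4.
    apply: (@le_trans _ _ (expR (2 * g))); first by rewrite ler_expR; lra.
    by rewrite expRM_natl e2 expr2; lra.
  have ss : 4 * s <= s ^+ 2 / 50.
    have : 200 * s <= s * s by rewrite ler_wpM2r//; lra.
    by rewrite expr2; lra.
  have : s * expR (6 / 5 * g) <= s * 4 by rewrite ler_wpM2l//; lra.
  rewrite expr_div_n in e; lra.
have K00 : 0 <= K0.
  have := hL L (leqnn L); have := sqr_ge0 (tail_prob (expR (3 / 10 * (L%:R * g)))).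
  move=> h1 h2; have := le_trans h1 h2.
  by rewrite pmulr_lge0// invr_gt0 exprn_gt0// exprn_gt0.
pose K1 := Num.sqrt K0 * expR (3 / 2 * g).
pose K2 := expR (5 * (3 / 10 * (L%:R * g))).
have K10 : 0 <= K1 by rewrite mulr_ge0 ?sqrtr_ge0 ?expR_ge0.
exists (K1 + K2); split; first by rewrite addr_ge0// expR_ge0.
move=> t t0.
have c0 : 0 < 3 / 10 * g by rewrite mulr_gt0.
have [tL|Lt] := ltP t (3 / 10 * (L%:R * g)).
  apply: (le_trans (tail_prob_le1 _)).
  rewrite [leRHS]mulrDl; apply: (@le_trans _ _ (K2 * expR (- (5 * t)))); last first.
    by rewrite lerDr mulr_ge0// expR_ge0.
  by rewrite /K2 -expRD -[leLHS]expR0 ler_expR; lra.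
(* The last grid point with 2^(3l/10) <= e^t. Rounding t down costs at most the factor e^(3g/2) in
   K1, while K2 makes the bound trivial for t before the grid starts. *)
pose l := Num.truncn (t / (3 / 10 * g)).
have tc0 : 0 <= t / (3 / 10 * g) by rewrite divr_ge0// ltW.
have /andP[l1 l2] := truncn_itv tc0.
rewrite -/l in l1 l2.
have Ll : (L <= l)%N.
  rewrite -ltnS -(ltr_nat R); apply: le_lt_trans l2.
  by rewrite ler_pdivlMr// (_ : L%:R * _ = 3 / 10 * (L%:R * g))//; ring.
rewrite ler_pdivlMr// in l1; rewrite ltr_pdivrMr// in l2.
have tl : 3 / 10 * (l%:R * g) <= t by lra.
have := hL l Ll.
set p := tail_prob (expR (3 / 10 * (l%:R * g))) => hp.
have pt : tail_prob (expR t) <= p by apply: tail_prob_mono; rewrite ler_expR.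
have p0 : 0 <= p by exact: tail_prob_ge0.
have pK : p <= Num.sqrt K0 * expR (- (3 / 2 * (l%:R * g))).
  rewrite -(@ger0_norm _ p)// -sqrtr_sqr.
  rewrite -(@ger0_norm _ (expR _)) ?expR_ge0// -sqrtr_sqr -sqrtrM//.
  apply: ler_wsqrtr; apply: (le_trans hp); rewrite ler_wpM2l//.
  have -> : 2 ^+ l = expR (l%:R * g) by rewrite expRM_natl e2.
  by rewrite -!expRM_natl -expRN le_eqVlt; apply/orP; left; apply/eqP; congr expR; field.
apply: (le_trans pt); apply: (le_trans pK).
rewrite [leRHS]mulrDl; apply: (@le_trans _ _ (K1 * expR (- (5 * t)))); last first.
  by rewrite lerDl mulr_ge0// expR_ge0.
rewrite /K1 -[leRHS]mulrA ler_wpM2l ?sqrtr_ge0// -expRD ler_expR.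
rewrite -subr_ge0 (_ : _ - _ = 5 * (l.+1%:R * (3 / 10 * g) - t)).
  by rewrite mulr_ge0// subr_ge0 ltW.
by rewrite -natr1; field.
Qed.

End tail_bound.

Lemma near_expR_le (R : realType) (a b K : R) : a < b ->
  \forall n \near \oo, K * expR (a * ln n%:R) <= expR (b * ln (n%:R : R)).
Proof.
move=> ab; have ba : 0 < b - a by rewrite subr_gt0.
near=> n.
have h : K / (b - a) <= ln (n%:R : R) by near: n; exact: near_ln_ge.
rewrite ler_pdivrMr// in h.
have -> : b * ln n%:R = (b - a) * ln n%:R + a * ln (n%:R : R) by ring.
rewrite expRD ler_wpM2r ?expR_ge0//.
have := expR_ge1Dx ((b - a) * ln (n%:R : R)); lra.
Unshelve. all: by end_near. Qed.

(** * Fourth moments *)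

Section moments.
Context d (T : measurableType d) (R : realType) (P : probability T R).
Variable X : nat -> nat -> T -> R.
Hypothesis mX : forall k i, measurable_fun setT (X k i).
Local Notation Y := (fun ki : nat * nat => X ki.1 ki.2).
Hypothesis dX : identically_distributed P setT Y.
Variable K : R.
Hypothesis K0 : 0 <= K.
Hypothesis tailK : forall t, 0 <= t -> tail_prob P X (expR t) <= K * expR (- (5 * t)).

(** Layers of exponential height: weight e^(4l) against probability O(e^(-5l)) leaves a geometric
    series of ratio 1 / e. *)
Lemma integ_fourth k i : integ P (fun w => X k i w ^+ 4).
Proof.
have mX4 : measurable_fun setT (fun w => X k i w ^+ 4) by exact: measurable_funX.
(* The shift by one lets the weight e^(4l) dominate X^4 where e^(l-1) <= |X| < e^l; layer 0 takes
   care of |X| <= 1. *)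
pose A (l : nat) : set T := if l is l'.+1 then [set w | expR l'%:R <= `|X k i w|] else setT.
have mA l : measurable (A l) by case: l => //= l; exact: measurable_tail.
pose f (l : nat) (w : T) : \bar R := (expR (4 * l%:R) * \1_(A l) w)%:E.
have mf l : measurable_fun setT (f l).
  by apply/measurable_EFinP; apply: measurable_funM => //; exact: measurable_indic.
have f0 l w : setT w -> (0 <= f l w)%E.
  by move=> _; rewrite lee_fin mulr_ge0 ?expR_ge0.
have mS : measurable_fun setT (fun w => \sum_(0 <= l <oo) f l w)%E.
  by apply: ge0_emeasurable_sum => // l w _ _; exact: f0.
have point w : ((X k i w ^+ 4)%:E <= \sum_(0 <= l <oo) f l w)%E.
  have [L hL] : exists L, A L w /\ X k i w ^+ 4 <= expR (4 * L%:R).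
    have [x1|x1] := leP `|X k i w| 1.
      exists 0%N; split => //; rewrite mulr0 expR0.
      rewrite -[X k i w ^+ 4]ger0_norm ?exprn_even_ge0// normrX.
      by rewrite exprn_ile1.
    have x0 : 0 < `|X k i w| by exact: lt_trans x1.
    pose s := ln `|X k i w|.
    have sE : `|X k i w| = expR s by rewrite lnK.
    have s0 : 0 <= s by rewrite ln_ge0// ltW.
    have /andP[l1 l2] := truncn_itv s0.
    exists (Num.truncn s).+1; split; first by rewrite /= sE ler_expR.
    rewrite -[X k i w ^+ 4]ger0_norm ?exprn_even_ge0// normrX sE -expRM_natl ler_expR.
    by rewrite ler_wpM2l// ltW.
  case: hL => AL hL.
  apply: (@le_trans _ _ (f L w)).
    by rewrite lee_fin /f indicE mem_set// mulr1.
  apply: (@le_trans _ _ (\sum_(0 <= l < L.+1) f l w)%E); last first.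
    by apply: (nneseries_lim_ge (P := xpredT)) => l _ _; exact: f0.
  rewrite big_nat_recr//= leeDr//; apply: sume_ge0 => l _; exact: f0.
have If l : (\int[P]_w f l w = (expR (4 * l%:R))%:E * P (A l))%E.
  rewrite /f; under eq_integral do rewrite EFinM.
  rewrite ge0_integralZl//.
  - by rewrite integral_indic// setIT.
  - by apply/measurable_EFinP; exact: measurable_indic.
pose K' : R := 1 + K * expR 5.
have K'0 : 0 <= K' by rewrite addr_ge0// mulr_ge0// expR_ge0.
have PA l : (P (A l) <= (K' * expR (- (5 * l%:R)))%:E)%E.
  case: l => [|l].
    rewrite /= (probability_setT P) mulr0 oppr0 expR0 mulr1 lee_fin lerDl.
    by rewrite mulr_ge0// expR_ge0.
  rewrite /A (tail_probE mX dX) lee_fin.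
  have l0 : (0 : R) <= l%:R by [].
  apply: (le_trans (tailK l0)).
  rewrite (_ : K' * expR (- (5 * l.+1%:R)) = expR (- (5 * l.+1%:R)) +
    K * (expR 5 * expR (- (5 * l.+1%:R)))); last by rewrite /K'; ring.
  rewrite -expRD.
  have -> : 5 + - (5 * l.+1%:R) = - (5 * l%:R) :> R by rewrite -natr1; ring.
  by rewrite lerDr expR_ge0.
apply/integrableP; split; first exact/measurable_EFinP.
apply: (@le_lt_trans _ _ (\int[P]_w (\sum_(0 <= l <oo) f l w))%E).
  apply: ge0_le_integral => //.
  - by apply: measurableT_comp => //; exact/measurable_EFinP.
  - by move=> w _ /=; rewrite ger0_norm ?exprn_even_ge0.
rewrite integral_nneseries//.
pose q : R := expR (- 1).
have q1 : q < 1 by rewrite expR_lt1 oppr_lt0.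
have q0 : 0 < q by exact: expR_gt0.
apply: (@le_lt_trans _ _ (K' / (1 - q))%:E); last by rewrite ltry.
apply: nneseries_le => [l|N]; first by rewrite If mule_ge0// lee_fin expR_ge0.
apply: (@le_trans _ _ (\sum_(0 <= l < N) (K' * q ^+ l)%:E)%E).
  apply: lee_sum => l _; rewrite If.
  apply: (@le_trans _ _ ((expR (4 * l%:R))%:E * (K' * expR (- (5 * l%:R)))%:E)%E).
    by rewrite lee_wpmul2l// lee_fin expR_ge0.
  rewrite -EFinM lee_fin mulrCA -expRD /q -expRM_natl ler_wpM2l// ler_expR; lra.
rewrite sumEFin lee_fin -mulr_sumr ler_wpM2l//.
rewrite -[leRHS]mul1r ler_pdivlMr ?subr_gt0//.
have : (1 - q) * (\sum_(0 <= l < N) q ^+ l) = 1 - q ^+ N.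
  by rewrite big_mkord -(opprB q) mulNr -subrX1 opprB.
by rewrite mulrC => ->; rewrite gerBl exprn_ge0// ltW.
Qed.

Lemma Rint_ident (f : R -> R) k i : measurable_fun setT f ->
  (forall k i, integ P (fun w => f (X k i w))) ->
  \int[P]_w f (X k i w) = \int[P]_w f (X 0 0 w).
Proof.
move=> mf intf.
pose Xm k i : {mfun T >-> R} := HB.pack (X k i) (isMeasurableFun.Build _ _ _ _ _ (mX k i)).
have E k' i' : (\int[P]_w (f (X k' i' w))%:E = \int[distribution P (Xm k' i')]_x (f x)%:E)%E.
  rewrite (@integral_distribution _ _ _ _ _ P (Xm k' i') (EFin \o f))//.
    exact/measurable_EFinP.
  exact: intf.
rewrite /Rintegral !E; congr fine; apply: eq_measure_integral => B mB _.
exact: (dX (i := (k, i)) (j := (0, 0)%N) I I mB).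
Qed.

Lemma integ_dominated (f : R -> R) (c : R) k i : measurable_fun setT f ->
  (forall x, `|f x| <= c * (1 + x ^+ 4)) -> integ P (fun w => f (X k i w)).
Proof.
move=> mf fc; apply: (@integ_le _ _ _ _ _ (fun w => c * (1 + X k i w ^+ 4))).
- exact: measurableT_comp.
- by move=> w; exact: fc.
- by apply: integZ; apply: integD; [exact: integ_cst|exact: integ_fourth].
Qed.

End moments.

(** * Passage to standardized entries *)

Section standardization.
Context d (T : measurableType d) (R : realType) (P : probability T R).
Variable X : nat -> nat -> T -> R.
Hypothesis mX : forall k i, measurable_fun setT (X k i).
Local Notation Y := (fun ki : nat * nat => X ki.1 ki.2).
Hypothesis iX : mutually_independent P setT Y.
Hypothesis dX : identically_distributed P setT Y.
Hypothesis summable :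
  (\sum_(0 <= n <oo) P (row_event X 0 (iota 0 n) (scale R n)) < +oo)%E.
Hypothesis nondegenerate : ~ exists c : R, P [set w | X 0 0 w = c] = 1%E.

(** The tail exponent 5 at level n^(11/25) gives n^(-11/5), and n^2 entries leave n^(-1/5), summable
    at n = 2^l. *)
Lemma entries_bound (M : nat) :
  {ae P, forall w, \forall n \near \oo, forall k i, (k < M * n)%N -> (i < M * n)%N ->
     `|X k i w| <= expR (11 / 25 * ln n%:R)}.
Proof.
have [K [K0 hK]] := tail_exp mX iX dX summable.
pose r (l : nat) : R := expR (11 / 25 * ln (1 * 2 ^ l)%:R).
pose bad M' l := \big[setU/set0]_(ki <- [seq (k, i) | k <- iota 0 (M' * 2 ^ l), i <- iota 0 (M' * 2 ^ l)])
  [set w | r l <= `|X ki.1 ki.2 w|].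
have mbad M' l : measurable (bad M' l).
  by apply: bigsetU_measurable => ki _; exact: measurable_tail.
have good M' : {ae P, forall w, \forall l \near \oo, ~ bad M' l w}.
  apply: (@borel_cantelli_geometric _ _ _ P _ 1 (M'%:R ^+ 2 * K) 5^-1) => //.
  apply: nearW => l; set s := ln (1 * 2 ^ l)%:R.
  have s0 : 0 <= s by rewrite ln_ge0// ler1n mul1n expn_gt0.
  have sE : (2 ^ l)%:R = expR s by rewrite /s mul1n lnK// posrE ltr0n expn_gt0.
  have Pk (ki : nat * nat) : (P [set w | (r l <= `|X ki.1 ki.2 w|)%R] <=
      (K * expR (- (5 * (11 / 25 * s))))%:E)%E.
    by rewrite (tail_probE mX dX) lee_fin; apply: hK; rewrite mulr_ge0.
  apply: (le_trans (union_bound (fun ki _ => measurable_tail mX _ _ _) (fun ki _ => Pk ki))).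
  rewrite size_allpairs size_iota lee_fin !natrM sE.
  rewrite (_ : _ * (K * _) = M'%:R ^+ 2 * K *
    (expR s ^+ 2 * expR (- (5 * (11 / 25 * s))))); last by ring.
  rewrite ler_wpM2l ?mulr_ge0 ?exprn_ge0// -expRM_natl -expRD ler_expR; lra.
have : {ae P, forall w, forall c, \forall l \near \oo, ~ bad (M * c.+1)%N l w}.
  by apply: ae_foralln => c; exact: good.
apply: filterS => w hw; apply: (@near_blocks 0) => c c1.
apply: filterS (hw c) => l hl n /andP[n1 n2] k i kn in'.
have nM : (M * n <= M * c.+1 * 2 ^ l)%N.
  by rewrite -mulnA leq_mul2l (leq_trans n2) ?orbT// mulSn addnC.
have l2n : (2 ^ l <= n)%N by apply: leq_trans n1; rewrite leq_pmull.
apply: (@le_trans _ _ (r l)); last first.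
  rewrite /r mul1n ler_expR ler_wpM2l// ler_ln ?posrE ?ltr0n ?expn_gt0// ?ler_nat//.
  by rewrite (leq_trans _ l2n)// expn_gt0.
rewrite leNgt; apply/negP => /ltW h; apply: hl; rewrite /bad -bigcup_seq.
exists (k, i) => //; apply/allpairsP; exists (k, i).
by rewrite !mem_iota !add0n /= !(leq_trans _ nM).
Qed.

Lemma standardization : exists m v C : R, 0 < v /\
  [/\ std_array P (fun k i w => (X k i w - m) / v) C,
      small_products P (fun k i w => (X k i w - m) / v) &
      small_entries P (fun k i w => (X k i w - m) / v)].
Proof.
have [K [K0 hK]] := tail_exp mX iX dX summable.
have i4 := integ_fourth mX dX K0 hK.
pose m : R := \int[P]_w X 0 0 w.
have pow1 (x : R) : `|x| <= 1 * (1 + x ^+ 4).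
  by rewrite mul1r -[`|x|]expr1; exact: pow_le_1D4.
have pow2 (x : R) : x ^+ 2 <= 1 * (1 + x ^+ 4).
  by rewrite mul1r -[x ^+ 2]real_normK ?num_real//; exact: pow_le_1D4.
have mid : measurable_fun setT (fun x : R => x) by exact: measurable_id.
have i1 k i : integ P (X k i).
  exact: (@integ_dominated _ _ _ _ _ mX dX K K0 hK (fun x => x) 1).
have E1 k i : \int[P]_w X k i w = m by exact: (@Rint_ident _ _ _ _ _ mX dX (fun x => x)).
have msq : measurable_fun setT (fun x : R => (x - m) ^+ 2).
  by apply: measurable_funX; exact: measurable_funB.
have sq_le (x : R) : `|(x - m) ^+ 2| <= (2 + 2 * m ^+ 2) * (1 + x ^+ 4).
  rewrite ger0_norm ?sqr_ge0//.
  have := pow2 x; have := sqr_ge0 (x + m); have : 0 <= x ^+ 4 by rewrite exprn_even_ge0.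
  have m2 := sqr_ge0 m => x4; have := mulr_ge0 m2 x4.
  rewrite !expr2; lra.
have i2 k i : integ P (fun w => (X k i w - m) ^+ 2).
  exact: (@integ_dominated _ _ _ _ _ mX dX K K0 hK (fun x => (x - m) ^+ 2) _ _ _ msq sq_le).
pose v2 : R := \int[P]_w ((X 0 0 w - m) ^+ 2).
have E2 k i : \int[P]_w ((X k i w - m) ^+ 2) = v2.
  exact: (@Rint_ident _ _ _ _ _ mX dX (fun x => (x - m) ^+ 2)).
(* A vanishing variance would make X equal to its mean almost surely, against nondegeneracy. *)
have v20 : 0 < v2.
  rewrite lt_neqAle Rintegral_ge0 ?andbT; last by move=> w _; exact: sqr_ge0.
  apply/eqP => v0; apply: nondegenerate; exists m.
  have mA : measurable [set w | X 0 0 w = m].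
    by rewrite -[X in measurable X]setTI; exact: (mX 0 0 measurableT (measurable_set1 m)).
  have z : (\int[P]_w `|((X 0 0 w - m) ^+ 2)%:E| = 0)%E.
    transitivity (\int[P]_w ((X 0 0 w - m) ^+ 2)%:E)%E.
      by apply: eq_integral => w _; rewrite gee0_abs// lee_fin sqr_ge0.
    by rewrite -[LHS]fineK ?(integrable_fin_num _ (i2 0 0))// -[fine _]/v2 -v0.
  have m2 : measurable_fun setT (fun w => ((X 0 0 w - m) ^+ 2)%:E).
    by apply/measurable_EFinP; exact: integ_measurable (i2 0 0).
  have /(ae_eq_integral_abs P measurableT m2)[N [mN N0 hN]] := z.
  have : P (~` [set w | X 0 0 w = m]) = 0%E.
    apply/eqP; rewrite eq_le measure_ge0 andbT -N0; apply: le_measure; rewrite ?inE//.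
      exact: measurableC.
    apply: subset_trans hN => w /= hw h; apply: hw.
    have := h I; rewrite /cst => -[] /eqP; rewrite sqrf_eq0 subr_eq0 => /eqP.
    by [].
  rewrite probability_setC// => /eqP; rewrite sube_eq ?fin_num_measure// add0e.
  by move=> /eqP <-.
pose v : R := Num.sqrt v2.
have v0 : 0 < v by rewrite sqrtr_gt0.
have vv : v ^+ 2 = v2 by rewrite sqr_sqrtr// ltW.
pose Z k i w : R := (X k i w - m) / v.
pose phi (x : R) : R := (x - m) / v.
have mphi : measurable_fun setT phi.
  by apply: measurable_funM => //; exact: measurable_funB.
pose q (x : R) : R := phi x ^+ 4.
have mq : measurable_fun setT q by exact: measurable_funX.
have q_le (x : R) : `|q x| <= 8 * (1 + m ^+ 4) / v ^+ 4 * (1 + x ^+ 4).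
  rewrite /q /phi ger0_norm ?exprn_even_ge0// expr_div_n [leRHS]mulrAC ler_wpM2r//.
    by rewrite invr_ge0 exprn_even_ge0.
  have m4 : 0 <= m ^+ 4 by rewrite exprn_even_ge0.
  have x4 : 0 <= x ^+ 4 by rewrite exprn_even_ge0.
  apply: (@le_trans _ _ (8 * (x ^+ 4 + m ^+ 4))); last first.
    by have := mulr_ge0 m4 x4; lra.
  have s1 := sqr_ge0 (x + m); have s2 := sqr_ge0 (x ^+ 2 - m ^+ 2).
  have h1 : (x - m) ^+ 2 <= 2 * (x ^+ 2 + m ^+ 2).
    by rewrite -subr_ge0; move: s1; rewrite !expr2; lra.
  have -> : (x - m) ^+ 4 = ((x - m) ^+ 2) ^+ 2 by rewrite -exprM.
  apply: (@le_trans _ _ ((2 * (x ^+ 2 + m ^+ 2)) ^+ 2)).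
    by rewrite lerXn2r// nnegrE ?sqr_ge0// mulr_ge0// addr_ge0 ?sqr_ge0.
  rewrite -subr_ge0 (_ : _ - _ = 4 * (x ^+ 2 - m ^+ 2) ^+ 2); last by ring.
  by rewrite mulr_ge0.
have iZ4 k i : integ P (fun w => Z k i w ^+ 4).
  exact: (@integ_dominated _ _ _ _ _ mX dX K K0 hK q _ _ _ mq q_le).
exists m, v, (\int[P]_w (Z 0 0 w ^+ 4)); split => //; split.
- split.
  + by move=> k i; exact: (measurableT_comp mphi (mX k i)).
  + move=> J B uJ hJ mB.
    have mB' j : measurable (phi @^-1` B j) by rewrite -[X in measurable X]setTI; exact: mphi.
    exact: (iX uJ (fun _ _ => I) mB').
  + exact: iZ4.
  + move=> k i; rewrite (@Rint_ident _ _ _ _ _ mX dX q k i)//.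
  + move=> k i.
    rewrite (_ : \int[P]_w _ = \int[P]_w (v^-1 * (X k i w - m))); last first.
      by congr fine; apply: eq_integral => w _; rewrite mulrC.
    have iB : integ P (fun w => X k i w - m) by apply: integB => //; exact: integ_cst.
    rewrite RintegralZl// RintegralB//; [|exact: i1|exact: integ_cst].
    by rewrite Rintegral_prob_cst E1 subrr mulr0.
  + move=> k i.
    rewrite (_ : \int[P]_w _ = \int[P]_w (v^-2 * (X k i w - m) ^+ 2)); last first.
      by congr fine; apply: eq_integral => w _; rewrite exprMn exprVn mulrC.
    rewrite RintegralZl//; last exact: i2.
    by rewrite E2 -vv mulVf// gt_eqF// exprn_gt0.
- move=> M e e0.
  (* One half of e is for the product itself, the other for the terms with m, which are O(n^(11/25))
     and hence o(sqrt (n log n)). *)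
  have e2 : 0 < e * v2 / 2 by rewrite divr_gt0// mulr_gt0.
  have sp := @small_products_X _ _ _ P X mX iX dX summable M _ e2.
  have small : \forall n \near \oo, 2 * `|m| * expR (11 / 25 * ln n%:R) + m ^+ 2 <=
      e * v2 / 2 * scale R n.
    have lt1 : 11 / 25 < 2^-1 :> R by lra.
    have lt2 : 0 < 2^-1 :> R by [].
    have n1 := near_expR_le (8 * `|m| / (e * v2)) lt1.
    have n2 := near_expR_le (4 * m ^+ 2 / (e * v2)) lt2.
    have ev : 0 < e * v2 by rewrite mulr_gt0.
    apply: filterS3 n1 n2 (near_ln_ge (1 : R)) => n n1 n2 s1.
    have s0 : 0 < ln (n%:R : R) by exact: lt_le_trans s1.
    have sc : expR (2^-1 * ln n%:R) <= scale R n.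
      rewrite scaleE sqrt_nat_expR// (mulrC 2^-1) -[leLHS]mulr1 ler_wpM2l ?expR_ge0//.
      by rewrite -[leLHS](@sqrtr1 R) ler_wsqrtr.
    rewrite mul0r expR0 mulr1 in n2.
    rewrite mulrAC ler_pdivrMr// in n1; rewrite ler_pdivrMr// in n2.
    have := ler_wpM2l (ltW ev) sc; lra.
  apply: filterS2 sp (entries_bound M) => w h1 h2.
  apply: filterS3 h1 h2 small => n h1 h2 small k i j kn in' jn ij.
  have a1 := h1 k i j kn in' jn ij.
  have a2 := h2 k i kn in'; have a3 := h2 k j kn jn.
  have -> : (X k i w - m) / v * ((X k j w - m) / v) =
      (X k i w * X k j w - m * (X k i w + X k j w) + m ^+ 2) / v2.
    by rewrite -vv; field; rewrite gt_eqF.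
  rewrite normrM normfV (gtr0_norm v20) ler_pdivrMr//.
  apply: (le_trans (ler_normD _ _)); rewrite [`|m ^+ 2|]ger0_norm ?sqr_ge0//.
  have b1 := ler_normB (X k i w * X k j w) (m * (X k i w + X k j w)).
  have b2 : `|m * (X k i w + X k j w)| <= 2 * `|m| * expR (11 / 25 * ln n%:R).
    rewrite normrM -mulrA mulrCA ler_wpM2l//.
    by have := ler_normD (X k i w) (X k j w); lra.
  lra.
- move=> M.
  (* The gap between 11/25 and 9/20 absorbs the affine change. *)
  have small : \forall n \near \oo, expR (11 / 25 * ln n%:R) + `|m| <=
      v * expR (9 / 20 * ln n%:R).
    have lt1 : 11 / 25 < 9 / 20 :> R by lra.
    have lt2 : 0 < 9 / 20 :> R by lra.
    have n1 := near_expR_le (2 / v) lt1.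
    have n2 := near_expR_le (2 * `|m| / v) lt2.
    apply: filterS2 n1 n2 => n n1 n2.
    rewrite mul0r expR0 mulr1 in n2.
    rewrite mulrAC ler_pdivrMr// in n1; rewrite ler_pdivrMr// in n2.
    lra.
  apply: filterS (entries_bound M) => w h2.
  apply: filterS2 h2 small => n h2 small k i kn in'.
  rewrite normrM normfV (gtr0_norm v0) ler_pdivrMr// mulrC.
  have := ler_normB (X k i w) m; have := h2 k i kn in'; lra.
Qed.

End standardization.

(** * Sample correlations *)

Section sample_correlation.
Context (R : realType) (T : Type).
Variables (X Z : nat -> nat -> T -> R) (m v : R).
Hypothesis v0 : 0 < v.
Hypothesis XZ : forall k i w, X k.+1 i.+1 w = v * Z k i w + m.

Definition col_sum n i w : R := \sum_(0 <= k < n) Z k i w.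
Definition inner n i j w : R := \sum_(0 <= k < n) Z k i w * Z k j w.
(** This is n times the empirical covariance of columns i and j of Z. *)
Definition centered n i j w : R := inner n i j w - col_sum n i w * col_sum n j w / n%:R.

Lemma centeredE n i j w : (0 < n)%N ->
  \sum_(1 <= k < n.+1) (X k i.+1 w - colmean X n i.+1 w) * (X k j.+1 w - colmean X n j.+1 w) =
  v ^+ 2 * centered n i j w.
Proof.
move=> n0; have nn : n%:R != 0 :> R by rewrite pnatr_eq0 -lt0n.
have cm a : colmean X n a.+1 w = v * (col_sum n a w / n%:R) + m.
  rewrite /colmean big_add1 /=; under eq_bigr do rewrite XZ.
  rewrite big_split/= -mulr_sumr sumr_const_nat subn0 -/(col_sum n a w) -mulr_natr.
  by field.
rewrite big_add1 /= !cm; set a := col_sum n i w / n%:R; set b := col_sum n j w / n%:R.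
under eq_bigr => k _.
  rewrite !XZ (_ : _ * _ = v ^+ 2 * (Z k i w * Z k j w) - v ^+ 2 * b * Z k i w
    - v ^+ 2 * a * Z k j w + v ^+ 2 * a * b); last by ring.
  over.
rewrite big_split/= sumrB sumrB -!mulr_sumr sumr_const_nat subn0.
rewrite -/(col_sum n i w) -/(col_sum n j w) -/(inner n i j w) -[_ *+ n]mulr_natr /a /b /centered.
by field.
Qed.

Lemma sample_corrE n i j w : (0 < n)%N ->
  sample_corr X n i.+1 j.+1 w =
  centered n i j w / (Num.sqrt (centered n i i w) * Num.sqrt (centered n j j w)).
Proof.
move=> n0; rewrite /sample_corr.
have sq a : Num.sqrt (\sum_(1 <= k < n.+1) (X k a.+1 w - colmean X n a.+1 w) ^+ 2) =
    v * Num.sqrt (centered n a a w).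
  under eq_bigr do rewrite expr2.
  rewrite centeredE// sqrtrM ?sqr_ge0// sqrtr_sqr gtr0_norm//.
rewrite !sq centeredE// (_ : v * _ * (v * _) =
  v ^+ 2 * (Num.sqrt (centered n i i w) * Num.sqrt (centered n j j w))); last by ring.
by rewrite -mulf_div divff ?mul1r// gt_eqF// exprn_gt0.
Qed.

End sample_correlation.

(** * From inner products to correlations *)

Section correlation_bounds.
Context (R : realType) (T : Type).
Variables (Z : nat -> nat -> T -> R) (w : T) (n : nat) (y : R).
Hypothesis y0 : 0 < y.
Hypothesis y1 : 20 * y <= 1.
Hypothesis ln_big : y ^- 2 <= ln (n%:R : R).
Local Notation good i := (`|col_sum Z n i w| <= expR (3 / 4 * ln n%:R) /\
    `|\sum_(0 <= k < n) (Z k i w ^+ 2 - 1)| <= y * n%:R).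

Let s0 : 0 < ln (n%:R : R).
Proof. by apply: lt_le_trans ln_big; rewrite invr_gt0 exprn_gt0. Qed.

Let n0 : 0 < n%:R :> R.
Proof. by rewrite nat_expR// expR_gt0. Qed.

(** This is how [ln_big] enters: it makes sqrt n at most y times the scale. *)
Let ys : 1 <= y * Num.sqrt (ln n%:R).
Proof.
have : Num.sqrt (y ^- 2) <= Num.sqrt (ln (n%:R : R)) by exact: ler_wsqrtr.
by rewrite -exprVn sqrtr_sqr gtr0_norm ?invr_gt0// -[leLHS]mulr1 ler_pdivrMl.
Qed.

Let y2 : 0 < 1 - 2 * y.
Proof. by move: (y0) (y1); lra. Qed.

Lemma cross_term_le i j : good i -> good j ->
  `|col_sum Z n i w * col_sum Z n j w / n%:R| <= Num.sqrt n%:R.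
Proof.
move=> [gi _] [gj _].
rewrite normrM normfV (gtr0_norm n0) ler_pdivrMr// normrM.
apply: (le_trans (ler_pM _ _ gi gj)) => //.
rewrite sqrt_nat_expR// [X in _ <= _ * X](nat_expR s0) -!expRD ler_expR; lra.
Qed.

Lemma sqrt_le_scale : Num.sqrt n%:R <= y * scale R n.
Proof.
rewrite scaleE mulrCA -[leLHS]mulr1 ler_wpM2l// sqrtr_ge0.
Qed.

Lemma sqrt_le_n : Num.sqrt n%:R <= y * n%:R.
Proof.
have q0 : 0 <= Num.sqrt n%:R :> R by rewrite sqrtr_ge0.
have -> : n%:R = Num.sqrt n%:R ^+ 2 :> R by rewrite sqr_sqrtr// ltW.
rewrite sqrtr_sqr ger0_norm// expr2 mulrA -[leLHS]mul1r ler_wpM2r//.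
apply: (le_trans ys); rewrite ler_pM2l//; apply: ler_wsqrtr.
by apply: ltW; exact: ln_sublinear.
Qed.

Lemma variance_bounds i : good i ->
  (1 - 2 * y) * n%:R <= centered Z n i i w <= (1 + 2 * y) * n%:R.
Proof.
move=> gi; have [g1 g2] := gi.
have := cross_term_le gi gi; have := sqrt_le_n.
have qE : inner Z n i i w = \sum_(0 <= k < n) (Z k i w ^+ 2 - 1) + n%:R.
  rewrite sumrB sumr_const_nat subn0 subrK.
  by apply: eq_bigr => k _; rewrite expr2.
rewrite /centered qE => h1 /ler_normlP[h2 h3]; move: g2 => /ler_normlP[h4 h5].
have h6 : 0 <= col_sum Z n i w * col_sum Z n i w / n%:R.
  by rewrite divr_ge0 ?(ltW n0)// -expr2 sqr_ge0.
by apply/andP; split; lra.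
Qed.

Lemma normalization_bounds i j : good i -> good j ->
  (1 - 2 * y) * n%:R <=
    Num.sqrt (centered Z n i i w) * Num.sqrt (centered Z n j j w) <= (1 + 2 * y) * n%:R.
Proof.
move=> /variance_bounds/andP[i1 i2] /variance_bounds/andP[j1 j2].
have a0 : 0 <= (1 - 2 * y) * n%:R by rewrite mulr_ge0 ?(ltW n0)// ltW.
have b0 : 0 <= (1 + 2 * y) * n%:R by apply: le_trans a0 _; exact: le_trans i1 i2.
have sq a : 0 <= a -> a = Num.sqrt a * Num.sqrt a :> R by move=> ?; rewrite -expr2 sqr_sqrtr.
rewrite {1}(sq _ a0) {1}(sq _ b0).
by apply/andP; split; apply: ler_pM; rewrite ?sqrtr_ge0 ?ler_wsqrtr.
Qed.

Lemma scale_ratio : Num.sqrt (n%:R / ln n%:R) * scale R n = n%:R.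
Proof.
rewrite /scale -sqrtrM ?divr_ge0 ?(ltW s0)//.
rewrite (_ : _ * _ = n%:R ^+ 2); last by field; rewrite gt_eqF.
by rewrite sqrtr_sqr gtr0_norm.
Qed.

(** The numerator is at most 2 + 3 y in units of the scale and the denominator at least 1 - 2 y in
    units of n; for 20 y <= 1 the generous constant 20 covers the quotient. *)
Lemma normalized_corr_le i j : good i -> good j ->
  `|inner Z n i j w| <= (2 + 2 * y) * scale R n ->
  Num.sqrt (n%:R / ln n%:R) * `|centered Z n i j w /
    (Num.sqrt (centered Z n i i w) * Num.sqrt (centered Z n j j w))| <= 2 + 20 * y.
Proof.
move=> gi gj hij.
have /andP[b1 b2] := normalization_bounds gi gj.
set b := Num.sqrt (centered Z n i i w) * _ in b1 b2 *.
have a0 : 0 < (1 - 2 * y) * n%:R by rewrite mulr_gt0.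
have b0 : 0 < b by exact: lt_le_trans b1.
have hc : `|centered Z n i j w| <= (2 + 3 * y) * scale R n.
  apply: (le_trans (ler_normB _ _)).
  rewrite (_ : _ * scale R n = (2 + 2 * y) * scale R n + y * scale R n); last by ring.
  exact: lerD hij (le_trans (cross_term_le gi gj) sqrt_le_scale).
rewrite normrM normfV (gtr0_norm b0) mulrA ler_pdivrMr//.
apply: (@le_trans _ _ (Num.sqrt (n%:R / ln n%:R) * ((2 + 3 * y) * scale R n))).
  by rewrite ler_wpM2l ?sqrtr_ge0.
rewrite mulrCA scale_ratio.
apply: (@le_trans _ _ ((2 + 20 * y) * ((1 - 2 * y) * n%:R))); last first.
  by apply: ler_wpM2l b1; move: (y0); lra.
rewrite mulrA ler_wpM2r ?(ltW n0)//.
by have := ler_wpM2l (ltW y0) y1; move: (y0); nra.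
Qed.

Lemma normalized_corr_ge i j : good i -> good j ->
  (2 - 4 * y) * scale R n <= inner Z n i j w ->
  2 - 20 * y <= Num.sqrt (n%:R / ln n%:R) * `|centered Z n i j w /
    (Num.sqrt (centered Z n i i w) * Num.sqrt (centered Z n j j w))|.
Proof.
move=> gi gj hij.
have /andP[b1 b2] := normalization_bounds gi gj.
set b := Num.sqrt (centered Z n i i w) * _ in b1 b2 *.
have a0 : 0 < (1 - 2 * y) * n%:R by rewrite mulr_gt0.
have b0 : 0 < b by exact: lt_le_trans b1.
have hc : (2 - 5 * y) * scale R n <= `|centered Z n i j w|.
  apply: le_trans (ler_norm _); rewrite /centered.
  rewrite (_ : _ * scale R n = (2 - 4 * y) * scale R n - y * scale R n); last by ring.
  apply: lerB hij _; apply: le_trans sqrt_le_scale.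
  exact: le_trans (ler_norm _) (cross_term_le gi gj).
rewrite normrM normfV (gtr0_norm b0) mulrA ler_pdivlMr//.
apply: (@le_trans _ _ (Num.sqrt (n%:R / ln n%:R) * ((2 - 5 * y) * scale R n))); last first.
  by rewrite ler_wpM2l ?sqrtr_ge0.
rewrite [leRHS]mulrCA scale_ratio.
apply: (@le_trans _ _ ((2 - 20 * y) * ((1 + 2 * y) * n%:R))).
  by apply: ler_wpM2l b2; move: (y1); lra.
rewrite mulrA ler_wpM2r ?(ltW n0)//.
by have := sqr_ge0 y; move: (y0); rewrite expr2; lra.
Qed.

End correlation_bounds.

Theorem theorem2p4 (d : measure_display) (T : measurableType d) (R : realType)
  (P : probability T R) (X : nat -> nat -> T -> R) (p : nat -> nat) :
  iid P [set ki : nat * nat | (1 <= ki.1)%N /\ (1 <= ki.2)%N]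
      (fun ki => X ki.1 ki.2) ->
  (forall n, (1 <= n)%N -> (0 < p n)%N) ->
  (exists c1 c2 : R, 0 < c1 /\ 0 < c2 /\
     forall n, (1 <= n)%N -> c1 <= n%:R / (p n)%:R <= c2) ->
  ~ (exists c : R, P [set w | X 1%N 1%N w = c] = 1%E) ->
  (\sum_(1 <= n <oo)
     P [set w | exists i j : nat, [/\ (1 <= i)%N, (i < j)%N, (j <= n)%N &
          (Num.sqrt (n%:R * ln n%:R) <= `|X 1%N i w * X 1%N j w|)%R]] < +oo)%E ->
  {ae P, forall w,
     (fun n : nat => Num.sqrt (n%:R / ln n%:R) * Lmax X p n w) @ \oo --> (2 : R)}.
Proof.
move=> [mX iX dX] p0 [c1 [c2 [c10 [c20 hp]]]] nondeg summ.
(* Renumbered from 0, the array is i.i.d. over all pairs of natural numbers. *)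
pose X0 k i := X k.+1 i.+1.
have mX0 k i : measurable_fun setT (X0 k i) by exact: (mX (k.+1, i.+1)).
have iX0 : mutually_independent P setT (fun ki : nat * nat => X0 ki.1 ki.2).
  move=> J B uJ _ mB.
  pose sh (ki : nat * nat) := (ki.1.+1, ki.2.+1).
  have shinj : injective sh by move=> [a b] [a' b'] [-> ->].
  have := iX (map sh J) (fun ki => B (ki.1.-1, ki.2.-1)).
  rewrite map_inj_uniq// => /(_ uJ) h.
  have {}h := h _ (fun ki => mB _).
  rewrite big_map in h.
  rewrite (_ : \bigcap_(j in _) _ = \bigcap_(j in [set j | j \in map sh J])
    ((fun w => X j.1 j.2 w) @^-1` B (j.1.-1, j.2.-1))).
    rewrite h; first by apply: eq_bigr => -[a b] _.
    by move=> _ /mapP[j _ ->].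
  apply/seteqP; split => w /= hw.
    by move=> _ /mapP[j jJ ->] /=; have := hw j jJ; case: j jJ.
  move=> [a b] jJ; have := hw (sh (a, b)); apply.
  by apply/mapP; exists (a, b).
have dX0 : identically_distributed P setT (fun ki : nat * nat => X0 ki.1 ki.2).
  by move=> [a b] [a' b'] B _ _ mB; exact: (dX (a.+1, b.+1) (a'.+1, b'.+1)).
have evE n : [set w | exists i j : nat, [/\ (1 <= i)%N, (i < j)%N, (j <= n)%N &
    (Num.sqrt (n%:R * ln n%:R) <= `|X 1%N i w * X 1%N j w|)%R]] =
    row_event X0 0 (iota 0 n) (scale R n).
  apply/seteqP; split => w /=.
    move=> [i [j [i0 ij jn h]]]; case: i i0 ij h => // i _; case: j jn => // j jn ij h.
    exists i, j.
    rewrite !mem_iota !add0n /=; split => //; last by rewrite neq_ltn -ltnS ij.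
    by apply: leq_trans jn; rewrite ltnS ltnW.
  move=> [i [j []]]; rewrite !mem_iota !add0n /= => in' jn.
  rewrite neq_ltn => /orP[ij|ij] h; first by exists i.+1, j.+1.
  by exists j.+1, i.+1; split => //; rewrite [X 1 _ w * _]mulrC.
(* The added term n = 0 is the probability of an empty event. *)
have summ0 : (\sum_(0 <= n <oo) P (row_event X0 0 (iota 0 n) (scale R n)) < +oo)%E.
  apply: le_lt_trans summ; apply: nneseries_le => // N.
  apply: (@le_trans _ _ (\sum_(1 <= n < N) P (row_event X0 0 (iota 0 n) (scale R n)))%E).
    case: N => [|N]; first by rewrite !big_geq.
    rewrite big_ltn// (_ : row_event _ _ _ _ = set0) ?measure0 ?add0e//.
    by apply/seteqP; split => // w [i [j []]].
  under eq_bigr do rewrite -evE.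
  exact: (nneseries_lim_ge (P := xpredT)).
have [m [v [C [v0 [HZ sp se]]]]] := standardization mX0 iX0 dX0 summ0 nondeg.
set Z := fun k i w => (X0 k i w - m) / v in HZ sp se.
have XZ k i w : X k.+1 i.+1 w = v * Z k i w + m.
  by rewrite /Z mulrC divfK ?gt_eqF// subrK.
(* The two bounds on n / p n: M brings all p n columns into the range of the upper bound, and E
   places the large pair of the lower bound among them. *)
have [M hM] : exists M : nat, forall n, (1 <= n)%N -> (p n <= M * n)%N.
  have [M _ /(_ M (leqnn M)) hM] := nbhs_infty_ger (c1^-1).
  exists M => n n1; have /andP[h _] := hp n n1; have pn := p0 n n1.
  rewrite -(ler_nat R) natrM; rewrite ler_pdivlMr ?ltr0n// in h.
  apply: (@le_trans _ _ (c1^-1 * n%:R)); last by rewrite ler_wpM2r.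
  by rewrite ler_pdivlMl.
have [E E0 hE] : exists2 E : nat, (0 < E)%N & forall n, (1 <= n)%N -> (n <= E * p n)%N.
  have [E _ /(_ E (leqnn E)) hE] := nbhs_infty_ger c2.
  exists E; first by rewrite -(ltr0n R); exact: lt_le_trans hE.
  move=> n n1; have /andP[_ h] := hp n n1; have pn := p0 n n1.
  rewrite -(ler_nat R) natrM; rewrite ler_pdivrMr ?ltr0n// in h.
  by apply: (le_trans h); rewrite ler_wpM2r.
(* Countably many tolerances, so that the exceptional null sets can be united. *)
have key (a : nat) : {ae P, forall w, \forall n \near \oo,
    `|2 - Num.sqrt (n%:R / ln n%:R) * Lmax X p n w| <= a.+1%:R^-1}.
  pose y : R := 20^-1 * a.+1%:R^-1.
  have a1 : 0 < a.+1%:R^-1 :> R by rewrite invr_gt0 ltr0n.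
  have a2 : a.+1%:R^-1 <= 1 :> R by rewrite invf_le1 ?ltr0n// ler1n.
  have y0 : 0 < y by rewrite mulr_gt0.
  have ya : 20 * y = a.+1%:R^-1 by rewrite /y mulVKf ?pnatr_eq0.
  have y1 : 20 * y <= 1 by rewrite ya.
  have y2 : y <= 2^-1 by lra.
  have b1 := inner_products_bounds HZ M sp E0 y0 y2.
  have b2 := column_sums HZ M se y0.
  apply: filterS2 b1 b2 => w h1 h2.
  apply: filterS3 h1 h2 (filterI (near_ln_ge (y ^- 2)) (nbhs_infty_ge 1)) =>
    n [h1 [i0 [j0 [ij Ej hij]]]] h2 [lnb n1].
  set r := Num.sqrt (n%:R / ln n%:R).
  have r0 : 0 <= r by exact: sqrtr_ge0.
  have pM := hM n n1.
  have lt_pM i : (i < p n)%N -> (i < M * n)%N by move=> /leq_trans; exact.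
  have up i j : (1 <= i < (p n).+1)%N -> (i.+1 <= j < (p n).+1)%N ->
      r * `|sample_corr X n i j w| <= 2 + 20 * y.
    case: i j => [//|i] [//|j] /andP[_ ip] /andP[ij' jp].
    rewrite (sample_corrE v0 XZ)//.
    apply: (normalized_corr_le y0 y1 lnb); [exact/h2/lt_pM|exact/h2/lt_pM|].
    by apply: h1; [exact: lt_pM|exact: lt_pM|rewrite neq_ltn -ltnS ij'].
  have j0p : (j0.+1 <= p n)%N.
    by rewrite -(leq_pmul2l E0); exact: leq_trans Ej (hE n n1).
  have lo : 2 - 20 * y <= r * `|sample_corr X n i0.+1 j0.+1 w|.
    have i0p : (i0 < p n)%N by exact: ltn_trans ij j0p.
    rewrite (sample_corrE v0 XZ)//.
    by apply: (normalized_corr_ge y0 y1 lnb); [exact/h2/lt_pM|exact/h2/lt_pM|].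
  have rpos : 0 < r.
    by rewrite sqrtr_gt0 divr_gt0 ?ltr0n//; apply: lt_le_trans lnb; rewrite invr_gt0 exprn_gt0.
  have L1 : Lmax X p n w <= (2 + 20 * y) / r.
    (* The maxima in [Lmax] start from 0, so an upper bound must also be nonnegative. *)
    have q0 : 0 <= (2 + 20 * y) / r by rewrite divr_ge0// addr_ge0// mulr_ge0// ltW.
    rewrite /Lmax big_seq; apply: bigmax_le => // i; rewrite mem_index_iota => hi.
    rewrite big_seq; apply: bigmax_le => // j; rewrite mem_index_iota => hj.
    by rewrite ler_pdivlMr// mulrC; exact: up.
  have L2 : `|sample_corr X n i0.+1 j0.+1 w| <= Lmax X p n w.
    rewrite /Lmax; apply: (@bigmax_sup_seq _ _ _ _ _ i0.+1) => //.
      by rewrite mem_index_iota /= ltnS; exact: leq_trans ij (ltnW j0p).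
    apply: (@bigmax_sup_seq _ _ _ _ _ j0.+1) => //.
    by rewrite mem_index_iota /= !ltnS ij.
  have L3 : r * Lmax X p n w <= 2 + 20 * y by rewrite mulrC -ler_pdivlMr.
  have L4 : 2 - 20 * y <= r * Lmax X p n w.
    by apply: (le_trans lo); rewrite ler_wpM2l.
  by rewrite -ya ler_norml; lra.
have := ae_foralln key; apply: filterS => w hw.
apply/cvgrPdist_le => e e0.
have [a _ /(_ a (leqnn a)) ha] := nbhs_infty_ger (e^-1).
apply: filterS (hw a) => n /le_trans; apply.
rewrite -[leRHS]invrK lef_pV2 ?posrE ?invr_gt0 ?ltr0n//.
by apply: (le_trans ha); rewrite ler_nat.
Qed.
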